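(* Let $d>6$ and $L\ge1$, and suppose that critical Bernoulli bond percolation on $\mathbb{Z}^d_L$ satisfies the two-point asymptotics with amplitude $A>0$ and the two-blob estimate (both defined in the context), and let $V>0$ be the vertex factor. For each fixed $k\ge2$, $$T_{\mathrm{IIC}}(x_1,x_2,\ldots,x_k)\sim V^{k-1}A^{2k-2}\,G_{\mathrm{IIC}}(x_1,x_2,\ldots,x_k)\qquad\text{as }\min_{i\neq j}\|x_i-x_j\|\to\infty,$$ where $$G_{\mathrm{IIC}}(x_1,\ldots,x_k)=\lim_{z\to\infty}\frac{G(x_1,x_2,\ldots,x_k,z)}{G(x_1,z)}.$$
   Context: $\mathbb{Z}^d_L$ is the graph with vertex set $\mathbb{Z}^d$ in which distinct $x,y$ are adjacent iff $\|x-y\|_1\leq L$. Each edge is open independently with probability $p$; $\mathbb{P}_p$ is the law, $p_c$ the critical probability, $\leftrightarrow$ denotes connection by an open path, and $T_p(x_1,\ldots,x_k)$ is the probability that $x_1,\ldots,x_k$ all lie in one cluster. $\|\cdot\|$ is the Euclidean norm. $G(x,y)$ is the Green's function of nearest-neighbour simple random walk on $\mathbb{Z}^d$ (expected number of visits), and $G(x_1,\ldots,x_k)=\sum_{\mathcal{T}\in\mathsf{Tr}(k)}\sum_{\Phi}\prod_{\{u,v\}\in E(\mathcal{T})}G(\Phi(u),\Phi(v))$, where $\mathsf{Tr}(k)$ is a set of isomorphism-class representatives of trees with leaves labelled $1,\ldots,k$ and unlabelled internal vertices all of degree $3$, and the inner sum is over $\Phi:V(\mathcal{T})\to\mathbb{Z}^d$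 with $\Phi(i)=x_i$, $1\le i\le k$. Two-point asymptotics (amplitude $A$): $\mathbb{P}_{p_c}(x\leftrightarrow y)\sim A\,G(x,y)$ as $\|x-y\|\to\infty$ for a constant $A>0$. Two-blob estimate: the weak limit $\mathbb{P}_{\mathrm{IIC}}=\lim_{x\to\infty}\mathbb{P}_{p_c}(\cdot\mid0\leftrightarrow x)$ exists and, for each pair of cylinder events (depending on finitely many edges) $F^1,F^2$, $\mathbb{P}_{p_c}(\{x\leftrightarrow y\}\cap F^1_x\cap F^2_y)\sim\mathbb{P}_{\mathrm{IIC}}(F^1)\mathbb{P}_{\mathrm{IIC}}(F^2)\mathbb{P}_{p_c}(x\leftrightarrow y)$ as $\|x-y\|\to\infty$, where $F_x=\{\omega:\omega-x\in F\}$. ($f\sim g$ means $f/g\to1$; if $g$ is identically zero it means $f$ is eventually zero.) Under these hypotheses there is a constant $V>0$, the vertex factor, such that $T_{p_c}(x_1,\ldots,x_k)\sim V^{k-2}A^{2k-3}G(x_1,\ldots,x_k)$ as $\min_{i\ne j}\|x_i-x_j\|\to\infty$ for every fixed $k\ge2$. The IIC $k$-point function is $$T_{\mathrm{IIC}}(x_1,\ldots,x_k)=\lim_{z\to\infty}\mathbb{P}_{p_c}(x_1,\ldots,x_k\text{ all connected}\mid x_1\leftrightarrow z)=\lim_{z\to\infty}\frac{T_{p_c}(x_1,\ldots,x_k,z)}{T_{p_c}(x_1,z)}.$$ *)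

(* Defs.v *)
From HB Require Import structures.
From mathcomp Require Import all_boot all_order all_algebra all_fingroup.
From mathcomp Require Import finmap.
From mathcomp Require Import all_classical all_reals all_analysis.
Set Implicit Arguments.
Unset Strict Implicit.
Unset Printing Implicit Defensive.
Import Order.TTheory GRing.Theory Num.Theory.
Import numFieldNormedType.Exports.
Local Open Scope classical_set_scope.
Local Open Scope fset_scope.
Local Open Scope ring_scope.

(* Points of Z^d are integer row vectors, 'rV[int]_d. *)

Definition l1dist (d : nat) (x y : 'rV[int]_d) : nat :=
  (\sum_(i < d) absz (x 0 i - y 0 i)%R)%N.

(* The norm that the library puts on row vectors is the sup norm. *)
Definition enorm (R : realType) (d : nat) (x : 'rV[int]_d) : R :=
  Num.sqrt (\sum_(i < d) (x 0 i)%:~R ^+ 2).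

(* The filter "f(t) -> +oo" on the domain of f. *)
Definition tends_to_infty (R : realType) (T : Type) (f : T -> R) :
    set_system T :=
  filter_from [set: R] (fun M => [set t | M <= f t]).

Definition near_infinity (R : realType) (d : nat) : set_system 'rV[int]_d :=
  tends_to_infty (@enorm R d).

Definition far_apart (R : realType) (d : nat) :
    set_system ('rV[int]_d * 'rV[int]_d) :=
  tends_to_infty (fun xy => enorm R (xy.1 - xy.2)).

(* For k >= 2 this infimum is over a finite nonempty set: it is the minimum. *)
Definition min_separation (R : realType) (d k : nat)
    (x : k.-tuple 'rV[int]_d) : R :=
  inf [set enorm R (tnth x ij.1 - tnth x ij.2)
      | ij in [set ij : 'I_k * 'I_k | ij.1 != ij.2]].

Definition well_separated (R : realType) (d k : nat) :
    set_system (k.-tuple 'rV[int]_d) :=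
  tends_to_infty (@min_separation R d k).

(* f ~ g along F means f / g --> 1, unless g is identically zero, in which case
   it means that f is eventually zero.  As 0^-1 = 0, the first case forces g to
   be eventually nonzero. *)
Definition asymptotic (R : realType) (T : Type) (F : set_system T)
    (f g : T -> R) : Prop :=
  ((forall t, g t = 0) -> \forall t \near F, f t = 0) /\
  (~ (forall t, g t = 0) -> (f t / g t) @[t --> F] --> (1 : R)).

Definition is_edge (d L : nat) (e : {fset 'rV[int]_d}) : bool :=
  `[< exists x y, [/\ x != y, (l1dist x y <= L)%N & e = [fset x; y]] >].

Definition edge (d L : nat) := {e : {fset 'rV[int]_d} | is_edge L e}.

Definition cylinder (d L : nat) (F : set (edge d L -> bool)) : Prop :=
  exists S : {fset edge d L}, forall w w' : edge d L -> bool,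
    {in S, w =1 w'} -> F w -> F w'.

(* Configurations (true = open), with the product sigma-algebra. *)
Definition config (d L : nat) := g_sigma_algebraType (@cylinder d L).

Lemma is_edge_shift (d L : nat) (x : 'rV[int]_d) (e : edge d L) :
  is_edge L [fset (u + x)%R | u in val e].
Proof.
case: e => e /= /asboolP[u [v [uv luv ->]]]; apply/asboolP.
exists (u + x), (v + x); split; first by rewrite (inj_eq (addIr x)).
  rewrite (_ : l1dist _ _ = l1dist u v)//; apply: eq_bigr => i _.
  by rewrite !mxE opprD addrACA subrr addr0.
apply/fsetP => y; rewrite !inE; apply/imfsetP/orP => /= [[z]|].
  by rewrite !inE => /orP[]/eqP-> ->; rewrite eqxx; [left|right].
by case=> /eqP->; [exists u | exists v]; rewrite // !inE eqxx ?orbT.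
Qed.

Definition shift_edge (d L : nat) (x : 'rV[int]_d) (e : edge d L) : edge d L :=
  exist (fun f => is_true (is_edge L f)) _ (is_edge_shift x e).

(* [shift_event x F] is F_x = {w : w - x \in F}; the edge e is open in w - x
   iff e + x is open in w. *)
Definition shift_event (d L : nat) (x : 'rV[int]_d) (F : set (config d L)) :
    set (config d L) :=
  [set w | F (fun e => w (shift_edge x e))].

(* The value is false when x and y are not adjacent. *)
Definition open_edge (d L : nat) (w : config d L) : rel 'rV[int]_d :=
  fun x y => if insub [fset x; y] is Some e then w e else false.

Definition connected_by (d L : nat) (w : config d L) (x y : 'rV[int]_d) :
    Prop :=
  exists p : seq 'rV[int]_d, path (open_edge w) x p /\ last x p = y.

Definition conn (d L : nat) (x y : 'rV[int]_d) : set (config d L) :=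
  [set w | connected_by w x y].

Definition in_one_cluster (d L k : nat) (x : k.-tuple 'rV[int]_d) :
    set (config d L) :=
  [set w | forall i j : 'I_k, connected_by w (tnth x i) (tnth x j)].

(* The edges are independent, each open with probability p.  These finite
   dimensional marginals determine the law mu. *)
Definition bernoulli_percolation (R : realType) (d L : nat) (p : R)
    (mu : probability (config d L) R) : Prop :=
  forall (S : {fset edge d L}) (eta : edge d L -> bool),
    mu [set w : config d L | {in S, w =1 eta}] =
    (\prod_(e <- S) (if eta e then p else 1 - p))%:E.

Definition critical_probability (R : realType) (d L : nat)
    (P : R -> probability (config d L) R) : R :=
  inf [set p | 0 <= p <= 1 /\
    (0 < P p [set w | infinite_set [set y | connected_by w 0 y]])%E].

Definition kpoint (R : realType) (d L k : nat)
    (mu : probability (config d L) R) (x : k.-tuple 'rV[int]_d) : R :=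
  fine (mu (in_one_cluster x)).

Definition walk_step (d : nat) (s : 'I_d * bool) : 'rV[int]_d :=
  (-1) ^+ s.2 *: delta_mx 0 s.1.

(* The probability that n independent uniform steps lead from x to y. *)
Definition walk_prob (R : realType) (d n : nat) (x y : 'rV[int]_d) : R :=
  #|[pred s : n.-tuple ('I_d * bool) | x + \sum_(e <- s) walk_step e == y]|%:R
  / (2 * d)%:R ^+ n.

(* The walk is transient for d >= 3, so that [fine] is harmless. *)
Definition green (R : realType) (d : nat) (x y : 'rV[int]_d) : R :=
  fine (\sum_(0 <= n <oo) (walk_prob R n x y)%:E)%E.

(* By the handshake lemma such a tree has exactly k - 2 internal vertices. *)
Definition tree_vertex (k : nat) := ('I_k + 'I_(k - 2))%type.

(* A graph is its symmetric and irreflexive set of ordered adjacent pairs. *)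
Definition graph (k : nat) := {set tree_vertex k * tree_vertex k}.

Definition adj (k : nat) (E : graph k) : rel (tree_vertex k) :=
  fun u v => (u, v) \in E.

Definition degree (k : nat) (E : graph k) (u : tree_vertex k) : nat :=
  #|[pred v | adj E u v]|.

(* [ucycle] accepts the closed walk u, v, u; cycles of a graph are longer. *)
Definition is_tree (k : nat) (E : graph k) : Prop :=
  [/\ symmetric (adj E), irreflexive (adj E),
      forall u v, connect (adj E) u v
    & forall p : seq (tree_vertex k), ucycle (adj E) p -> (size p <= 2)%N].

Definition cubic_trees (k : nat) : {set graph k} :=
  [set E : graph k | `[< [/\ is_tree E,
                  forall i : 'I_k, degree E (inl i) = 1%N
                & forall j : 'I_(k - 2), degree E (inr j) = 3%N] >]].

(* Isomorphisms preserve the labels of the leaves. *)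
Definition tree_iso (k : nat) : rel (graph k) :=
  fun E E' => [exists s : {perm tree_vertex k},
    [forall i : 'I_k, s (inl i) == inl i] &&
    ([set (s uv.1, s uv.2) | uv in E]%SET == E')].

(* One representative of each isomorphism class. *)
Definition Tr (k : nat) : {set graph k} :=
  transversal (equivalence_partition (@tree_iso k) (cubic_trees k))
              (cubic_trees k).

(* The condition on the ranks retains one orientation of each edge. *)
Definition embedding_weight (R : realType) (d k : nat) (E : graph k)
    (Phi : {ffun tree_vertex k -> 'rV[int]_d}) : R :=
  \prod_(uv in E | (enum_rank uv.1 < enum_rank uv.2)%N)
    green R (Phi uv.1) (Phi uv.2).

(* The sum is finite for d > 6, so that [fine] is harmless there. *)
Definition tree_green (R : realType) (d k : nat) (x : k.-tuple 'rV[int]_d) :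
    R :=
  fine (\sum_(E in Tr k)
    \esum_(Phi in [set Phi : {ffun tree_vertex k -> 'rV[int]_d} |
                    forall i : 'I_k, Phi (inl i) = tnth x i])
      (embedding_weight R E Phi)%:E)%E.

Definition two_point_asymptotics (R : realType) (d L : nat)
    (mu : probability (config d L) R) (A : R) : Prop :=
  asymptotic (@far_apart R d)
    (fun xy => fine (mu (conn xy.1 xy.2)))
    (fun xy => A * green R xy.1 xy.2).

(* Configurations form a compact zero-dimensional space, so that weak
   convergence is convergence on cylinder events. *)
Definition is_IIC (R : realType) (d L : nat)
    (mu iic : probability (config d L) R) : Prop :=
  forall F : set (config d L), cylinder F ->
    (fine (mu (F `&` conn 0 x)%classic) / fine (mu (conn 0 x)))
      @[x --> @near_infinity R d] --> fine (iic F).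

Definition two_blob_estimate (R : realType) (d L : nat)
    (mu : probability (config d L) R) : Prop :=
  exists iic : probability (config d L) R, is_IIC mu iic /\
    forall F1 F2 : set (config d L), cylinder F1 -> cylinder F2 ->
      asymptotic (@far_apart R d)
        (fun xy => fine (mu (conn xy.1 xy.2 `&` shift_event xy.1 F1
                             `&` shift_event xy.2 F2)%classic))
        (fun xy => fine (iic F1) * fine (iic F2)
                   * fine (mu (conn xy.1 xy.2))).

(* The defining property of the vertex factor V, given the amplitude A. *)
Definition vertex_factor (R : realType) (d L : nat)
    (mu : probability (config d L) R) (A V : R) : Prop :=
  forall k : nat, (2 <= k)%N ->
    asymptotic (@well_separated R d k)
      (kpoint mu)
      (fun x => V ^+ (k - 2) * A ^+ (2 * k - 3) * tree_green R x).

(* For k >= 1, [head 0 x] is the first point x_1 of the tuple x. *)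
Definition kpoint_ratio (R : realType) (d L k : nat)
    (mu : probability (config d L) R) (x : k.-tuple 'rV[int]_d)
    (z : 'rV[int]_d) : R :=
  kpoint mu [tuple of rcons x z] / kpoint mu [tuple head 0 x; z].

Definition green_ratio (R : realType) (d k : nat) (x : k.-tuple 'rV[int]_d)
    (z : 'rV[int]_d) : R :=
  tree_green R [tuple of rcons x z] / green R (head 0 x) z.

Definition T_IIC (R : realType) (d L k : nat)
    (mu : probability (config d L) R) (x : k.-tuple 'rV[int]_d) : R :=
  lim (kpoint_ratio mu x z @[z --> @near_infinity R d]).

Definition G_IIC (R : realType) (d k : nat) (x : k.-tuple 'rV[int]_d) : R :=
  lim (green_ratio R x z @[z --> @near_infinity R d]).

(* Main.v *)
(* The asymptotics of [T_IIC] is obtained by dividing the vertex factor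
   asymptotics of the (k+1)-point function at (x_1, ..., x_k, z) by the two-point
   asymptotics at (x_1, z), and letting z tend to infinity first.  What needs work
   is the existence of the two limits in z.

   Green's function.  The lattice Laplacian of [(|x|^2 + a)^(-b)] is computed up
   to an error that does not depend on [a]; for suitable [a] and [b] these
   functions are sub- or superharmonic, and comparison yields two-sided bounds
   [G(x, y) ~ |x - y|^(2 - d)] and the convolution bounds.  Together with the
   Harnack inequality the bounds force [G(w, z) / G(x, z) --> 1].  In the sum over
   embeddings of a tree, the contribution of the embeddings that map the neighbour
   of the leaf z to w is [K(w) G(w, z)] with [K(w) <= C |w|^(2 (2 - d))], as one
   sees by stripping leaves; hence the ratio converges by domination.

   Percolation.  By the two-blob estimate, the probability of the cylinder event
   that x_1, ..., x_k are connected inside a box, given that x_1 is connected to z,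
   converges.  If x and y are connected to each other and to z, but not inside the
   box, there are a branch point v and a vertex u outside the box with edge
   disjoint open paths x--u, u--v, v--y and v--z (or the same with x and y
   exchanged).  By the van den Berg--Kesten inequality the probability is at most
   the sum over u and v of a product of four two-point functions, which is a
   small multiple of [G(x, z)] for a large box because [d > 6]. *)

Require Import Defs.
From HB Require Import structures.
From mathcomp Require Import all_boot all_order all_algebra all_fingroup.
From mathcomp Require Import finmap.
From mathcomp Require Import all_classical all_reals all_analysis.
From mathcomp Require Import ring lra zify.
Set Implicit Arguments.
Unset Strict Implicit.
Unset Printing Implicit Defensive.
Import Order.TTheory GRing.Theory Num.Theory.
Import numFieldNormedType.Exports.
Local Open Scope classical_set_scope.
Local Open Scope ring_scope.

(** * The lattice Laplacian of a power of the distance *)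

(** Write [al] for [crit R d], so that [riesz 1 al] is of order |x|^(2 - d). At this exponent the
    1/t term of the Laplacian vanishes, and the next one, [al * (1 + a) / t ^+ 2], beats an error
    that is free of [a] as soon as [a] is large: this is the purpose of the shift [a]. For the lower
    bound on [green] the sign has to be reversed, which is done by adding a power with exponent
    above [al].

    The resulting bounds fix [green] only up to constants, so that the limit of its ratios cannot be
    read off from them and is obtained by contradiction.

    Both limits in z follow one scheme: the ratio differs from a convergent quantity attached to a
    finite box by an error that is small uniformly in far z.

    Dividing by [G_IIC] requires it to be positive, hence requires a cubic tree. None is
    constructed: if [Tr k.+1] were empty, the vertex factor asymptotics would make the (k+1)-point
    function vanish for well separated points, whereas it is positive because the critical
    probability is. The latter follows from the two-point asymptotics, which exclude p = 0. *)

Lemma mvt_between (R : realType) (f df : R -> R) (y : R) :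
  (forall c : R, `|c| <= `|y| -> is_derive c 1 f (df c)) ->
  exists c, [/\ `|c| <= `|y|, 0 <= c * y & f y - f 0 = df c * y].
Proof.
move=> fdf.
have cont a b : (forall c, a <= c <= b -> `|c| <= `|y|) ->
    {within `[a, b], continuous f}.
  move=> ab; apply: derivable_within_continuous => c.
  by rewrite in_itv/= => /ab/fdf[].
have [y0|y0] := leP 0 y.
  have [c cy fc] : exists2 c, c \in `[0, y] & f y - f 0 = df c * (y - 0).
    apply: MVT_segment => //.
      move=> c; rewrite in_itv/= => /andP[c0 cy].
      by apply: fdf; rewrite !ger0_norm// ltW.
    by apply: cont => c /andP[c0 cy]; rewrite !ger0_norm.
  move: cy; rewrite in_itv/= => /andP[c0 cy]; exists c.
  by rewrite !ger0_norm// mulr_ge0// fc subr0.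
have [c cy fc] : exists2 c, c \in `[y, 0] & f 0 - f y = df c * (0 - y).
  apply: MVT_segment; first exact: ltW.
    move=> c; rewrite in_itv/= => /andP[yc c0].
    by apply: fdf; rewrite !ltr0_norm// lerN2 ltW.
  by apply: cont => c /andP[yc c0]; rewrite !ler0_norm// ?lerN2// ltW.
move: cy; rewrite in_itv/= => /andP[yc c0]; exists c.
split; first by rewrite !ler0_norm// ?lerN2// ltW.
- by rewrite mulr_le0// ltW.
- by rewrite -[LHS]opprB fc sub0r mulrN opprK.
Qed.

(** The Taylor polynomial of (1 + y)^(-b) at 0. Odd terms cancel between opposite steps of the walk,
    so the error that counts is of order y^4. *)
Definition binom3 (R : realType) (b y : R) : R :=
  1 - b * y + b * (b + 1) / 2 * y ^+ 2 - b * (b + 1) * (b + 2) / 6 * y ^+ 3.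

(* The derivative of [(1 + y)^b * (binom3 b y + k * y^4)] is a multiple of
   [y^3] whose sign is that of [k] when [k] is large and [y] is small. *)
Lemma powR_binom3 (R : realType) (b y : R) : 0 < b -> `|y| * (b + 4) <= 1 ->
  `|(1 + y) `^ (- b) - binom3 b y| <=
    b * (b + 1) * (b + 2) * (b + 3) / 6 * y ^+ 4.
Proof.
move=> b0 yb; set C := b * (b + 1) * (b + 2) * (b + 3) / 6.
have C0 : 0 <= C by rewrite /C; repeat (apply: mulr_ge0 => //); lra.
have small (c : R) : `|c| <= `|y| -> `|c| * (b + 4) <= 1.
  by move=> cy; apply: le_trans yb; rewrite ler_wpM2r//; lra.
have pos (c : R) : `|c| <= `|y| -> 0 < 1 + c.
  move=> /small; have [c0|c0] := leP 0 c; first by lra.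
  by rewrite ltr0_norm// => ?; nra.
pose g (k c : R) : R := (1 + c) `^ b * (binom3 b c + k * c ^+ 4).
pose dg (k c : R) : R := (1 + c) `^ (b - 1) *
  (c ^+ 3 * (4 * k - C + k * (c * (b + 4)))).
have gd k (c : R) : `|c| <= `|y| -> is_derive c 1 (g k) (dg k c).
  move=> /pos c0.
  have Ha : is_derive c 1 (fun c : R => 1 + c) (1 : R).
    have := is_deriveD (is_derive_cst (1 : R) c 1) (is_derive_id c (1 : R)).
    by rewrite add0r.
  have Hp := is_derive1_comp (is_derive1_powR b c0) Ha.
  have Hq : is_derive c 1 (fun c : R => binom3 b c + k * c ^+ 4)
      (- b + b * (b + 1) * c - b * (b + 1) * (b + 2) / 2 * c ^+ 2 + 4 * k * c ^+ 3).
    rewrite /binom3; apply: is_derive_eq.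
    by rewrite /GRing.scale /=; field.
  have H := is_deriveM Hp Hq; apply: is_derive_eq; rewrite /dg /= /GRing.scale /=.
  have -> : (1 + c) `^ b = (1 + c) `^ (b - 1) * (1 + c).
    by rewrite -[X in _ * X](@powRr1 _ (1 + c)) ?ltW// -powRD ?subrK// gt_eqF// implybT.
  by rewrite /binom3 /C; field.
have g0 k : g k 0 = 1.
  by rewrite /g /binom3 addr0 powR1; ring.
have b1 : 0 < (1 + y) `^ b by rewrite powR_gt0// pos.
(* Used with [k = C] and [k = - C]: [g C y >= 1] and [g (- C) y <= 1] are the two sides of the
   estimate. *)
have key (k : R) : k ^+ 2 = C ^+ 2 -> 0 <= k * (g k y - 1).
  move=> kC; have [c [cy c0]] := mvt_between (gd k); rewrite g0 => ->.
  rewrite /dg; set q := (1 + c) `^ _.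
  have q0 : 0 <= q by exact: powR_ge0.
  rewrite (_ : k * _ = q * (c ^+ 2 * (c * y)) * (k * (4 * k - C + k * (c * (b + 4))))); last by ring.
  apply: mulr_ge0; first by rewrite mulr_ge0// mulr_ge0// sqr_ge0.
  have kC' : k * C <= C ^+ 2 by have := sqr_ge0 (k - C); rewrite sqrrB kC; lra.
  have t1 : -1 <= c * (b + 4).
    have := small c cy; have [c0'|c0'] := leP 0 c.
      by move=> _; apply: (@le_trans _ _ 0); rewrite ?mulr_ge0//; lra.
    by rewrite ltr0_norm//; lra.
  rewrite (_ : _ * _ = C ^+ 2 * (4 + c * (b + 4)) - k * C); last first.
    by rewrite -kC; ring.
  have : 0 <= C ^+ 2 * (1 + c * (b + 4)) by rewrite mulr_ge0 ?sqr_ge0//; lra.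
  have := sqr_ge0 C; lra.
have [C00|Cn0] := eqVneq C 0.
  move: C0; rewrite /C => _; exfalso; move: C00; rewrite /C.
  apply/eqP; rewrite gt_eqF//; repeat (apply: mulr_gt0 => //); lra.
have Cp : 0 < C by rewrite lt_def Cn0.
have eg k : g k y = (1 + y) `^ b * (binom3 b y + k * y ^+ 4) by [].
have /(_ erefl) := key C; rewrite pmulr_rge0// subr_ge0 eg => h1.
have := key (- C); rewrite sqrrN => /(_ erefl).
rewrite mulNr oppr_ge0 pmulr_rle0// subr_le0 eg => h2.
rewrite powRN ler_distl; apply/andP; split.
  by rewrite -mulNr -[leRHS]mul1r ler_pdivlMr// mulrC.
by rewrite -[leLHS]mul1r ler_pdivrMr// mulrC.
Qed.

Definition sqnorm (R : realType) (d : nat) (x : 'rV[int]_d) : R :=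
  \sum_(i < d) (x 0 i)%:~R ^+ 2.

(** As [sqnorm] is a squared length, the exponent [b] stands for decay like |x|^(-2b). A shift
    [a > 0] removes the singularity at 0. *)
Definition riesz (R : realType) (d : nat) (a b : R) (x : 'rV[int]_d) : R :=
  (sqnorm R x + a) `^ (- b).

(** The transition operator of the walk: [f - avg f] is minus the discrete Laplacian of [f]. *)
Definition avg (R : realType) (d : nat) (f : 'rV[int]_d -> R)
    (x : 'rV[int]_d) : R :=
  (\sum_(e : 'I_d * bool) f (x + walk_step e)) / (2 * d)%:R.

Lemma sqnorm_ge0 (R : realType) (d : nat) (x : 'rV[int]_d) : 0 <= sqnorm R x.
Proof. by apply: sumr_ge0 => i _; exact: sqr_ge0. Qed.

Lemma sqnormN (R : realType) (d : nat) (x : 'rV[int]_d) :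
  sqnorm R (- x) = sqnorm R x.
Proof. by apply: eq_bigr => i _; rewrite mxE mulrNz sqrrN. Qed.

Lemma walk_stepE (d : nat) (i j : 'I_d) (s : bool) :
  walk_step (i, s) 0 j = (if j == i then (-1) ^+ s else 0 : int).
Proof. by rewrite /walk_step !mxE eqxx /=; case: eqP; rewrite ?mulr1 ?mulr0. Qed.

Lemma sqnorm_step (R : realType) (d : nat) (x : 'rV[int]_d) (i : 'I_d)
    (s : bool) :
  sqnorm R (x + walk_step (i, s)) =
  sqnorm R x + 1 + (-1) ^+ s * (2 * (x 0 i)%:~R).
Proof.
rewrite /sqnorm (bigD1 i)//= [in RHS](bigD1 i)//= mxE walk_stepE eqxx.
rewrite (eq_bigr (fun j => (x 0 j)%:~R ^+ 2 : R)); last first.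
  by move=> j ji; rewrite mxE walk_stepE (negPf ji) addr0.
set q := \sum_(_ | _) _.
by rewrite intrD; case: s; rewrite /= ?expr1 ?expr0 ?rmorphN1 ?rmorph1; ring.
Qed.

(** The neighbours of [x] along axis i have squared length [sqnorm R x + 1] plus or minus 2 x_i.
    Expanding about [sqnorm R x + a + 1], and not about the value at [x], makes the increments
    exactly opposite. *)
Lemma avg_riesz (R : realType) (d : nat) (a b : R) (x : 'rV[int]_d) :
  0 <= a -> (0 < d)%N ->
  avg (riesz a b) x = (sqnorm R x + a + 1) `^ (- b) * (\sum_(i < d)
    ((1 + 2 * (x 0 i)%:~R / (sqnorm R x + a + 1)) `^ (- b) +
     (1 - 2 * (x 0 i)%:~R / (sqnorm R x + a + 1)) `^ (- b))) / (2 * d%:R).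
Proof.
move=> a0 d0; rewrite /avg natrM; congr (_ / _).
set t := sqnorm R x + a + 1.
have t0 : 0 < t by rewrite /t; have := sqnorm_ge0 R x; lra.
rewrite mulr_sumr (eq_bigr (fun e : 'I_d * bool => riesz a b (x + walk_step (e.1, e.2)))); last first.
  by case.
rewrite -(pair_bigA _ (fun i s => riesz a b (x + walk_step (i, s)))) /=.
apply: eq_bigr => i _; rewrite big_bool /= addrC mulrDr /riesz !sqnorm_step.
have sq : `|2 * (x 0 i)%:~R| <= t.
  have h : (x 0 i)%:~R ^+ 2 <= sqnorm R x.
    rewrite /sqnorm (bigD1 i)//= lerDl.
    by apply: sumr_ge0 => j _; exact: sqr_ge0.
  rewrite /t; set z := (x 0 i)%:~R in h *.
  rewrite ler_norml; apply/andP; split.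
    by have := sqr_ge0 (z + 1); rewrite sqrrD1; lra.
  by have := sqr_ge0 (z - 1); rewrite sqrrB1; lra.
move: sq; rewrite ler_norml => /andP[sq1 sq2].
congr (_ + _); rewrite -powRM ?(ltW t0)//; try (by congr (_ `^ _); rewrite /t /=; field; rewrite gt_eqF).
  rewrite (_ : 1 + _ = (t + 2 * (x 0 i)%:~R) / t); last by field; rewrite gt_eqF.
  by rewrite divr_ge0 ?(ltW t0)//; lra.
rewrite (_ : 1 - _ = (t - 2 * (x 0 i)%:~R) / t); last by field; rewrite gt_eqF.
by rewrite divr_ge0 ?(ltW t0)//; lra.
Qed.

Lemma riesz_laplacian (R : realType) (d : nat) (b : R) : 0 < b -> (0 < d)%N ->
  exists2 K : R, 0 < K & forall a (x : 'rV[int]_d) t, (b + 4) ^+ 2 <= a ->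
    t = sqnorm R x + a + 1 ->
  `|riesz a b x - avg (riesz a b) x - t `^ (- b) *
    (b * (1 - 2 * (b + 1) / d%:R) / t + 2 * b * (b + 1) / d%:R * (1 + a) / t ^+ 2)|
  <= K * t `^ (- b) / t ^+ 2.
Proof.
move=> b0 d0; have dR : 1 <= d%:R :> R by rewrite ler1n.
set c2 := b * (b + 1) / 2; set c3 := b * (b + 1) * (b + 2) / 6.
set c4 := b * (b + 1) * (b + 2) * (b + 3) / 6.
have c20 : 0 < c2 by rewrite /c2; repeat (apply: mulr_gt0 => //); lra.
have c30 : 0 < c3 by rewrite /c3; repeat (apply: mulr_gt0 => //); lra.
have c40 : 0 < c4 by rewrite /c4; repeat (apply: mulr_gt0 => //); lra.
(* [c2], [c3] and one [c4] come from the terms and the remainder of (1 - 1/t)^(-b) beyond first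
   order, [16 * c4] from the remainders at the neighbours. *)
exists (c2 + c3 + 17 * c4); first by lra.
move=> a x t ab tE; have n0 := sqnorm_ge0 R x.
have ab4 : b + 4 <= a by apply: le_trans ab; rewrite expr2; nra.
have t1 : b + 4 <= t by lra.
have t0 : 0 < t by lra.
have a0 : 0 <= a by lra.
rewrite (avg_riesz b x a0 d0) -tE {1}/riesz.
set T := t `^ (- b); have T0 : 0 <= T by exact: powR_ge0.
have -> : (sqnorm R x + a) `^ (- b) = T * (1 + (- t^-1)) `^ (- b).
  rewrite -powRM ?(ltW t0)//; last first.
    by rewrite subr_ge0 invf_le1//; lra.
  by congr (_ `^ _); rewrite mulrDr mulrN mulfV ?gt_eqF//; lra.
pose y i : R := 2 * (x 0 i)%:~R / t.
(* This is where [a] has to be large: 2 |x_i| (b + 4) is at most x_i^2 + (b + 4)^2, hence at most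
   [t]. *)
have ysmall i : `|y i| * (b + 4) <= 1.
  rewrite /y normrM normfV (gtr0_norm t0) mulrAC ler_pdivrMr// mul1r.
  have h : (x 0 i)%:~R ^+ 2 <= sqnorm R x.
    rewrite /sqnorm (bigD1 i)//= lerDl.
    by apply: sumr_ge0 => j _; exact: sqr_ge0.
  rewrite normrM gtr0_norm//.
  have := sqr_ge0 (`|(x 0 i)%:~R| - (b + 4)); rewrite sqrrB real_normK ?num_real//.
  lra.
pose eps i : R := (1 + y i) `^ (- b) + (1 - y i) `^ (- b) - (2 + 2 * c2 * y i ^+ 2).
have epsE i : `|eps i| <= 2 * c4 * y i ^+ 4.
  have h1 := powR_binom3 b0 (ysmall i).
  have h2 : `|- y i| * (b + 4) <= 1 by rewrite normrN.
  have {}h2 := powR_binom3 b0 h2.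
  rewrite (_ : eps i = ((1 + y i) `^ (- b) - binom3 b (y i)) + ((1 + - y i) `^ (- b) - binom3 b (- y i))).
    apply: le_trans (ler_normD _ _) _; apply: le_trans (lerD h1 h2) _.
    by rewrite -/c4 (_ : (- y i) ^+ 4 = y i ^+ 4); [lra|ring].
  by rewrite /eps /binom3 /c2; field.
have Sy : \sum_i y i ^+ 2 = 4 * (t - 1 - a) / t ^+ 2.
  rewrite (_ : t - 1 - a = sqnorm R x); last by lra.
  rewrite /sqnorm mulr_sumr mulr_suml; apply: eq_bigr => i _.
  by rewrite /y; field; rewrite gt_eqF.
have Sy4 : \sum_i y i ^+ 2 <= 4 / t.
  rewrite Sy expr2 invfM mulrA ler_pM2r ?invr_gt0// ler_pdivrMr//; lra.
have Sy0 : 0 <= \sum_i y i ^+ 2 by apply: sumr_ge0 => i _; exact: sqr_ge0.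
have E4 : `|\sum_i eps i| <= 32 * c4 / t ^+ 2.
  apply: le_trans (ler_norm_sum _ _ _) _.
  apply: (@le_trans _ _ (\sum_i 2 * c4 * (4 / t) * y i ^+ 2)).
    apply: ler_sum => i _; apply: le_trans (epsE i) _.
    rewrite -[4%N]/(2 + 2)%N exprD mulrA ler_wpM2r ?sqr_ge0//.
    rewrite ler_wpM2l//; first by lra.
    apply: le_trans Sy4; rewrite (bigD1 i)//= lerDl.
    by apply: sumr_ge0 => j _; exact: sqr_ge0.
  rewrite -mulr_sumr; apply: (@le_trans _ _ (2 * c4 * (4 / t) * (4 / t))).
    rewrite ler_wpM2l// mulr_ge0//; first by lra.
    by rewrite divr_ge0// ltW.
  by rewrite le_eqVlt; apply/orP; left; apply/eqP; field; rewrite gt_eqF.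
have usmall : `|- t^-1| * (b + 4) <= 1.
  by rewrite normrN gtr0_norm ?invr_gt0// mulrC ler_pdivrMr// mul1r.
have := powR_binom3 b0 usmall; rewrite -/c4.
set r := (1 + _) `^ _ => Hr.
have epsD i : (1 + y i) `^ (- b) + (1 - y i) `^ (- b) = 2 + 2 * c2 * y i ^+ 2 + eps i.
  by rewrite /eps; ring.
rewrite (eq_bigr _ (fun i _ => epsD i)).
clearbody eps; rewrite !big_split /= -mulr_sumr Sy.
have -> : \sum_(i < d) (1 : R) = d%:R by rewrite sumr_const card_ord.
move: E4; set E := \sum_i eps i => E4.
rewrite (_ : _ - _ = T * ((r - binom3 b (- t^-1)) - E / (2 * d%:R) + c2 / t ^+ 2 + c3 / t ^+ 3)); last first.
  by rewrite /binom3 /c2 /c3; field; rewrite ?gt_eqF//; lra.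
clear epsE epsD; clearbody c2 c3 c4.
rewrite normrM ger0_norm// -mulrA mulrCA ler_wpM2l//.
have tt : t^-1 ^+ 2 <= 1.
  by rewrite expr_le1// ?invr_ge0 ?invf_le1//; lra.
have t2 : 0 < (t ^+ 2)^-1 by rewrite invr_gt0 exprn_gt0.
have b3 : t^-1 <= 1 by rewrite invf_le1//; lra.
have k1 : `|r - binom3 b (- t^-1)| <= c4 / t ^+ 2.
  apply: le_trans Hr _; rewrite ler_wpM2l ?(ltW c40)//.
  rewrite (_ : (- t^-1) ^+ 4 = (t ^+ 2)^-1 * t^-1 ^+ 2); last by field; rewrite gt_eqF//; lra.
  by rewrite ler_piMr// ltW.
have k2 : `|E / (2 * d%:R)| <= 16 * c4 / t ^+ 2.
  rewrite normrM (@ger0_norm _ (_^-1)) ?invr_ge0 ?mulr_ge0 ?ler0n//.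
  rewrite ler_pdivrMr ?mulr_gt0 ?ltr0n//; apply: le_trans E4 _.
  have : 0 <= c4 / t ^+ 2 by rewrite divr_ge0 ?sqr_ge0// ltW.
  by set w := c4 / t ^+ 2 => w0; rewrite -![_ * c4 / _]mulrA -/w; nra.
have k3 : `|c3 / t ^+ 3| <= c3 / t ^+ 2.
  rewrite ger0_norm ?divr_ge0 ?exprn_ge0 ?(ltW c30) ?(ltW t0)// ler_pM2l// exprS invfM.
  by rewrite ler_piMl// ltW.
have k4 : `|c2 / t ^+ 2| <= c2 / t ^+ 2.
  by rewrite ger0_norm// divr_ge0 ?exprn_ge0 ?(ltW c20) ?(ltW t0).
rewrite [leRHS](_ : _ = c4 / t ^+ 2 + 16 * c4 / t ^+ 2 + c2 / t ^+ 2 + c3 / t ^+ 2); last by ring.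
apply: le_trans (ler_normD _ _) (lerD _ k3).
apply: le_trans (ler_normD _ _) (lerD _ k4).
by apply: le_trans (ler_normB _ _) (lerD k1 k2).
Qed.

(** * Random walk and Green's function *)

Lemma le_avg (R : realType) (d : nat) (f g : 'rV[int]_d -> R) (x : 'rV[int]_d) :
  (forall y, f y <= g y) -> avg f x <= avg g x.
Proof. by move=> fg; rewrite /avg ler_wpM2r ?invr_ge0// ler_sum. Qed.

Lemma avgD (R : realType) (d : nat) (f g : 'rV[int]_d -> R) (x : 'rV[int]_d) :
  avg (fun y => f y + g y) x = avg f x + avg g x.
Proof. by rewrite /avg big_split mulrDl. Qed.

Lemma avgZ (R : realType) (d : nat) (c : R) (f : 'rV[int]_d -> R)
    (x : 'rV[int]_d) :
  avg (fun y => c * f y) x = c * avg f x.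
Proof. by rewrite /avg -mulr_sumr mulrA. Qed.

Lemma avg_sum (R : realType) (d : nat) (I : Type) (r : seq I)
    (f : I -> 'rV[int]_d -> R) (x : 'rV[int]_d) :
  avg (fun y => \sum_(i <- r) f i y) x = \sum_(i <- r) avg (f i) x.
Proof. by rewrite /avg exchange_big mulr_suml. Qed.

Lemma eq_avg (R : realType) (d : nat) (f g : 'rV[int]_d -> R) (x : 'rV[int]_d) :
  f =1 g -> avg f x = avg g x.
Proof. by move=> fg; rewrite /avg (eq_bigr _ (fun e _ => fg _)). Qed.

Lemma walk_prob_ge0 (R : realType) (d n : nat) (x y : 'rV[int]_d) :
  0 <= walk_prob R n x y.
Proof. by rewrite /walk_prob mulr_ge0// invr_ge0 exprn_ge0. Qed.

Lemma walk_prob0 (R : realType) (d : nat) (x y : 'rV[int]_d) :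
  walk_prob R 0 x y = (x == y)%:R.
Proof.
rewrite /walk_prob expr0 divr1; congr _%:R.
rewrite -sum1_card big_mkcond (big_pred1 [tuple])/=; last by move=> t; apply/esym/eqP; exact: tuple0.
by rewrite inE big_nil addr0; case: eqP.
Qed.

Lemma walk_probS (R : realType) (d n : nat) (x y : 'rV[int]_d) :
  walk_prob R n.+1 x y = avg (fun u => walk_prob R n u y) x.
Proof.
rewrite /avg /walk_prob -mulr_suml exprS invfM.
rewrite -mulrA [_^-1 * _^-1]mulrC mulrA mulrA; congr (_ * _ * _).
rewrite -natr_sum; congr _%:R.
rewrite -sum1_card big_mkcond /=.
rewrite (eq_bigr (fun e => \sum_(s : n.-tuple ('I_d * bool))
    if (x + \sum_(e' <- e :: s) walk_step e' == y)%R then 1 else 0)%N); last first.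
  move=> e _; rewrite -sum1_card big_mkcond /=; apply: eq_bigr => s _.
  by rewrite inE big_cons addrA.
rewrite pair_bigA /=.
rewrite (reindex (fun p : ('I_d * bool) * n.-tuple ('I_d * bool) =>
   [tuple of p.1 :: p.2])) /=; last first.
  exists (fun t : n.+1.-tuple _ => (thead t, [tuple of behead t])).
    by case=> e s _ /=; congr pair; apply/val_inj.
  by move=> t _; rewrite [RHS](tuple_eta t).
by apply: eq_bigr.
Qed.

Lemma walk_prob_sym (R : realType) (d n : nat) (x y : 'rV[int]_d) :
  walk_prob R n x y = walk_prob R n y x.
Proof.
pose flip (e : 'I_d * bool) := (e.1, ~~ e.2).
have flipE e : walk_step (flip e) = - walk_step e.
  case: e => i s; apply/rowP => j; rewrite [RHS]mxE !walk_stepE.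
  by case: eqP => // _; case: s; rewrite ?oppr0.
have flipK : involutive flip by case=> i s; rewrite /flip /= negbK.
pose tf (t : n.-tuple ('I_d * bool)) := map_tuple flip t.
have tfK : involutive tf by move=> t; apply/val_inj; rewrite /= -map_comp map_id_in// => e _ /=.
rewrite /walk_prob; congr (_%:R / _); rewrite -!sum1_card.
rewrite (reindex_inj (inv_inj tfK)); apply: eq_bigl => t; rewrite !inE /= big_map.
rewrite (eq_bigr (fun e => - walk_step e)) => [|e _]; last exact: flipE.
by rewrite sumrN subr_eq eq_sym.
Qed.

Lemma walk_prob_shift (R : realType) (d n : nat) (v x y : 'rV[int]_d) :
  walk_prob R n (x + v) (y + v) = walk_prob R n x y.
Proof.
rewrite /walk_prob; congr (_%:R / _); apply: eq_card => t.
by rewrite !inE addrAC (inj_eq (addIr v)).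
Qed.

(** Iterating [rho + avg f <= f] adds one term [rho] per step, and the iterate of [f] that is left
    over is nonnegative. *)
Lemma superharmonic_sum (R : realType) (d : nat) (f rho : 'rV[int]_d -> R)
    (Y : seq 'rV[int]_d) (N : nat) (x : 'rV[int]_d) :
  uniq Y -> (forall y, 0 <= f y) -> (forall y, 0 <= rho y) ->
  (forall y, rho y + avg f y <= f y) ->
  \sum_(n < N) \sum_(y <- Y) walk_prob R n x y * rho y <= f x.
Proof.
move=> uY f0 rho0 sup; elim: N x => [|N IH] x; first by rewrite big_ord0.
rewrite big_ord_recl /=; apply: le_trans (sup x); apply: lerD.
  have [xY|xY] := boolP (x \in Y).
    rewrite (bigD1_seq x)//= walk_prob0 eqxx mul1r big1 ?addr0// => y yx.
    by rewrite walk_prob0 eq_sym (negPf yx) mul0r.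
  rewrite big_seq big1// => y yY; rewrite walk_prob0.
  by case: eqP xY => [->|]; rewrite ?yY ?mul0r.
apply: le_trans (le_avg x IH); rewrite avg_sum le_eqVlt; apply/orP; left.
apply/eqP/eq_bigr => n _; rewrite avg_sum; apply: eq_bigr => y _.
rewrite /bump /= add1n walk_probS mulrC -avgZ.
by apply: eq_avg => u; rewrite mulrC.
Qed.

Lemma cvg_bigsum (R : realType) (T I : Type) (F : set_system T) (r : seq I)
    (f : I -> T -> R) (l : I -> R) : Filter F ->
  (forall i, f i t @[t --> F] --> l i) ->
  \sum_(i <- r) f i t @[t --> F] --> \sum_(i <- r) l i.
Proof.
move=> FF fl; elim: r => [|i r IH].
  by rewrite big_nil; under eq_fun do rewrite big_nil; exact: cvg_cst.
rewrite big_cons; under eq_fun do rewrite big_cons.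
by apply: cvgD => //; exact: fl.
Qed.

(** Excludes an infinite series, which [fine] would turn into the value 0 in [green]. *)
Definition transient (R : realType) (d : nat) := forall x y : 'rV[int]_d,
  exists B : R, forall N, \sum_(n < N) walk_prob R n x y <= B.

Lemma green_cvg (R : realType) (d : nat) (x y : 'rV[int]_d) :
  transient R d ->
  (fun N => \sum_(n < N) walk_prob R n x y) @ \oo --> green R x y.
Proof.
move=> tr; have [B hB] := tr x y.
have nd : nondecreasing_seq (fun N => \sum_(n < N) walk_prob R n x y).
  by apply/nondecreasing_seqP => n; rewrite big_ord_recr /= lerDl walk_prob_ge0.
have cv : cvgn (fun N => \sum_(n < N) walk_prob R n x y).
  by apply: nondecreasing_is_cvgn => //; exists B => _ [n _ <-]; exact: hB.
rewrite /green (_ : (\sum_(0 <= n <oo) (walk_prob R n x y)%:E)%E =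
  (limn (fun N => \sum_(n < N) walk_prob R n x y))%:E) //.
rewrite -EFin_lim//; congr (limn _).
by apply/funext => n /=; rewrite big_mkord sumEFin.
Qed.

Lemma green_ge (R : realType) (d N : nat) (x y : 'rV[int]_d) :
  transient R d -> \sum_(n < N) walk_prob R n x y <= green R x y.
Proof.
move=> tr; rewrite -(cvg_lim _ (green_cvg (x:=x) (y:=y) tr))//.
apply: nondecreasing_cvgn_le; last by apply/cvg_ex; eexists; exact: green_cvg.
by apply/nondecreasing_seqP => n; rewrite big_ord_recr /= lerDl walk_prob_ge0.
Qed.

Lemma green_ge0 (R : realType) (d : nat) (x y : 'rV[int]_d) :
  transient R d -> 0 <= green R x y.
Proof. by move=> tr; have := green_ge 0 x y tr; rewrite big_ord0. Qed.

Lemma green_sym (R : realType) (d : nat) (x y : 'rV[int]_d) :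
  green R x y = green R y x.
Proof.
by rewrite /green; congr fine; apply: eq_eseriesr => n _; rewrite walk_prob_sym.
Qed.

Lemma green_shift (R : realType) (d : nat) (v x y : 'rV[int]_d) :
  green R (x + v) (y + v) = green R x y.
Proof.
by rewrite /green; congr fine; apply: eq_eseriesr => n _; rewrite walk_prob_shift.
Qed.

Lemma green_rec (R : realType) (d : nat) (x y : 'rV[int]_d) :
  transient R d -> green R x y = (x == y)%:R + avg (fun u => green R u y) x.
Proof.
move=> tr; have h := green_cvg (x:=x) (y:=y) tr.
have h1 : (fun N => \sum_(n < N.+1) walk_prob R n x y) @ \oo --> green R x y.
  by move: h; rewrite -(cvg_shiftS (fun N => \sum_(n < N) walk_prob R n x y)).
have h2 : (fun N => \sum_(n < N.+1) walk_prob R n x y) @ \oo -->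
    (x == y)%:R + avg (fun u => green R u y) x.
  rewrite (_ : (fun _ => _) = (fun N => (x == y)%:R +
      avg (fun u => \sum_(n < N) walk_prob R n u y) x)); last first.
    apply/funext => N; rewrite big_ord_recl walk_prob0 avg_sum; congr (_ + _).
    by apply: eq_bigr => n _; rewrite walk_probS.
  apply: cvgD; first exact: cvg_cst.
  rewrite /avg; apply: cvgM; last exact: cvg_cst.
  by apply: cvg_bigsum => e; exact: green_cvg.
exact: (cvg_unique _ h1 h2).
Qed.

(** The comparison principle: a nonnegative supersolution [f] dominates the potential of [rho]. The
    potential bounds below consist in choosing [f]. *)
Lemma green_potential_le (R : realType) (d : nat) (f rho : 'rV[int]_d -> R)
    (Y : seq 'rV[int]_d) (x : 'rV[int]_d) :
  transient R d -> uniq Y -> (forall y, 0 <= f y) -> (forall y, 0 <= rho y) ->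
  (forall y, rho y + avg f y <= f y) ->
  \sum_(y <- Y) green R x y * rho y <= f x.
Proof.
move=> tr uY f0 rho0 sup.
have h : (fun N => \sum_(y <- Y) (\sum_(n < N) walk_prob R n x y) * rho y) @ \oo
    --> \sum_(y <- Y) green R x y * rho y.
  apply: cvg_bigsum => y; apply: cvgM; [exact: green_cvg|exact: cvg_cst].
rewrite -(cvg_lim _ h)//; apply: limr_le; first by apply/cvg_ex; eexists; exact: h.
apply: nearW => N; apply: le_trans (superharmonic_sum N x uY f0 rho0 sup).
rewrite exchange_big /= ler_sum// => y _.
by rewrite mulr_suml.
Qed.

(** The translations that preserve [P] are closed under addition, and unit steps generate the
    lattice. *)
Lemma step_ind (d : nat) (P : 'rV[int]_d -> Prop) :
  P 0 -> (forall v e, P v -> P (v + walk_step e)) -> forall v, P v.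
Proof.
move=> P0 PS v; pose Q w := forall u, P u -> P (u + w).
have QD w w' : Q w -> Q w' -> Q (w + w').
  by move=> Qw Qw' u /Qw/Qw'; rewrite addrA.
have Q0 : Q 0 by move=> u; rewrite addr0.
have Qn w n : Q w -> Q (w *+ n).
  by move=> Qw; elim: n => [|n IH]; rewrite ?mulr0n// mulrSr; exact: QD.
have Qe (i : 'I_d) (s : bool) : Q ((-1) ^+ s *: delta_mx 0 i) by move=> u; exact: (PS u (i, s)).
suff : Q v by move=> /(_ 0 P0); rewrite add0r.
rewrite [v]row_sum_delta; elim/big_ind: _ => // i _.
case: (intP (v 0 i)) => [|n|n]; first by rewrite scale0r.
  have := Qn _ n.+1 (Qe i false); rewrite /= expr0 scale1r.
  by rewrite -scaler_nat; congr (Q (_ *: _)); rewrite natz.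
have := Qn _ n.+1 (Qe i true); rewrite /= expr1 -scaler_nat scalerA.
by congr (Q (_ *: _)); rewrite natz mulrN1.
Qed.

Lemma green_step_le (R : realType) (d : nat) (x y : 'rV[int]_d) e :
  transient R d -> green R (x + walk_step e) y <= (2 * d)%:R * green R x y.
Proof.
move=> tr; have d0 : (0 < d)%N by case: e => -[i hi] _; exact: leq_ltn_trans hi.
have D0 : 0 < (2 * d)%:R :> R by rewrite ltr0n muln_gt0.
rewrite (green_rec x y tr) mulrDr.
apply: ler_wpDl; first by rewrite mulr_ge0.
rewrite /avg mulrC mulfVK ?gt_eqF// (bigD1 e)//= lerDl sumr_ge0// => *.
exact: green_ge0.
Qed.

(** Each unit step from [x'] to [x] costs a factor [2 * d], whatever [y] is. *)
Lemma harnack (R : realType) (d : nat) (x x' : 'rV[int]_d) :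
  transient R d -> exists2 c : R, 0 < c &
  forall y, green R x y <= c * green R x' y.
Proof.
move=> tr; rewrite -(subrK x' x); move: (x - x'); apply: step_ind.
  by exists 1 => // y; rewrite add0r mul1r.
move=> v e [c c0 h]; exists ((2 * d)%:R * c).
  have d0 : (0 < d)%N by case: e => -[i hi] _; exact: leq_ltn_trans hi.
  by rewrite mulr_gt0// ltr0n muln_gt0.
move=> y; rewrite addrAC; apply: le_trans (green_step_le _ _ _ tr) _.
by rewrite -mulrA ler_wpM2l.
Qed.

Lemma green_gt0 (R : realType) (d : nat) (x y : 'rV[int]_d) :
  transient R d -> 0 < green R x y.
Proof.
move=> tr; have [c c0 h] := harnack y x tr.
have : 1 <= green R y y.
  by have := green_ge 1 y y tr; rewrite big_ord1 walk_prob0 eqxx.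
by have := h y; nra.
Qed.

(** * Powers of the distance as comparison functions *)

Lemma powRN_le (R : realType) (u v b : R) : 0 < u -> u <= v -> 0 <= b ->
  v `^ (- b) <= u `^ (- b).
Proof.
move=> u0 uv b0; have v0 : 0 < v by exact: lt_le_trans uv.
by rewrite !powRN lef_pV2 ?posrE ?powR_gt0// ge0_ler_powR// ?nnegrE ltW.
Qed.

Lemma powRN_exp_le (R : realType) (u b b' : R) : 1 <= u -> b' <= b ->
  u `^ (- b) <= u `^ (- b').
Proof. by move=> u1 bb; rewrite ler_powR// lerN2. Qed.

Lemma riesz_gt0 (R : realType) (d : nat) (a b : R) (x : 'rV[int]_d) : 0 < a ->
  0 < riesz a b x.
Proof. by move=> a0; rewrite powR_gt0// ltr_wpDl// sqnorm_ge0. Qed.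

Lemma riesz_le1 (R : realType) (d : nat) (a b : R) (x : 'rV[int]_d) :
  1 <= a -> 0 <= b -> riesz a b x <= riesz 1 b x.
Proof.
by move=> a1 b0; have := sqnorm_ge0 R x => ?; apply: powRN_le => //; lra.
Qed.

Lemma riesz1_le (R : realType) (d : nat) (a b : R) (x : 'rV[int]_d) :
  1 <= a -> 0 <= b -> riesz 1 b x <= a `^ b * riesz a b x.
Proof.
move=> a1 b0; have n0 := sqnorm_ge0 R x; have a0 : 0 < a by lra.
rewrite -[b in a `^ b]opprK powRN /riesz mulrC ler_pdivlMr ?powR_gt0//.
rewrite -powRM ?powRN_le//; nra.
Qed.

Lemma sqnormD (R : realType) (d : nat) (x y : 'rV[int]_d) :
  sqnorm R (x + y) <= 2 * (sqnorm R x + sqnorm R y).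
Proof.
rewrite /sqnorm -big_split /= mulr_sumr ler_sum// => i _; rewrite mxE intrD.
set u := _%:~R; set v := _%:~R.
by have := sqr_ge0 (u - v); rewrite sqrrB sqrrD; lra.
Qed.

Lemma riesz_shift (R : realType) (d : nat) (b : R) (x y : 'rV[int]_d) : 0 <= b ->
  riesz 1 b (x + y) <= (2 * (sqnorm R y + 1)) `^ b * riesz 1 b x.
Proof.
move=> b0; have n0 := sqnorm_ge0 R y; have n0' := sqnorm_ge0 R (x + y).
rewrite -[X in _ `^ X * _]opprK powRN /riesz mulrC ler_pdivlMr ?powR_gt0 //; last by lra.
rewrite -powRM; [|lra|lra].
apply: powRN_le => //; first by have := sqnorm_ge0 R x; lra.
have := sqnormD R (x + y) (- y); rewrite addrK sqnormN.
by nra.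
Qed.

Lemma riesz_le_one (R : realType) (d : nat) (b : R) (x : 'rV[int]_d) : 0 <= b ->
  riesz 1 b x <= 1.
Proof.
move=> b0; rewrite -[leRHS](@powRr0 _ (sqnorm R x + 1)) /riesz -[X in _ <= _ `^ X]oppr0.
by rewrite powRN_exp_le// lerDr sqnorm_ge0.
Qed.

Lemma riesz_exp_le (R : realType) (d : nat) (a b b' : R) (x : 'rV[int]_d) :
  1 <= a -> b' <= b -> riesz a b x <= riesz a b' x.
Proof.
by move=> a1 bb; apply: powRN_exp_le => //; have := sqnorm_ge0 R x; lra.
Qed.

Lemma rieszM (R : realType) (d : nat) (a b b' : R) (x : 'rV[int]_d) : 0 < a ->
  riesz a b x * riesz a b' x = riesz a (b + b') x.
Proof.
move=> a0; have p : 0 < sqnorm R x + a by rewrite ltr_wpDl// sqnorm_ge0.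
by rewrite /riesz -powRD -?opprD// (gt_eqF p) implybT.
Qed.

Definition box_seq (d m : nat) : seq 'rV[int]_d :=
  undup [seq (\row_i ((f i : nat)%:Z - m%:Z))
    | f : {ffun 'I_d -> 'I_(2 * m).+1} <- enum {: {ffun 'I_d -> 'I_(2 * m).+1}}].

Lemma mem_box_seq (R : realType) (d m : nat) (x : 'rV[int]_d) :
  sqnorm R x <= m%:R -> x \in box_seq d m.
Proof.
move=> xm; rewrite mem_undup; apply/mapP.
have xi i : (x 0 i <= m%:Z) /\ (- m%:Z <= x 0 i).
  have h : (x 0 i)%:~R ^+ 2 <= m%:R :> R.
    apply: le_trans xm; rewrite /sqnorm (bigD1 i)//=.
    by rewrite lerDl; apply: sumr_ge0 => j _; exact: sqr_ge0.
  have {h} : ((x 0 i) ^+ 2 <= m%:Z) by rewrite -(ler_int R) rmorphXn.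
  by rewrite expr2; nia.
exists [ffun i => inord (absz (x 0 i + m%:Z))]; first by rewrite mem_enum.
apply/rowP => i; rewrite mxE ffunE; have [x1 x2] := xi i.
have x3 : 0 <= x 0 i + m%:Z by rewrite -lerBlDr sub0r.
have ax : (absz (x 0 i + m%:Z))%:Z = x 0 i + m%:Z by rewrite gez0_abs.
rewrite inordK ?ax ?addrK// -ltz_nat ax; lia.
Qed.

(** The exponent [b] at which the coefficient [1 - 2 * (b + 1) / d%:R] in [riesz_laplacian]
    vanishes. *)
Definition crit (R : realType) (d : nat) : R := (d%:R - 2) / 2.

(** Only terms of order 1/t^2 remain, and [al * (1 + a)] exceeds the error constant by 1 for large
    [a]: the function is strictly superharmonic, even at the origin. *)
Lemma riesz_crit (R : realType) (d : nat) : (2 < d)%N ->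
  exists2 a0 : R, 1 <= a0 & forall a, a0 <= a -> exists C, forall x t,
    t = sqnorm R x + a + 1 ->
    t `^ (- crit R d) / t ^+ 2 <=
      riesz a (crit R d) x - avg (@riesz R d a (crit R d)) x <=
      C * (t `^ (- crit R d) / t ^+ 2).
Proof.
move=> d2; have dR : 3 <= d%:R :> R by rewrite ler_nat.
have al0 : 0 < crit R d by rewrite /crit; lra.
have [K K0 H] := riesz_laplacian (d:=d) al0 (ltn_trans (ltn0Sn 1) d2).
set al := crit R d in al0 H *.
have dE : d%:R = 2 * (al + 1) by rewrite /al /crit; field.
have b4 : 1 <= (al + 4) ^+ 2 by rewrite expr2; nra.
exists ((al + 4) ^+ 2 + (K + 1) / al).
  have : 0 <= (K + 1) / al by apply: divr_ge0; lra.
  by lra.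
move=> a aa; have Kal : 0 <= (K + 1) / al by apply: divr_ge0; lra.
have aK : K + 1 <= al * (1 + a).
  by rewrite mulrC -ler_pdivrMr//; lra.
exists (al * (1 + a) + K) => x t tE.
have n0 := sqnorm_ge0 R x.
have t0 : 0 < t by lra.
have ab : (al + 4) ^+ 2 <= a by lra.
move: (H a x t ab tE); set T := t `^ (- al).
have T2 : 0 <= T / t ^+ 2 by rewrite divr_ge0 ?powR_ge0 ?sqr_ge0.
rewrite (_ : T * _ = al * (1 + a) * (T / t ^+ 2)); last first.
  by rewrite dE; field; rewrite !gt_eqF//; lra.
rewrite -[K * T / _]mulrA ler_distl => /andP[h1 h2]; apply/andP; split.
  by apply: le_trans h1; rewrite -mulrBl ler_peMl//; lra.
by apply: le_trans h2 _; rewrite mulrDl.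
Qed.

(** Here the 1/t term is positive, and [t], being larger than [a], makes the error at most half of
    it. *)
Lemma riesz_super (R : realType) (d : nat) (b : R) : (2 < d)%N ->
  0 < b -> b < crit R d ->
  exists2 a0 : R, 1 <= a0 & exists2 c : R, 0 < c & forall a x t, a0 <= a ->
    t = sqnorm R x + a + 1 ->
    c * (t `^ (- b) / t) <= riesz a b x - avg (@riesz R d a b) x.
Proof.
move=> d2 b0 bc; have dR : 3 <= d%:R :> R by rewrite ler_nat.
have [K K0 H] := riesz_laplacian (d:=d) b0 (ltn_trans (ltn0Sn 1) d2).
set c := b * (1 - 2 * (b + 1) / d%:R).
have c0 : 0 < c.
  rewrite /c mulr_gt0// subr_gt0 ltr_pdivrMr ?mul1r; last by lra.
  by move: bc; rewrite /crit; lra.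
have b4 : 1 <= (b + 4) ^+ 2 by rewrite expr2; nra.
have Kc : 0 < K / (c / 2) by rewrite divr_gt0// divr_gt0.
exists ((b + 4) ^+ 2 + K / (c / 2)); first by lra.
exists (c / 2); first by lra.
move=> a x t aa tE; have n0 := sqnorm_ge0 R x.
have t0 : 0 < t by lra.
have ab : (b + 4) ^+ 2 <= a by lra.
have Kt : K / t <= c / 2.
  have /ltW : K / (c / 2) < t by lra.
  by rewrite ler_pdivrMr ?divr_gt0// ler_pdivrMr// mulrC.
move: (H a x t ab tE); rewrite -/c; set T := t `^ (- b).
have T0 : 0 <= T / t by rewrite divr_ge0 ?powR_ge0 ?(ltW t0).
have q0 : 0 <= 2 * b * (b + 1) / d%:R * (1 + a) / t ^+ 2.
  by apply: divr_ge0; rewrite ?sqr_ge0// mulr_ge0 ?divr_ge0 ?mulr_ge0//; lra.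
rewrite ler_distl => /andP[h1 _]; apply: le_trans h1.
rewrite (_ : K * T / t ^+ 2 = K / t * (T / t)); last by field; rewrite gt_eqF.
rewrite mulrDr (_ : T * (c / t) = c * (T / t)); last by ring.
have : 0 <= T * (2 * b * (b + 1) / d%:R * (1 + a) / t ^+ 2) by rewrite mulr_ge0 ?powR_ge0.
have : K / t * (T / t) <= c / 2 * (T / t) by rewrite ler_wpM2r.
lra.
Qed.

(** Here the 1/t term is negative, but the term with [1 + a] keeps its positive sign and is not
    small near the origin, where [t] is close to [1 + a]. Hence the correction [C], which depends on
    [a]: subharmonicity holds only far out. *)
Lemma riesz_sub (R : realType) (d : nat) (b : R) : (2 < d)%N ->
  crit R d < b ->
  exists2 a0 : R, 1 <= a0 & exists2 c : R, 0 < c & forall a, a0 <= a ->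
    exists2 C, 0 <= C & forall x t, t = sqnorm R x + a + 1 ->
    riesz a b x - avg (@riesz R d a b) x <=
      - c * (t `^ (- b) / t) + C * (t `^ (- b) / t ^+ 2).
Proof.
move=> d2 bc; have dR : 3 <= d%:R :> R by rewrite ler_nat.
have b0 : 0 < b by apply: le_lt_trans bc; rewrite /crit; lra.
have [K K0 H] := riesz_laplacian (d:=d) b0 (ltn_trans (ltn0Sn 1) d2).
set c := b * (1 - 2 * (b + 1) / d%:R).
have c0 : 0 < - c.
  rewrite /c -mulrN mulr_gt0// opprB subr_gt0 ltr_pdivlMr ?mul1r; last by lra.
  by move: bc; rewrite /crit; lra.
have b4 : 1 <= (b + 4) ^+ 2 by rewrite expr2; nra.
exists ((b + 4) ^+ 2) => //; exists (- c) => // a aa.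
have C0 : 0 <= 2 * b * (b + 1) / d%:R * (1 + a).
  by rewrite mulr_ge0 ?divr_ge0 ?mulr_ge0//; lra.
exists (2 * b * (b + 1) / d%:R * (1 + a) + K); first by lra.
move=> x t tE; have n0 := sqnorm_ge0 R x.
have t0 : 0 < t by lra.
move: (H a x t aa tE); rewrite -/c; set T := t `^ (- b).
rewrite ler_distl => /andP[_ h2]; apply: le_trans h2 _.
by rewrite opprK le_eqVlt; apply/orP; left; apply/eqP; field; rewrite !gt_eqF//; lra.
Qed.

Lemma crit_gt0 (R : realType) (d : nat) : (2 < d)%N -> 0 < crit R d.
Proof.
by move=> d2; have : 3 <= d%:R :> R by [rewrite ler_nat]; rewrite /crit; lra.
Qed.

Lemma powRN1 (R : realType) (t b : R) : 0 < t -> t `^ (- b) / t = t `^ (- (b + 1)).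
Proof.
by move=> t0; rewrite opprD powRD ?(gt_eqF t0) ?implybT// powR_inv1// ltW.
Qed.

Lemma riesz1_le_t (R : realType) (d : nat) (a b t : R) (x : 'rV[int]_d) :
  1 <= a -> 0 <= b -> t = sqnorm R x + a + 1 ->
  riesz 1 b x <= (2 * a) `^ b * t `^ (- b).
Proof.
move=> a1 b0 tE; have n0 := sqnorm_ge0 R x.
have -> : (2 * a) `^ b = ((2 * a) `^ (- b))^-1 by rewrite powRN invrK.
rewrite /riesz mulrC ler_pdivlMr ?powR_gt0//; last by lra.
rewrite -powRM; [|lra|lra]; apply: powRN_le => //; first by lra.
by rewrite tE; nra.
Qed.

Lemma walk_transient (R : realType) (d : nat) : (2 < d)%N ->
  exists2 C : R, 0 < C & forall N (x y : 'rV[int]_d),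
    \sum_(n < N) walk_prob R n x y <= C * riesz 1 (crit R d) (x - y).
Proof.
move=> d2; have al0 : 0 <= crit R d by rewrite ltW// crit_gt0.
have [a a1 /(_ a (lexx a))[C HC]] := riesz_crit R d2.
set al := crit R d in al0 HC *.
(* The lower bound of [riesz_crit] at the origin. The source [kap] at 0 turns the comparison into a
   bound on the expected number of visits to 0. *)
pose kap := (a + 1) `^ (- al) / (a + 1) ^+ 2.
have kap0 : 0 < kap by rewrite divr_gt0 ?powR_gt0 ?exprn_gt0//; lra.
exists kap^-1; first by rewrite invr_gt0.
move=> N x y; rewrite (eq_bigr (fun n : 'I_N => walk_prob R n (x - y) 0)); last first.
  by move=> n _; rewrite -(walk_prob_shift R n (- y)) subrr.
rewrite [leRHS]mulrC ler_pdivlMr// mulr_suml.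
apply: le_trans (riesz_le1 (x - y) a1 al0).
have := @superharmonic_sum R d (riesz a al) (fun u => if u == 0 then kap else 0) [:: 0] N (x - y) isT.
rewrite (eq_bigr (fun n : 'I_N => walk_prob R n (x - y) 0 * kap)); last first.
  by move=> n _; rewrite big_seq1 eqxx.
apply => [u|u|u]; first by rewrite ltW// riesz_gt0//; lra.
  by case: eqP => // _; rewrite ltW.
have /andP[+ _] := HC u _ erefl; have := sqnorm_ge0 R u.
case: eqP => [->|_] n0.
  rewrite (_ : sqnorm R 0 = 0) ?add0r -/kap; first by lra.
  by rewrite /sqnorm big1// => i _; rewrite mxE expr0n.
have : 0 <= (sqnorm R u + a + 1) `^ (- al) / (sqnorm R u + a + 1) ^+ 2.
  by rewrite divr_ge0 ?powR_ge0 ?sqr_ge0.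
lra.
Qed.

Lemma transientP (R : realType) (d : nat) : (2 < d)%N -> transient R d.
Proof.
by move=> /(walk_transient R)[C _ HC] x y; exists (C * riesz 1 (crit R d) (x - y)).
Qed.

Lemma green_upper (R : realType) (d : nat) : (2 < d)%N ->
  exists2 C : R, 0 < C & forall x y : 'rV[int]_d,
    green R x y <= C * riesz 1 (crit R d) (x - y).
Proof.
move=> d2; have [C C0 HC] := walk_transient R d2; exists C => // x y.
have h := green_cvg (x:=x) (y:=y) (transientP R d2).
rewrite -(cvg_lim _ h)//; apply: limr_le; first by apply/cvg_ex; eexists; exact: h.
by apply: nearW => N; exact: HC.
Qed.

(** A multiple of [riesz a b] is a supersolution by [riesz_super]; in the continuum, convolution
    with |x|^(2 - d) raises the power by 2. *)
Lemma potential_subcrit (R : realType) (d : nat) (b : R) : (2 < d)%N ->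
  0 < b -> b < crit R d ->
  exists2 C : R, 0 < C & forall Y (x : 'rV[int]_d), uniq Y ->
    \sum_(y <- Y) green R x y * riesz 1 (b + 1) y <= C * riesz 1 b x.
Proof.
move=> d2 b0 bc; have [a a1 [c c0 H]] := riesz_super d2 b0 bc.
pose K := (2 * a) `^ (b + 1) / c.
have K0 : 0 < K by rewrite divr_gt0// powR_gt0; lra.
exists K => // Y x uY.
apply: (@le_trans _ _ (K * riesz a b x)); last first.
  by rewrite ler_pM2l// riesz_le1// ltW.
apply: (green_potential_le (f := fun u => K * riesz a b u)) => //.
- exact: transientP.
- by move=> y; rewrite mulr_ge0 ?(ltW K0)// ltW// riesz_gt0//; lra.
- by move=> y; rewrite ltW// riesz_gt0.
move=> y; rewrite avgZ -lerBrDr -mulrBr.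
have n0 := sqnorm_ge0 R y.
have := H a y _ (lexx a) erefl; rewrite powRN1; last by lra.
set t := sqnorm R y + a + 1 => h.
have b1 : 0 <= b + 1 by lra.
apply: le_trans (riesz1_le_t a1 b1 (erefl t)) _.
rewrite (_ : (2 * a) `^ (b + 1) = K * c); last by rewrite /K divfK// gt_eqF.
by rewrite -mulrA ler_pM2l.
Qed.

(** A fast decaying source has a potential that decays no faster than |x|^(2 - d). The supersolution
    is a large multiple of the critical power minus [riesz a b]: the subtracted power produces the
    source. *)
Lemma potential_supercrit (R : realType) (d : nat) (b : R) : (2 < d)%N ->
  crit R d < b ->
  exists2 C : R, 0 < C & forall Y (x : 'rV[int]_d), uniq Y ->
    \sum_(y <- Y) green R x y * riesz 1 (b + 1) y <= C * riesz 1 (crit R d) x.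
Proof.
move=> d2 bc; have [a1 a11 H1] := riesz_crit R d2.
have al0 : 0 <= crit R d by rewrite ltW// crit_gt0.
have [a2 a21 [c c0 H2]] := riesz_sub d2 bc.
set al := crit R d in al0 H1 bc *.
pose a := a1 + a2; have aa1 : a1 <= a by rewrite /a; lra.
have a_ge1 : 1 <= a by rewrite /a; lra.
have aa2 : a2 <= a by rewrite /a; lra.
have [C1 {}H1] := H1 a aa1; have [C2 C20 {}H2] := H2 a aa2.
pose K := (2 * a) `^ (b + 1) / c.
have K0 : 0 < K by rewrite divr_gt0// powR_gt0; lra.
(* The summand 1 makes [f] nonnegative; [C2] pays for the correction in [riesz_sub] out of the
   strict superharmonicity of the critical power. *)
pose M := 1 + C2.
exists (K * M) => [|Y x uY]; first by rewrite mulr_gt0// /M; lra.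
pose f (u : 'rV[int]_d) := K * (M * riesz a al u + (-1) * riesz a b u).
have a0 : 0 < a by lra.
have rr (u : 'rV[int]_d) : riesz a b u <= riesz a al u by apply: riesz_exp_le => //; lra.
apply: (@le_trans _ _ (f x)); last first.
  rewrite /f -mulrA ler_pM2l//.
  have : M * riesz a al x <= M * riesz 1 al x by rewrite ler_wpM2l ?riesz_le1// /M; lra.
  by have := riesz_gt0 b x a0; lra.
apply: green_potential_le => //.
- exact: transientP.
- move=> y; rewrite mulr_ge0 ?(ltW K0)//.
  have := rr y; have : 0 <= C2 * riesz a al y by rewrite mulr_ge0// ltW// riesz_gt0.
  by rewrite /M; lra.
- by move=> y; rewrite ltW// riesz_gt0.
move=> y; rewrite avgZ avgD !avgZ -lerBrDr -mulrBr.
have n0 := sqnorm_ge0 R y.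
have /andP[h1 _] := H1 y _ erefl; have := H2 y _ erefl.
move: h1; set t := sqnorm R y + a + 1.
have t1 : 1 <= t by rewrite /t; lra.
have t0 : 0 < t by lra.
rewrite powRN1// => h1 h2.
have b1 : 0 <= b + 1 by lra.
apply: le_trans (riesz1_le_t a_ge1 b1 (erefl t)) _.
rewrite (_ : (2 * a) `^ (b + 1) = K * c); last by rewrite /K divfK// gt_eqF.
rewrite -mulrA ler_pM2l//.
have tt : t `^ (- b) / t ^+ 2 <= t `^ (- al) / t ^+ 2.
  by rewrite ler_pM2r ?invr_gt0 ?exprn_gt0// powRN_exp_le// ltW.
have t3 : 0 <= t `^ (- al) / t ^+ 2 by rewrite divr_ge0 ?powR_ge0 ?sqr_ge0.
have : C2 * (t `^ (- b) / t ^+ 2) <= C2 * (t `^ (- al) / t ^+ 2) by rewrite ler_wpM2l.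
have : M * (t `^ (- al) / t ^+ 2) <= M * (riesz a al y - avg (riesz a al) y).
  by rewrite ler_wpM2l// /M; lra.
rewrite /M; lra.
Qed.

(** * The lower bound for Green's function *)

Lemma le_iter_avg (R : realType) (d n : nat) (f g : 'rV[int]_d -> R) x :
  (forall y, f y <= g y) -> iter n (@avg R d) f x <= iter n (@avg R d) g x.
Proof. by move=> fg; elim: n x => //= n IH x; exact: le_avg. Qed.

Lemma iter_avgZ (R : realType) (d n : nat) c (f : 'rV[int]_d -> R) x :
  iter n (@avg R d) (fun y => c * f y) x = c * iter n (@avg R d) f x.
Proof.
by elim: n x => //= n IH x; rewrite -avgZ; apply: eq_avg => y.
Qed.

Lemma iter_avg_indic (R : realType) (d n : nat) (Y : seq 'rV[int]_d) x :
  iter n (@avg R d) (fun y => \sum_(z <- Y) (y == z)%:R) x =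
  \sum_(z <- Y) walk_prob R n x z.
Proof.
elim: n x => [|n IH] x /=; first by apply: eq_bigr => z _; rewrite walk_prob0.
rewrite (eq_avg _ IH) avg_sum.
by apply: eq_bigr => z _; rewrite walk_probS.
Qed.

Lemma iter_avg_sum_le (R : realType) (d N : nat) (f rho : 'rV[int]_d -> R) x :
  (forall y, 0 <= f y) -> (forall y, rho y + avg f y <= f y) ->
  \sum_(n < N) iter n (@avg R d) rho x <= f x.
Proof.
move=> f0 sup; elim: N x => [|N IH] x; first by rewrite big_ord0.
rewrite big_ord_recl /=; apply: le_trans (sup x); apply: lerD => //.
by apply: le_trans (le_avg x IH); rewrite avg_sum.
Qed.

Lemma le_iter_avg_sum (R : realType) (d N : nat) (f h : 'rV[int]_d -> R) x :
  (forall y, f y <= h y + avg f y) ->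
  f x <= iter N (@avg R d) f x + \sum_(n < N) iter n (@avg R d) h x.
Proof.
move=> sub; elim: N x => [|N IH] x; first by rewrite big_ord0 addr0.
rewrite big_ord_recl /= addrCA; apply: le_trans (sub x) _; rewrite lerD2l.
by apply: le_trans (le_avg x IH) _; rewrite avgD avg_sum.
Qed.

(** A multiple of [riesz a (crit R d - 1)], whose exponent is positive because [d > 4]. It bounds
    the sum of all iterates of [avg] on the critical power, so that these iterates become small. *)
Lemma riesz_super_crit_pred (R : realType) (d : nat) : (4 < d)%N ->
  exists2 f : 'rV[int]_d -> R, (forall x, 0 <= f x) &
    forall x, riesz 1 (crit R d) x + avg f x <= f x.
Proof.
move=> d4; have d2 : (2 < d)%N by exact: ltn_trans d4.
have dR : 5 <= d%:R :> R by rewrite ler_nat.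
have [||a a1 [c c0 H]] := @riesz_super R d (crit R d - 1) d2; rewrite /crit; [lra|lra|].
rewrite -/(crit R d); set al := crit R d.
have al0 : 0 <= al by rewrite ltW// crit_gt0.
pose K := (2 * a) `^ al / c.
have K0 : 0 < K by rewrite divr_gt0// powR_gt0; lra.
exists (fun x => K * riesz a (al - 1) x) => x.
  by rewrite mulr_ge0 ?(ltW K0)// ltW// riesz_gt0//; lra.
rewrite avgZ -lerBrDr -mulrBr.
have n0 := sqnorm_ge0 R x.
have := H a x _ (lexx a) erefl; rewrite -/al powRN1 ?subrK; last by lra.
set t := sqnorm R x + a + 1 => h.
apply: le_trans (riesz1_le_t a1 al0 (erefl t)) _.
rewrite (_ : (2 * a) `^ al = K * c); last by rewrite /K divfK// gt_eqF.
by rewrite -mulrA ler_pM2l.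
Qed.

Lemma iter_avg_riesz_small (R : realType) (d : nat) (x : 'rV[int]_d) (eps : R) :
  (4 < d)%N -> 0 < eps ->
  exists N, iter N (@avg R d) (riesz 1 (crit R d)) x <= eps.
Proof.
move=> d4 e0; have [f f0 sup] := riesz_super_crit_pred R d4.
apply: contrapT => /forallNP H.
pose N := Num.truncn (f x / eps).
have := iter_avg_sum_le N.+1 x f0 sup.
apply/negP; rewrite -ltNge; apply: (@lt_le_trans _ _ (\sum_(n < N.+1) eps)).
  rewrite sumr_const card_ord -mulr_natl -ltr_pdivrMr//.
  exact: truncnS_gt.
by apply: ler_sum => n _; apply/ltW; rewrite ltNge; apply/negP/H.
Qed.

(** With [be = al + 2^-1], the function [riesz a al + riesz a be] is subharmonic off the finite set
    [D]: the negative term of order t^(-be - 1) wins against t^(-al - 2). Iterating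
    [f <= h + avg f], the iterates of [f] become small, so [f] is at most a multiple of the sum of
    [green R x z] over z in [D], which the Harnack inequality compares with [green R x 0]. *)
Lemma green_lower (R : realType) (d : nat) : (4 < d)%N ->
  exists2 c : R, 0 < c & forall x y : 'rV[int]_d,
    c * riesz 1 (crit R d) (x - y) <= green R x y.
Proof.
move=> d4; have d2 : (2 < d)%N by exact: ltn_trans d4.
have tr := @transientP R d d2.
have [a1 a11 H1] := riesz_crit R d2.
have [|a2 a21 [c c0 H2]] := @riesz_sub R d (crit R d + 2^-1) d2; first by lra.
have al0 : 0 <= crit R d by rewrite ltW// crit_gt0.
set al := crit R d in al0 H1 H2 *; pose be := al + 2^-1.
pose a := a1 + a2; have aa1 : a1 <= a by rewrite /a; lra.
have a_ge1 : 1 <= a by rewrite /a; lra.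
have aa2 : a2 <= a by rewrite /a; lra.
have [C1 {}H1] := H1 a aa1; have [C2 C20 {}H2] := H2 a aa2.
have a0 : 0 < a by lra.
pose C := `|C1| + C2; have C0 : 0 <= C by rewrite addr_ge0.
(* Off [D], [t] is at least [T0], so its square root is at least [C / c]; a square root of [t] is
   what the two powers to be compared differ by. *)
pose T0 := (C / c) ^+ 2.
pose D := box_seq d (Num.truncn T0).+1.
pose f (x : 'rV[int]_d) := riesz a al x + riesz a be x.
pose h (x : 'rV[int]_d) : R := C * \sum_(z <- D) (x == z)%:R.
have sub x : f x <= h x + avg f x.
  rewrite -lerBlDr /f avgD; have /andP[_] := H1 x _ erefl.
  have := H2 x _ erefl; rewrite -/be; set t := sqnorm R x + a + 1.
  have n0 := sqnorm_ge0 R x; have t1 : 1 <= t by rewrite /t; lra.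
  have t0 : 0 < t by lra.
  set T2 := t `^ (- al) / t ^+ 2.
  have T20 : 0 <= T2 by rewrite divr_ge0 ?powR_ge0 ?sqr_ge0.
  have tb : t `^ (- be) / t ^+ 2 <= T2.
    by rewrite ler_pM2r ?invr_gt0 ?exprn_gt0// powRN_exp_le// /be; lra.
  have tb0 : 0 <= t `^ (- be) / t by rewrite divr_ge0 ?powR_ge0// ltW.
  have : C1 * T2 <= `|C1| * T2 by rewrite ler_wpM2r// ler_norm.
  have : C2 * (t `^ (- be) / t ^+ 2) <= C2 * T2 by rewrite ler_wpM2l.
  move=> h1 h2 h3 h4.
  apply: (@le_trans _ _ (C * T2 - c * (t `^ (- be) / t))); first by rewrite /C; lra.
  have [xD|xD] := boolP (x \in D).
    rewrite /h; apply: (@le_trans _ _ (C * 1)).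
      rewrite lerBlDr; apply: ler_wpDr; first by rewrite mulr_ge0// ltW.
      rewrite ler_wpM2l// /T2 ler_pdivrMr ?exprn_gt0// mul1r.
      apply: (@le_trans _ _ 1); last by rewrite exprn_ege1.
      by rewrite powRN invf_le1 ?powR_gt0// -(powRr0 t) ler_powR.
    rewrite ler_wpM2l// (bigD1_seq x) ?undup_uniq//= eqxx lerDl sumr_ge0//.
  have tT : T0 <= t.
    have : ~ (sqnorm R x <= (Num.truncn T0).+1%:R) by move=> /mem_box_seq; apply/negP.
    move=> /negP; rewrite -ltNge; have := truncnS_gt T0; rewrite /t; lra.
  apply: (@le_trans _ _ 0); last by rewrite mulr_ge0// sumr_ge0.
  rewrite subr_le0 /T2 /be.
  have s0 : 0 < t `^ (2^-1) by rewrite powR_gt0.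
  have ss : C <= c * t `^ (2^-1).
    rewrite mulrC -ler_pdivrMr// powR12_sqrt ?(ltW t0)//.
    by apply: le_trans (ler_norm _) _; rewrite -sqrtr_sqr ler_wsqrtr.
  have sq2 : t `^ (2^-1) * t `^ (2^-1) = t.
    by rewrite powR12_sqrt ?(ltW t0)// -expr2 sqr_sqrtr// ltW.
  rewrite opprD powRD ?(gt_eqF t0) ?implybT// [t `^ (- 2^-1)]powRN.
  set s := t `^ (2^-1) in s0 ss sq2 *; set TT := t `^ (- al).
  rewrite -sq2 (_ : c * _ = (c * s) * (TT / (s * s) ^+ 2)); last first.
    by field; rewrite gt_eqF.
  by rewrite ler_wpM2r// divr_ge0 ?powR_ge0// exprn_ge0// mulr_ge0// ltW.
have [K K0 HK] : exists2 K, 0 < K & forall x, \sum_(y <- D) green R x y <= K * green R x 0.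
  elim: D {h sub} => [|y D [K K0 HK]].
    by exists 1 => // x; rewrite big_nil mul1r green_ge0.
  have [k k0 Hk] := harnack y 0 tr; exists (k + K); first by rewrite addr_gt0.
  move=> x; rewrite big_cons mulrDl lerD// green_sym (green_sym _ x); exact: Hk.
have fle x : f x <= C * (K * green R x 0).
  apply/ler_addgt0Pr => e e0.
  have [N HN] := iter_avg_riesz_small x d4 (divr_gt0 e0 (ltr0Sn R 1)).
  have := le_iter_avg_sum N x sub; set S := \sum_(n < N) _ => h1.
  have h2 : iter N (@avg R d) f x <= e.
    apply: (@le_trans _ _ (2 * iter N (@avg R d) (riesz 1 al) x)); last first.
      by move: HN; rewrite -/al; lra.
    rewrite -iter_avgZ; apply: le_iter_avg => y; rewrite /f.
    have := riesz_le1 y a_ge1 al0.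
    have : riesz a be y <= riesz a al y by apply: riesz_exp_le => //; rewrite /be; lra.
    lra.
  suff : S <= C * (K * green R x 0) by lra.
  rewrite /S /h (eq_bigr (fun n : 'I_N => C * \sum_(z <- D) walk_prob R n x z)); last first.
    by move=> n _; rewrite iter_avgZ iter_avg_indic.
  rewrite -mulr_sumr ler_wpM2l//; apply: le_trans (HK x).
  by rewrite exchange_big /= ler_sum// => y _; apply: green_ge.
have C_gt0 : 0 < C.
  rewrite lt_def C0 andbT; apply/negP => /eqP C00; have := fle 0; rewrite C00 mul0r.
  by rewrite /f; have := riesz_gt0 al (0 : 'rV[int]_d) a0; have := riesz_gt0 be (0 : 'rV[int]_d) a0; lra.
have aal : 0 < a `^ al by rewrite powR_gt0.
exists (a `^ al * (C * K))^-1; first by rewrite invr_gt0 !mulr_gt0.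
move=> x y; rewrite mulrC ler_pdivrMr ?mulr_gt0//.
apply: le_trans (riesz1_le (x - y) a_ge1 al0) _.
rewrite [leRHS]mulrC -mulrA ler_pM2l//.
rewrite -(green_shift R (- y) x y) subrr -mulrA; apply: le_trans (fle _).
by rewrite /f lerDl ltW// riesz_gt0.
Qed.

(** * Ratios of Green's function at infinity *)

Lemma expr_unbounded (R : realType) (M B : R) : 1 < M -> exists J, B <= M ^+ J.
Proof.
move=> M1; have bern n : 1 + n%:R * (M - 1) <= M ^+ n.
  elim: n => [|n IH]; first by rewrite mul0r addr0 expr0.
  have : M * (1 + n%:R * (M - 1)) <= M ^+ n.+1 by rewrite exprS ler_pM2l//; lra.
  have : 0 <= n%:R * (M - 1) ^+ 2 by rewrite mulr_ge0 ?sqr_ge0.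
  by rewrite -(natr1 n); lra.
exists (Num.truncn (B / (M - 1))).+1; apply: le_trans (bern _).
have := truncnS_gt (B / (M - 1)); rewrite ltr_pdivrMr; last by lra.
lra.
Qed.

Lemma sqnorm_near (R : realType) (d : nat) (x v : 'rV[int]_d) :
  sqnorm R x / 2 - sqnorm R v <= sqnorm R (x + v).
Proof.
have := sqnormD R (x + v) (- v); rewrite addrK sqnormN.
lra.
Qed.

(* If the ratio [green (z + e) 0 / green z 0] had an upper limit [M > 1], then
   [M green z 0 - green (z + e) 0] would be nearly a nonnegative harmonic
   function; where it is small it stays small along [z + e, z + 2e, ...] by the
   Harnack inequality, so that [green] would grow like [M^j] along this ray,
   against the power law bounds. *)
Lemma green_step_ratio (R : realType) (d : nat) (e : 'I_d * bool) (eps : R) :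
  (4 < d)%N -> 0 < eps -> exists r, forall z : 'rV[int]_d, r <= sqnorm R z ->
    green R (z + walk_step e) 0 <= (1 + eps) * green R z 0.
Proof.
move=> d4 eps0; have d2 : (2 < d)%N by exact: ltn_trans d4.
have tr := @transientP R d d2; have d0 : (0 < d)%N by exact: ltn_trans d2.
pose u (z : 'rV[int]_d) : R := green R z 0; have u0 z : 0 < u z by exact: green_gt0.
pose w := walk_step e.
pose S := [set M : R | 1 <= M /\ exists r, forall z, r <= sqnorm R z -> u (z + w) <= M * u z].
have D1 : 1 <= (2 * d)%:R :> R by rewrite ler1n muln_gt0.
have S2d : S (2 * d)%:R by split => //; exists 0 => z _; exact: green_step_le.
have Sinf : has_inf S.
  by split; [exists (2 * d)%:R | exists 1 => M []].
pose M := inf S.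
have M1 : 1 <= M by apply: lb_le_inf => [|M' []]//; exists (2 * d)%:R.
have [ML|ML] := ltP M (1 + eps).
  have e1 : 0 < 1 + eps - M by lra.
  have [M' [_ [r Hr]] M'L] := inf_adherent e1 Sinf.
  exists r => z /Hr h; apply: le_trans h _; rewrite ler_wpM2r ?(ltW (u0 _))//.
  by move: M'L; rewrite -/M; lra.
exfalso.
have [C C0 HC] := green_upper R d2; have [c c0 Hc] := green_lower R d4.
set al := crit R d in HC Hc; have al0 : 0 <= al by rewrite ltW// crit_gt0.
(* Along the ray the squared length stays above a quarter of that of [z0], so that [u] stays below
   [C' * u z0]. *)
pose C' := C * (4 `^ al / c).
have C'0 : 0 <= C' by rewrite mulr_ge0 ?(ltW C0)// divr_ge0 ?powR_ge0// ltW.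
have [J HJ] := @expr_unbounded R M (C' + 2) ltac:(lra).
pose D : R := (2 * d)%:R.
(* The first bound keeps [M - del] at least 1, so that it misses [S] only by failing the eventual
   inequality; the second keeps the loss accumulated over [J] steps below 1. *)
pose del := Num.min eps (2 * (M + D) ^+ J)^-1.
have MD0 j : 0 < (M + D) ^+ j by rewrite exprn_gt0// /D; lra.
have del0 : 0 < del by rewrite lt_min eps0 invr_gt0 mulr_gt0.
have del1 : del <= eps by rewrite ge_min lexx.
have del2 : 2 * del * (M + D) ^+ J <= 1.
  rewrite mulrAC -ler_pdivlMl ?mulr_gt0// mulr1.
  by rewrite ge_min lexx orbT.
have [M2 [M21 [r1 Hr1]] M2M] := inf_adherent del0 Sinf.
have NS : ~ S (M - del).
  move=> SM; have := ge_inf (proj2 Sinf) SM; rewrite -/M; lra.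
pose W := \sum_(j < J.+1) \sum_(e' : 'I_d * bool) sqnorm R (w *+ j + walk_step e').
pose W' := \sum_(j < J.+2) sqnorm R (w *+ j).
have W0 : 0 <= W by rewrite sumr_ge0// => j _; rewrite sumr_ge0// => e' _; exact: sqnorm_ge0.
have W0' : 0 <= W' by rewrite sumr_ge0// => j _; exact: sqnorm_ge0.
(* So large that the first [J] points of the ray and their neighbours lie where [M2] is a valid
   bound, and that the ray stays away from 0. *)
pose R0 := 2 * (`|r1| + W + 1 + W') + 4 * W'.
have [z0 [z0R z0M]] : exists z0, R0 <= sqnorm R z0 /\ (M - del) * u z0 < u (z0 + w).
  apply: contrapT => /forallNP H; apply: NS; split; first by lra.
  exists R0 => z zR; rewrite leNgt; apply/negP => zM.
  by apply: (H z).
pose z j := z0 + w *+ j.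
have zS j : z j.+1 = z j + w by rewrite /z mulrSr addrA.
have near1 j e' : (j <= J)%N -> r1 <= sqnorm R (z j + walk_step e').
  move=> jJ; rewrite /z -addrA; apply: le_trans (sqnorm_near R _ _).
  have : sqnorm R (w *+ j + walk_step e') <= W.
    rewrite /W (bigD1 (Ordinal (jJ : (j < J.+1)%N)))//= (bigD1 e')//= -addrA lerDl.
    apply: addr_ge0; apply: sumr_ge0 => *; first exact: sqnorm_ge0.
    by apply: sumr_ge0 => *; exact: sqnorm_ge0.
  by have := ler_norm r1; move: z0R; rewrite /R0; lra.
have near2 j : (j <= J.+1)%N -> sqnorm R z0 / 4 <= sqnorm R (z j) /\ 0 < sqnorm R (z j).
  move=> jJ; have := sqnorm_near R z0 (w *+ j); rewrite -/(z j).
  have : sqnorm R (w *+ j) <= W'.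
    rewrite /W' (bigD1 (Ordinal (jJ : (j < J.+2)%N)))//= lerDl.
    by rewrite sumr_ge0// => *; exact: sqnorm_ge0.
  by have := normr_ge0 r1; move: z0R; rewrite /R0; split; lra.
have nz j : (j <= J.+1)%N -> (z j == 0) = false.
  move=> /near2[_]; case: eqP => // ->.
  by rewrite /sqnorm big1 ?ltxx// => i _; rewrite mxE expr0n.
pose v y := M2 * u y - u (y + w).
have v0 j e' : (j <= J)%N -> 0 <= v (z j + walk_step e').
  by move=> jJ; rewrite subr_ge0; apply: Hr1; exact: near1.
have Davg (f : 'rV[int]_d -> R) y : D * avg f y = \sum_e' f (y + walk_step e').
  by rewrite /avg -/D mulrC divfK// gt_eqF// /D; lra.
have uavg y : y == 0 = false -> D * u y = \sum_e' u (y + walk_step e').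
  by move=> y0; rewrite -Davg /u (green_rec y 0 tr) y0 add0r.
have vS j : (j <= J)%N -> v (z j.+1) <= D * v (z j).
  move=> jJ; have -> : D * v (z j) = \sum_e' v (z j + walk_step e').
    have -> : D * v (z j) = M2 * (D * u (z j)) - D * u (z j + w) by rewrite /v; ring.
    rewrite (uavg _ (nz j (leqW jJ))) uavg; last by rewrite -zS; exact: nz.
    rewrite mulr_sumr -sumrB; apply: eq_bigr => e' _.
    by rewrite (addrAC (z j) w (walk_step e')).
  rewrite zS (bigD1 e)//= -/w lerDl sumr_ge0// => e' _; exact: v0.
have vb j : (j <= J)%N -> v (z j) <= D ^+ j * (2 * del * u z0).
  elim: j => [_|j IH jJ].
    rewrite /v /z mulr0n addr0 expr0 mul1r.
    have : M2 * u z0 <= (M + del) * u z0 by rewrite ler_wpM2r ?(ltW (u0 _))// ltW.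
    lra.
  apply: le_trans (vS j (ltnW jJ)) _; rewrite exprS -mulrA ler_wpM2l ?IH ?(ltnW jJ)//.
have MM2 : M <= M2 by apply: (ge_inf (proj2 Sinf)); split => //; exists r1.
(* One step multiplies the loss by at most [M] and adds at most 2 [del] [D ^+ j]; both are absorbed
   by the passage from [(M + D) ^+ j] to the next power. *)
have ub j : (j <= J)%N -> (M ^+ j - 2 * del * (M + D) ^+ j) * u z0 <= u (z j).
  elim: j => [_|j IH jJ].
    by rewrite /z mulr0n addr0 !expr0; have := u0 z0; nra.
  have h1 := vb j (ltnW jJ); have h2 := IH (ltnW jJ).
  rewrite zS (_ : u (z j + w) = M2 * u (z j) - v (z j)); last by rewrite /v; ring.
  have h3 : M * u (z j) <= M2 * u (z j) by rewrite ler_wpM2r// ltW.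
  have h4 : M * ((M ^+ j - 2 * del * (M + D) ^+ j) * u z0) <= M * u (z j).
    by rewrite ler_wpM2l//; lra.
  have h5 : D ^+ j * (2 * del * u z0) <= D * (M + D) ^+ j * (2 * del * u z0).
    have q0 : 0 <= 2 * del * u z0 by rewrite !mulr_ge0// ltW.
    rewrite ler_wpM2r//; apply: (@le_trans _ _ ((M + D) ^+ j)).
      by rewrite lerXn2r ?nnegrE// /D; lra.
    by rewrite ler_peMl ?(ltW (MD0 j)).
  rewrite !exprS; lra.
have := ub J (leqnn J).
have n4 := (near2 J (leqnSn J)).1.
have : u (z J) <= C' * u z0.
  apply: le_trans (HC _ _) _; rewrite subr0 /C' -!mulrA ler_pM2l//.
  apply: (@le_trans _ _ (4 `^ al * riesz 1 al z0)); last first.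
    rewrite ler_wpM2l ?powR_ge0// mulrC ler_pdivlMr// mulrC.
    by have := Hc z0 0; rewrite subr0.
  have -> : 4 `^ al = ((4 : R) `^ (- al))^-1 by rewrite powRN invrK.
  have n0 := sqnorm_ge0 R z0; have n0' := sqnorm_ge0 R (z J).
  rewrite mulrC ler_pdivlMr ?powR_gt0// -powRM ?powRN_le//; lra.
have : (C' + 2 - 1) * u z0 <= (M ^+ J - 2 * del * (M + D) ^+ J) * u z0.
  by rewrite ler_wpM2r ?(ltW (u0 _))//; lra.
by have := u0 z0; lra.
Qed.

Lemma green_ratio_le (R : realType) (d : nat) (v : 'rV[int]_d) (eps : R) :
  (4 < d)%N -> 0 < eps -> exists r, forall z : 'rV[int]_d, r <= sqnorm R z ->
    green R (z + v) 0 <= (1 + eps) * green R z 0.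
Proof.
move=> d4; have d2 : (2 < d)%N by exact: ltn_trans d4.
have tr := @transientP R d d2.
move: v eps; apply: step_ind => [eps e0|v e IH eps e0].
  exists 0 => z _; rewrite addr0 ler_peMl ?green_ge0//; lra.
(* For e at most 1, (1 + e)^2 is at most 1 + 3e. *)
pose eps' := Num.min 1 (eps / 3).
have e1 : eps' <= 1 by rewrite ge_min lexx.
have e3 : eps' <= eps / 3 by rewrite ge_min lexx orbT.
have e0' : 0 < eps' by rewrite lt_min ltr01 divr_gt0.
have [r1 H1] := IH _ e0'; have [r2 H2] := green_step_ratio e d4 e0'.
exists (`|r1| + 2 * (`|r2| + sqnorm R v)) => z zr.
have r10 := normr_ge0 r1; have r20 := normr_ge0 r2; have v0 := sqnorm_ge0 R v.
rewrite addrA; apply: le_trans (H2 _ _) _.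
  by apply: le_trans (sqnorm_near R _ _); have := ler_norm r2; lra.
have h : green R (z + v) 0 <= (1 + eps') * green R z 0.
  by apply: H1; have := ler_norm r1; lra.
apply: (@le_trans _ _ ((1 + eps') * ((1 + eps') * green R z 0))).
  by rewrite ler_wpM2l//; lra.
rewrite mulrA ler_wpM2r ?green_ge0//; nra.
Qed.

Lemma tends_to_infty_filter (R : realType) (T : Type) (f : T -> R) :
  Filter (tends_to_infty f).
Proof.
apply: filter_from_filter; first by exists 0.
by move=> M N _ _; exists (Num.max M N) => // t /=; rewrite ge_max => /andP[].
Qed.

#[global] Instance near_infinity_filter (R : realType) (d : nat) :
  Filter (@near_infinity R d).
Proof. exact: tends_to_infty_filter. Qed.

#[global] Instance far_apart_filter (R : realType) (d : nat) :
  Filter (@far_apart R d).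
Proof. exact: tends_to_infty_filter. Qed.

#[global] Instance well_separated_filter (R : realType) (d k : nat) :
  Filter (@well_separated R d k).
Proof. exact: tends_to_infty_filter. Qed.

Lemma enormE (R : realType) (d : nat) (x : 'rV[int]_d) :
  enorm R x = Num.sqrt (sqnorm R x).
Proof. by []. Qed.

Lemma near_infinity_sqnorm (R : realType) (d : nat) (P : set 'rV[int]_d) (r : R) :
  (forall z, r <= sqnorm R z -> P z) -> \forall z \near @near_infinity R d, P z.
Proof.
move=> H; exists (`|r| + 1) => // z /=; rewrite enormE => h; apply: H.
have h2 : (`|r| + 1) ^+ 2 <= sqnorm R z.
  by rewrite -(sqr_sqrtr (sqnorm_ge0 R z)) lerXn2r ?nnegrE ?sqrtr_ge0 ?addr_ge0.
by apply: le_trans h2; have := ler_norm r; have := normr_ge0 r; nra.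
Qed.

Lemma sqnorm_unbounded (R : realType) (d : nat) (M : R) : (0 < d)%N ->
  exists z : 'rV[int]_d, M <= sqnorm R z.
Proof.
move=> d0; pose n := (Num.truncn M).+1; pose i := Ordinal d0.
exists (n%:Z *: delta_mx 0 i); rewrite /sqnorm (bigD1 i)//= !mxE !eqxx mulr1.
apply: ler_wpDr; first by apply: sumr_ge0 => j _; exact: sqr_ge0.
have := truncnS_gt M; rewrite -/n => h; apply: le_trans (ltW h) _.
have : 1 <= n%:R :> R by rewrite ler1n.
rewrite -pmulrn expr2; nra.
Qed.

Lemma near_infinity_proper (R : realType) (d : nat) : (0 < d)%N ->
  ProperFilter (@near_infinity R d).
Proof.
move=> d0; apply: filter_from_proper => M _.
have [z hz] := @sqnorm_unbounded R d (M ^+ 2) d0; exists z => /=.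
rewrite enormE; apply: le_trans (ler_norm M) _.
by rewrite -sqrtr_sqr ler_wsqrtr.
Qed.

Lemma near_infinity_ge (R : realType) (d : nat) (r : R) : 
  \forall z \near @near_infinity R d, r <= sqnorm R z.
Proof. exact: (@near_infinity_sqnorm R d (fun z => r <= sqnorm R z) r (fun _ h => h)). Qed.

Lemma green_ratio_cvg (R : realType) (d : nat) (x w : 'rV[int]_d) : (4 < d)%N ->
  green R w z / green R x z @[z --> @near_infinity R d] --> (1 : R).
Proof.
move=> d4; have d2 : (2 < d)%N by exact: ltn_trans d4.
have tr := @transientP R d d2.
have gE y z : green R y z = green R (z - y) 0.
  by rewrite -(green_shift R (- y)) subrr green_sym.
apply/cvgrPdist_le => eps e0.
pose e := Num.min (eps / 2) 2^-1.
have e00 : 0 < e by rewrite lt_min divr_gt0//= invr_gt0 ltr0n.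
have e1 : e <= eps / 2 by rewrite ge_min lexx.
have e2 : e <= 2^-1 by rewrite ge_min lexx orbT.
have [r1 H1] := @green_ratio_le R d (x - w) e d4 e00.
have [r2 H2] := @green_ratio_le R d (w - x) e d4 e00.
apply: (@near_infinity_sqnorm R d _ (2 * (`|r1| + `|r2| + sqnorm R (- x) + sqnorm R (- w)))).
move=> z hz.
have n1 := normr_ge0 r1; have n2 := normr_ge0 r2.
have n3 := sqnorm_ge0 R (- x); have n4 := sqnorm_ge0 R (- w).
have l1 := ler_norm r1; have l2 := ler_norm r2.
have q1 : r1 <= sqnorm R (z - x) by apply: le_trans (sqnorm_near R _ _); lra.
have q2 : r2 <= sqnorm R (z - w) by apply: le_trans (sqnorm_near R _ _); lra.
have gx : 0 < green R x z by exact: green_gt0.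
have gw : 0 < green R w z by exact: green_gt0.
have := H1 _ q1; rewrite addrA subrK -!gE => h1.
have := H2 _ q2; rewrite addrA subrK -!gE => h2.
rewrite ler_distl; apply/andP; split.
  by rewrite lerBlDr ler_pdivrMr//; nra.
have -> : green R w z / green R x z + eps =
    (green R w z + eps * green R x z) / green R x z by field; rewrite gt_eqF.
rewrite ler_pdivlMr// mul1r.
have h3 : green R w z <= 2 * green R x z by nra.
have : e * green R w z <= eps * green R x z; last by lra.
apply: le_trans (_ : e * green R w z <= e * (2 * green R x z)) _.
  by rewrite ler_wpM2l// ltW.
have : 2 * e <= eps -> e * (2 * green R x z) <= eps * green R x z by nra.
by apply; lra.
Qed.

(** * Lattice sums against Green's function *)

Lemma esum_le_seq (R : realType) (T : choiceType) (A : set T) (f : T -> R) (M : R) :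
  (forall Y : seq T, uniq Y -> (forall y, y \in Y -> A y) -> \sum_(y <- Y) f y <= M) ->
  (\esum_(y in A) (f y)%:E <= M%:E)%E.
Proof.
move=> H; apply: ge_ereal_sup => _ [X [finX XA] <-].
rewrite fsbig_finite//= sumEFin lee_fin; apply: H; first exact: fset_uniq.
by move=> y; rewrite in_fset_set// inE => /XA.
Qed.

Lemma esum_seq (R : realType) (T : choiceType) (Y : seq T) (f : T -> \bar R) :
  uniq Y -> (forall y, (0 <= f y)%E) ->
  (\esum_(y in [set` Y]) f y = \sum_(y <- Y) f y)%E.
Proof.
move=> uY f0; rewrite esum_fset//.
by rewrite -(fsbig_seq _ _ uY).
Qed.

Lemma powRN_small (R : realType) (b eps : R) : 0 < b -> 0 < eps ->
  exists n : nat, (n%:R + 1) `^ (- b) <= eps.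
Proof.
move=> b0 e0; pose m := (eps^-1) `^ b^-1.
exists (Num.truncn m).+1; have := truncnS_gt m; set n := _.+1%:R => mn.
have m0 : 0 <= m by exact: powR_ge0.
rewrite powRN -[leRHS]invrK lef_pV2 ?posrE ?invr_gt0 ?powR_gt0//; last by lra.
have -> : eps^-1 = m `^ b.
  by rewrite /m -powRrM mulVf ?gt_eqF// powRr1// invr_ge0 ltW.
by rewrite ge0_ler_powR ?nnegrE ?(ltW b0)//; lra.
Qed.

(** The Cauchy criterion behind both limits in z; [g] will be the contribution of a finite box. *)
Lemma cvg_of_approx (R : realType) (T : Type) (F : set_system T)
    (f : T -> R) : ProperFilter F ->
  (forall eps, 0 < eps -> exists (g : T -> R) (l : R), (g t @[t --> F] --> l) /\
     \forall t \near F, `|f t - g t| <= eps) ->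
  cvg (f t @[t --> F]).
Proof.
move=> FF H; apply/cauchy_cvgP; apply: cauchy_exP => eps e0.
have e2 : 0 < eps / 2 by rewrite divr_gt0.
have [g [l [gl fg]]] := H _ (divr_gt0 e2 (ltr0Sn R 1)).
exists l; have /cvgrPdist_lt/(_ _ e2) gl' := gl.
move: fg gl'; apply: filterS2 => t h2 h1; rewrite /ball /=.
rewrite (_ : l - f t = (l - g t) - (f t - g t)); last by ring.
by apply: le_lt_trans (ler_normB _ _) _; lra.
Qed.

Lemma le_esum_subset (R : realType) (T : choiceType) (A B : set T)
    (f : T -> \bar R) :
  A `<=` B -> (\esum_(t in A) f t <= \esum_(t in B) f t)%E.
Proof.
move=> AB; apply: ge_ereal_sup => _ [X [finX XA] <-].
by apply: ereal_sup_ubound; exists X => //; split => //; exact: subset_trans AB.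
Qed.

Lemma riesz_far (R : realType) (d n : nat) (b : R) (w : 'rV[int]_d) : 0 <= b ->
  w \notin box_seq d n -> riesz 1 b w <= (n%:R + 1) `^ (- b).
Proof.
move=> b0 wn; have nw : n%:R < sqnorm R w.
  by rewrite ltNge; apply: contra wn; exact: mem_box_seq.
by apply: powRN_le => //; lra.
Qed.

Lemma esum_potential_supercrit (R : realType) (d : nat) (b : R) : (2 < d)%N ->
  crit R d < b ->
  exists2 C : R, 0 < C & forall x : 'rV[int]_d,
   (\esum_(y in setT) (green R x y * riesz 1 (b + 1) y)%:E <=
     (C * riesz 1 (crit R d) x)%:E)%E.
Proof.
move=> d2 bc; have [C C0 HC] := potential_supercrit d2 bc.
by exists C => // x; apply: esum_le_seq => Y uY _; exact: HC.
Qed.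

Lemma esum_potential_subcrit (R : realType) (d : nat) (b : R) : (2 < d)%N ->
  0 < b -> b < crit R d ->
  exists2 C : R, 0 < C & forall x : 'rV[int]_d,
   (\esum_(y in setT) (green R x y * riesz 1 (b + 1) y)%:E <=
     (C * riesz 1 b x)%:E)%E.
Proof.
move=> d2 b0 bc; have [C C0 HC] := potential_subcrit d2 b0 bc.
by exists C => // x; apply: esum_le_seq => Y uY _; exact: HC.
Qed.

Lemma esumZl (R : realType) (T : choiceType) (A : set T) (c : R) (f : T -> R) :
  0 <= c -> (forall t, 0 <= f t) ->
  (\esum_(t in A) (c * f t)%:E <= c%:E * \esum_(t in A) (f t)%:E)%E.
Proof.
move=> c0 f0; apply: ge_ereal_sup => _ [X [finX XA] <-].
rewrite fsbig_finite//=; under eq_bigr do rewrite EFinM.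
rewrite -ge0_sume_distrr; last by move=> *; rewrite lee_fin.
apply: lee_wpmul2l => //; apply: ereal_sup_ubound; exists X => //.
by rewrite fsbig_finite.
Qed.

(** The exponent splits as [(al - 5 / 4) + (al + 1 / 4 + 1)]. The first part is small off the box;
    the second is summed by the supercritical bound, which returns [riesz 1 al z], a quantity
    bounded by a multiple of [green R x z]. *)
Lemma green_tail (R : realType) (d : nat) (x : 'rV[int]_d) : (6 < d)%N ->
  exists2 C : R, 0 < C & forall (n : nat) (z : 'rV[int]_d),
   (\esum_(w in ~` [set` box_seq d n]) (riesz 1 (2 * crit R d) w * green R w z)%:E <=
     (C * (n%:R + 1) `^ (- (crit R d - 5 / 4)) * green R x z)%:E)%E.
Proof.
move=> d6; have d4 : (4 < d)%N by exact: ltn_trans d6.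
have d2 : (2 < d)%N by exact: ltn_trans d4.
have tr := @transientP R d d2.
have dR : 7 <= d%:R :> R by rewrite ler_nat.
set al := crit R d; have al1 : 5 / 2 <= al by rewrite /al /crit; lra.
have be : crit R d < al + 1 / 4 by rewrite -/al; lra.
have [C C0 HC] := esum_potential_supercrit d2 be.
have [c c0 Hc] := green_lower R d4.
have [k k0 Hk] := harnack 0 x tr.
exists (C / c * k); first by rewrite mulr_gt0// divr_gt0.
move=> n z; set q := (n%:R + 1) `^ _; have q0 : 0 <= q by exact: powR_ge0.
pose f w := green R z w * riesz 1 (al + 1 / 4 + 1) w.
have f0 w : 0 <= f w by rewrite mulr_ge0 ?green_ge0// ltW// riesz_gt0.
apply: (@le_trans _ _ (\esum_(w in ~` [set` box_seq d n]) (q * f w)%:E)%E).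
  apply: le_esum => w /negP wn; rewrite lee_fin /f (green_sym R z w).
  rewrite [leRHS](_ : _ = q * riesz 1 (al + 1 / 4 + 1) w * green R w z); last by ring.
  rewrite ler_wpM2r ?green_ge0//.
  rewrite (_ : 2 * al = (al - 5 / 4) + (al + 1 / 4 + 1)); last by lra.
  rewrite -rieszM// ler_wpM2r//; first by rewrite ltW// riesz_gt0.
  by apply: riesz_far => //; lra.
apply: le_trans (esumZl _ q0 f0) _.
apply: (@le_trans _ _ (q%:E * \esum_(w in setT) (f w)%:E)%E).
  by apply: lee_wpmul2l => //; apply: le_esum_subset.
apply: (@le_trans _ _ (q%:E * (C * riesz 1 al z)%:E)%E).
  by apply: lee_wpmul2l => //; exact: HC.
rewrite -EFinM lee_fin mulrC [leRHS]mulrAC ler_wpM2r// -!mulrA ler_pM2l//.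
rewrite ler_pdivlMl//; apply: le_trans (Hk z).
by rewrite green_sym -[X in riesz _ _ X]subr0; exact: Hc.
Qed.

Lemma esum_green_split (R : realType) (d : nat) (K : 'rV[int]_d -> R) (C : R)
    (x : 'rV[int]_d) : (6 < d)%N -> 0 < C ->
  (forall w, 0 <= K w <= C * riesz 1 (2 * crit R d) w) ->
  exists2 C' : R, 0 < C' & forall (n : nat) (z : 'rV[int]_d), exists t : R,
    (\esum_(w in setT) (K w * green R w z)%:E)%E =
      (\sum_(w <- box_seq d n) K w * green R w z + t)%:E /\
    0 <= t <= C' * (n%:R + 1) `^ (- (crit R d - 5 / 4)) * green R x z.
Proof.
move=> d6 C0 HK; have d4 : (4 < d)%N by exact: ltn_trans d6.
have d2 : (2 < d)%N by exact: ltn_trans d4.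
have tr := @transientP R d d2.
have [C1 C10 H1] := @green_tail R d x d6.
exists (C * C1); first by rewrite mulr_gt0.
move=> n z; have f0 w : 0 <= K w * green R w z.
  by rewrite mulr_ge0 ?green_ge0//; have /andP[] := HK w.
pose T := (\esum_(w in ~` [set` box_seq d n]) (K w * green R w z)%:E)%E.
have T0 : (0 <= T)%E by apply: esum_ge0 => w _; rewrite lee_fin.
have TC : (T <= (C * C1 * (n%:R + 1) `^ (- (crit R d - 5 / 4)) * green R x z)%:E)%E.
  rewrite -!mulrA EFinM !mulrA.
  apply: (@le_trans _ _ (C%:E * \esum_(w in ~` [set` box_seq d n]) (riesz 1 (2 * crit R d) w * green R w z)%:E)%E); last first.
    by apply: lee_wpmul2l; [rewrite lee_fin ltW|exact: H1].
  apply: (@le_trans _ _ (\esum_(w in ~` [set` box_seq d n]) (C * (riesz 1 (2 * crit R d) w * green R w z))%:E)%E).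
    apply: le_esum => w _; rewrite lee_fin mulrA ler_wpM2r ?green_ge0//.
    by have /andP[] := HK w.
  apply: esumZl; first exact: ltW.
  by move=> w; rewrite mulr_ge0 ?green_ge0// ltW// riesz_gt0.
have Tf : T \is a fin_num.
  by rewrite ge0_fin_numE//; apply: le_lt_trans TC _; rewrite ltry.
exists (fine T); split; last first.
  by rewrite -!lee_fin fineK// T0 TC.
rewrite EFinD fineK// (esumID [set` box_seq d n]); last by move=> w _; rewrite lee_fin.
rewrite !setTI; congr (_ + _)%E.
by rewrite esum_seq ?undup_uniq// sumEFin.
Qed.

(** Box by box the ratio tends to the sum of [K] over the box, and the tail is uniform in z. The
    last clause, from a box that contains [w0], is what makes [G_IIC] positive. *)
Lemma esum_green_ratio (R : realType) (d : nat) (K : 'rV[int]_d -> R) (C : R)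
    (x : 'rV[int]_d) : (6 < d)%N -> 0 < C ->
  (forall w, 0 <= K w <= C * riesz 1 (2 * crit R d) w) ->
  [/\ forall z, (\esum_(w in setT) (K w * green R w z)%:E < +oo)%E,
      cvg (fine (\esum_(w in setT) (K w * green R w z)%:E)%E / green R x z
        @[z --> @near_infinity R d]) &
      forall w0, 0 < K w0 -> exists2 c : R, 0 < c &
        \forall z \near @near_infinity R d,
         c <= fine (\esum_(w in setT) (K w * green R w z)%:E)%E / green R x z].
Proof.
move=> d6 C0 HK; have d4 : (4 < d)%N by exact: ltn_trans d6.
have d2 : (2 < d)%N by exact: ltn_trans d4.
have d0 : (0 < d)%N by exact: ltn_trans d2.
have tr := @transientP R d d2.
have dR : 7 <= d%:R :> R by rewrite ler_nat.
have [C' C'0 H] := esum_green_split x d6 C0 HK.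
have gx z : 0 < green R x z by exact: green_gt0.
have HP n : (\sum_(w <- box_seq d n) K w * green R w z) / green R x z
    @[z --> @near_infinity R d] --> \sum_(w <- box_seq d n) K w.
  under eq_fun do rewrite mulr_suml; apply: cvg_bigsum => w.
  under eq_fun do rewrite -mulrA; 
  have h := cvgM (cvg_cst (K w)) (@green_ratio_cvg R d x w d4).
  by rewrite mulr1 in h; exact: h.
split.
- by move=> z; have [t [-> _]] := H 0%N z; rewrite ltry.
- have PF := near_infinity_proper R d0.
  apply: cvg_of_approx => eps e0.
  have [n Hn] := @powRN_small R (crit R d - 5 / 4) (eps / C') ltac:(rewrite /crit; lra) (divr_gt0 e0 C'0).
  exists (fun z => (\sum_(w <- box_seq d n) K w * green R w z) / green R x z).
  exists (\sum_(w <- box_seq d n) K w); split => //.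
  apply: nearW => z; have [t [-> /andP[t0 tC]]] := H n z.
  rewrite /= -mulrBl addrAC subrr add0r ger0_norm ?divr_ge0 ?(ltW (gx _))//.
  rewrite ler_pdivrMr//; apply: le_trans tC _.
  rewrite ler_wpM2r ?(ltW (gx _))//; move: Hn.
  by rewrite ler_pdivlMr// mulrC.
- move=> w0 K0; pose n := (Num.truncn (sqnorm R w0)).+1.
  have w0n : w0 \in box_seq d n.
    by apply: (@mem_box_seq R); apply/ltW; exact: truncnS_gt.
  have S0 : K w0 <= \sum_(w <- box_seq d n) K w.
    rewrite (bigD1_seq w0) ?undup_uniq//= lerDl sumr_ge0// => w _.
    by have /andP[] := HK w.
  exists (K w0 / 2); first by rewrite divr_gt0.
  have /cvgrPdist_lt/(_ (K w0 / 2)) := HP n; rewrite divr_gt0// => /(_ isT).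
  apply: filterS => z; have [t [-> /andP[t0 _]]] := H n z.
  rewrite /= ltr_distl => /andP[_ h].
  have : 0 <= t / green R x z by rewrite divr_ge0// ltW.
  rewrite mulrDl; lra.
Qed.

(** * Cubic trees *)

(** The form in which a tree is used: [rk] gives an order for stripping vertices, and the last
    clause, where acyclicity is hidden, lets the edges be indexed by the vertices other than [r]. *)
Definition rooted_at (V : finType) (e : rel V) (r : V) (par : V -> V)
    (rk : V -> nat) : Prop :=
  [/\ par r = r, forall u, u != r -> e u (par u) /\ (rk (par u) < rk u)%N &
      forall a b, e a b -> (a != r) && (b == par a) || (b != r) && (a == par b)].

(** [rk] is the distance from [r]. An edge that joins no vertex to its parent could be deleted
    without disconnecting the graph, since the parent edges survive; a simple path between its ends
    in the rest would close up to a cycle of length at least 3. *)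
Lemma tree_rooted (V : finType) (e : rel V) (r : V) :
  symmetric e -> irreflexive e -> (forall u v, connect e u v) ->
  (forall p : seq V, ucycle e p -> (size p <= 2)%N) ->
  exists par rk, rooted_at e r par rk.
Proof.
move=> esym eirr econ eacy.
pose P u n := [exists p : n.-tuple V, path e r p && (last r p == u)].
have exP u : exists n, P u n.
  have /connectP[p ep ->] := econ r u; exists (size p).
  by apply/existsP; exists (in_tuple p); rewrite /= ep eqxx.
pose rk u := ex_minn (exP u).
have ex_par u : u != r -> exists v, e u v && (rk v < rk u)%N.
  move=> ur; have : P u (rk u) by rewrite /rk; case: ex_minnP.
  case/existsP => -[p /= /eqP sp] /andP[+ /eqP lp].
  case/lastP: p sp lp => [|p w]; first by move=> _ /= ru; rewrite ru eqxx in ur.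
  rewrite size_rcons last_rcons rcons_path => sp wu /andP[ep ew]; subst w.
  exists (last r p); rewrite esym ew /= -sp ltnS /rk; case: ex_minnP => n _; apply.
  by apply/existsP; exists (in_tuple p); rewrite /= ep eqxx.
pose par u := if u == r then r else odflt u [pick v | e u v && (rk v < rk u)%N].
have parP u : u != r -> e u (par u) /\ (rk (par u) < rk u)%N.
  move=> ur; rewrite /par (negPf ur); case: pickP => [v /andP[]//|].
  by have [v hv] := ex_par u ur => /(_ v); rewrite hv.
exists par, rk; split => //; first by rewrite /par eqxx.
move=> a b eab; apply/negPn/negP; rewrite negb_or !negb_and !negbK => /andP[na nb].
pose e' := [rel x y | e x y && ~~ ((x == a) && (y == b) || (x == b) && (y == a))].
have e'sym : symmetric e'.
  move=> x y /=; rewrite esym; congr (_ && ~~ _).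
  by rewrite orbC [(y == a) && _]andbC [(y == b) && _]andbC.
have con u : connect e' r u.
  elim: {u}(rk u).+1 {-2}u (ltnSn (rk u)) => // n IH u un.
  have [->|ur] := eqVneq u r; first exact: connect0.
  have [eu ru] := parP u ur.
  apply: connect_trans (IH (par u) (leq_trans ru un)) _.
  apply: connect1; rewrite /= esym eu /=; apply/negP => /orP[]/andP[/eqP h1 /eqP h2].
    by move: nb; rewrite -h1 -h2 eqxx orbF (negPf ur).
  by move: na; rewrite -h1 -h2 eqxx orbF (negPf ur).
have : connect e' a b.
  by apply: connect_trans (con b); rewrite (sym_connect_sym e'sym).
case/connectP => p ep bE; case/shortenP: ep bE => q eq uq _ bE.
have path_e : path e a q by apply: sub_path eq => x y /andP[].
have /eacy : ucycle e (a :: q).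
  by rewrite /ucycle uq andbT /= rcons_path path_e /= -bE esym.
case: q eq uq bE path_e => [|y [|//]] /=.
  by move=> _ _ ba; rewrite -ba eirr in eab.
by rewrite andbT => /andP[_] + _ yb; rewrite -yb !eqxx.
Qed.

(** [h] maps a vertex to its parent edge in the orientation chosen by [enum_rank], and [h'] recovers
    the child. *)
Lemma prod_edges (V : finType) (R : comPzSemiRingType) (e : rel V) (r : V)
    (par : V -> V) (rk : V -> nat) (F : V -> V -> R) :
  symmetric e -> irreflexive e -> rooted_at e r par rk ->
  (forall a b, F a b = F b a) ->
  \prod_(ab : V * V | e ab.1 ab.2 && (enum_rank ab.1 < enum_rank ab.2)%N)
    F ab.1 ab.2 = \prod_(u | u != r) F u (par u).
Proof.
move=> esym eirr [parr parP edgeP] Fsym.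
pose h u := if (enum_rank u < enum_rank (par u))%N then (u, par u) else (par u, u).
pose h' (ab : V * V) := if (ab.1 != r) && (ab.2 == par ab.1) then ab.1 else ab.2.
rewrite (reindex_onto h h') /=; last first.
  move=> [a b] /= /andP[eab ab]; rewrite /h'/=.
  have := edgeP _ _ eab; case: ifP => [/andP[_ /eqP bE] _|_ /= /andP[_ /eqP aE]].
    by rewrite /h -bE ab.
  by rewrite /h -aE ltnNge (ltnW ab).
apply: eq_big => [u|u _]; last by rewrite /h; case: ifP => _ //=; rewrite Fsym.
have [->|ur] /= := eqVneq u r.
  by rewrite /h parr ltnn /= eirr.
have [eu ru] := parP u ur.
have neu : u != par u by apply: contraTneq eu => <-; rewrite eirr.
have nr : enum_rank u != enum_rank (par u) :> nat.
  by apply: contraNneq neu => /val_inj/enum_rank_inj/eqP.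
rewrite /h; case: ltnP => [lt|ge]; rewrite /h' /= ?eu ?lt ?ur ?eqxx//=.
rewrite esym eu ltn_neqAle eq_sym nr ge /=.
case: ifP => //; rewrite ?eqxx// => /andP[pr /eqP upp].
by have [_] := parP _ pr; rewrite -upp => /(ltn_trans ru); rewrite ltnn.
Qed.

(** * Sums over embeddings *)

Definition upd (V : finType) (T : Type) (Phi : {ffun V -> T}) (u : V) (y : T) :
    {ffun V -> T} :=
  [ffun a => if a == u then y else Phi a].

Definition pinned (V : finType) (T : Type) (Fr : {set V}) (pin : V -> T) :
    set {ffun V -> T} :=
  [set Phi | forall a, a \notin Fr -> Phi a = pin a].

(** Makes the position of [u] the innermost summation variable, as is needed to strip [u];
    [esum_pinned_outer] makes it the outermost one. *)
Lemma esum_pinned_setU1 (R : realType) (V : finType) (T : choiceType)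
    (Fr : {set V}) (pin : V -> T) (u : V) (F : {ffun V -> T} -> \bar R) :
  u \notin Fr -> (forall Phi, (0 <= F Phi)%E) ->
  (\esum_(Phi in pinned (u |: Fr)%SET pin) F Phi =
   \esum_(Phi in pinned Fr pin) \esum_(y in setT) F (upd Phi u y))%E.
Proof.
move=> uFr F0; rewrite esum_esum//.
apply: (@reindex_esum R _ _ _ _ (fun k => upd k.1 u k.2)); split.
- move=> [Phi y] /= [PA _] a; rewrite in_setU1 negb_or => /andP[au aFr].
  by rewrite ffunE (negPf au) PA.
- move=> [Phi y] [Psi y'] /[!inE] /= -[PA _] [PB _] /ffunP E.
  have := E u; rewrite !ffunE eqxx => <-; congr pair; apply/ffunP => a.
  have [->|au] := eqVneq a u; first by rewrite PA// PB.
  by have := E a; rewrite !ffunE (negPf au).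
- move=> Psi PA; exists (upd Psi u (pin u), Psi u).
    split => // a aFr; rewrite ffunE; case: eqP => [->//|/eqP au].
    by apply: PA; rewrite in_setU1 negb_or au.
  by apply/ffunP => a /=; rewrite !ffunE; case: eqP => [->|].
Qed.

Lemma esum_pinned0 (R : realType) (V : finType) (T : choiceType)
    (pin : V -> T) (F : {ffun V -> T} -> \bar R) :
  (0 <= F [ffun a => pin a])%E ->
  (\esum_(Phi in pinned finset.set0 pin) F Phi = F [ffun a => pin a])%E.
Proof.
move=> F0; rewrite (_ : pinned _ _ = [set [ffun a => pin a]]) ?esum_set1//.
apply/seteqP; split => [Phi H|_ -> a _] /=; last by rewrite ffunE.
by apply/ffunP => a; rewrite ffunE H ?inE.
Qed.

Section elimination.
Context {R : realType} {d : nat} {V : finType} (r v : V) (par : V -> V).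
Variables (rk : V -> nat) (I : {set V}).

(** [v] is the top of the tree that remains. Its own parent edge, which will lead to the leaf z,
    enters neither [children] nor [weight]. *)
Definition children (U : {set V}) (u : V) : nat :=
  #|[set u' in U | (u' != v) && (par u' == u)]|.

Definition weight (U : {set V}) (c : V -> nat) (Phi : {ffun V -> 'rV[int]_d}) : R :=
  (\prod_(u in U | u != v) green R (Phi u) (Phi (par u))) *
  \prod_(u in U) riesz 1 (crit R d) (Phi u) ^+ c u.

(* The vertices of [U] of maximal rank are removed one at a time; the factor
   [riesz] to the power [c u] records the subtrees already removed at [u]. *)
Lemma elimination (d6 : (6 < d)%N) (pin : V -> 'rV[int]_d) (U : {set V})
    (c : V -> nat) :
  v \in I -> v \in U ->
  (forall u, u \in U -> u != v -> par u \in U /\ (rk (par u) < rk u)%N) ->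
  (forall u, u \in U -> u \in I -> (children U u + c u = 2)%N) ->
  exists2 C : R, 0 < C & forall w,
    (\esum_(Phi in pinned ((U :&: I) :\ v)%SET (fun a => if a == v then w else pin a))
      (weight U c Phi)%:E <= (C * riesz 1 (2 * crit R d) w)%:E)%E.
Proof.
move=> vI; have d4 : (4 < d)%N by exact: ltn_trans d6.
have d2 : (2 < d)%N by exact: ltn_trans d4.
have tr := @transientP R d d2.
have dR : 7 <= d%:R :> R by rewrite ler_nat.
set al := crit R d; have al1 : 5 / 2 <= al by rewrite /al /crit; lra.
have al0 : 0 <= al by lra.
have rz0 (x : 'rV[int]_d) b : 0 <= riesz 1 b x by rewrite ltW// riesz_gt0.
have w0 U' c' Phi : 0 <= weight U' c' Phi.
  by apply: mulr_ge0; apply: prodr_ge0 => u _; [exact: green_ge0|exact/exprn_ge0/rz0].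
elim: {U}#|U| {-2}U c (erefl #|U|) => [|n IH] U c cU vU parU cc.
  by move/eqP: cU; rewrite cards_eq0 => /eqP U0; rewrite U0 inE in vU.
(* When only [v] is left, both of its subtrees have been removed, and two factors [riesz 1 al] give
   the exponent [2 * al]. *)
have [U1|[u0]] := set_0Vmem (U :\ v)%SET.
  have UE : U = [set v]%SET by rewrite -(finset.setD1K vU) U1 finset.setU0.
  have cv : c v = 2%N.
    have := cc v vU vI; rewrite /children UE (_ : [set _ in _ | _]%SET = finset.set0) ?cards0//.
    by apply/setP => u'; rewrite !inE; case: eqP.
  exists 1 => // w; rewrite (_ : ((U :&: I) :\ v)%SET = finset.set0); last first.
    by apply/setP => u'; rewrite UE !inE; case: eqP.
  rewrite esum_pinned0 ?lee_fin// mul1r /weight UE big1 => [|u']; last first.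
    by rewrite inE => /andP[->].
  by rewrite big_set1 mul1r cv ffunE eqxx expr2 rieszM// (_ : al + al = 2 * al)//; ring.
rewrite in_setD1 => u0P.
case: (@arg_maxnP V u0 (fun u => (u != v) && (u \in U)) rk u0P) => u /andP[uv uU] umax {u0 u0P}.
have [puU ru] := parU u uU uv.
have nochild u' : u' \in U -> u' != v -> par u' != u.
  move=> u'U u'v; apply/eqP => pu; have [_] := parU u' u'U u'v; rewrite pu.
  by move=> lt; have := umax u'; rewrite u'v u'U => /(_ isT); rewrite /= leqNgt lt.
have pu : par u != u by exact: nochild.
pose U' := (U :\ u)%SET; pose c' a := (c a + (a == par u))%N.
have cU' : #|U'| = n by move: cU; rewrite (cardsD1 u) uU => -[].
have vU' : v \in U' by rewrite !inE eq_sym uv.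
have parU' a : a \in U' -> a != v -> par a \in U' /\ (rk (par a) < rk a)%N.
  rewrite in_setD1 => /andP[au aU] av; have [paU ra] := parU a aU av.
  by rewrite in_setD1 paU nochild.
have cc' a : a \in U' -> a \in I -> (children U' a + c' a = 2)%N.
  rewrite in_setD1 => /andP[au aU] aI; rewrite -(cc a aU aI) /children /c'.
  rewrite (cardsD1 u [set u' in U | _]%SET) !inE uU uv /= [a == _]eq_sym.
  have -> : #|[set u' in U' | (u' != v) && (par u' == a)]%SET| =
      #|([set u' in U | (u' != v) && (par u' == a)] :\ u)%SET|.
    by apply: eq_card => u'; rewrite !inE -andbA.
  by move: (nat_of_bool _) #|_| (c a); lia.
have [C C0 HC] := IH U' c' cU' vU' parU' cc'.
have wE Phi : weight U c Phi = green R (Phi u) (Phi (par u)) * riesz 1 al (Phi u) ^+ c u *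
    ((\prod_(u' in U' | u' != v) green R (Phi u') (Phi (par u'))) *
     \prod_(u' in U') riesz 1 al (Phi u') ^+ c u').
  rewrite /weight (bigD1 u) ?uU//= [X in _ * X](bigD1 u)//= mulrACA; congr (_ * (_ * _)).
    by apply: eq_bigl => u'; rewrite !inE; case: (u' != u); rewrite /= ?andbT ?andbF.
  by apply: eq_bigl => u'; rewrite !inE andbC.
have wE' Phi : weight U' c' Phi = riesz 1 al (Phi (par u)) *
    ((\prod_(u' in U' | u' != v) green R (Phi u') (Phi (par u'))) *
     \prod_(u' in U') riesz 1 al (Phi u') ^+ c u').
  rewrite /weight mulrCA; congr (_ * _).
  under eq_bigr do rewrite /c' exprD; rewrite big_split /= mulrC; congr (_ * _).
  rewrite (bigD1 (par u))/=; last by rewrite in_setD1 pu.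
  by rewrite eqxx expr1 big1 ?mulr1// => a /andP[_ /negPf->].
(* A summed vertex without remaining children carries two factors [riesz 1 al]; summing over its
   position by the supercritical bound leaves one such factor at its parent. *)
have [uI|uI] := boolP (u \in I).
- have cu : c u = 2%N.
    have := cc u uU uI; rewrite /children (_ : [set _ in _ | _]%SET = finset.set0) ?cards0//.
    apply/setP => u'; rewrite !inE; apply/negP => /andP[u'U /andP[u'v /eqP pu']].
    by have := nochild u' u'U u'v; rewrite pu' eqxx.
  have be : crit R d < al + 1 / 4 by rewrite -/al; lra.
  have [C1 C10 HC1] := esum_potential_supercrit d2 be.
  exists (C1 * C); first by rewrite mulr_gt0.
  move=> w; set pn := (fun a => _).
  have uF : u \notin ((U' :&: I) :\ v)%SET by rewrite !inE eqxx /= andbF.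
  rewrite (_ : ((U :&: I) :\ v)%SET = (u |: (U' :&: I) :\ v)%SET); last first.
    apply/setP => a; rewrite !inE; case: (eqVneq a u) => //= ->.
    by rewrite uv uU uI.
  rewrite esum_pinned_setU1//; last by move=> Phi; rewrite lee_fin.
  apply: (@le_trans _ _ (\esum_(Phi in pinned ((U' :&: I) :\ v)%SET pn) (C1 * weight U' c' Phi)%:E)%E).
    apply: le_esum => Phi _.
    rewrite wE'; set Q := _ * \prod_(u' in U') _.
    have Q0 : 0 <= Q by apply: mulr_ge0; apply: prodr_ge0 => a _; [exact: green_ge0|exact/exprn_ge0/rz0].
    pose f y := green R (Phi (par u)) y * riesz 1 (al + 1 / 4 + 1) y.
    have f0 y : 0 <= f y by rewrite mulr_ge0 ?green_ge0 ?rz0.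
    apply: (@le_trans _ _ (\esum_(y in setT) (Q * f y)%:E)%E).
      apply: le_esum => y _; rewrite lee_fin wE mulrC.
      have updu : upd Phi u y u = y by rewrite ffunE eqxx.
      have updn a : a != u -> upd Phi u y a = Phi a by move=> au; rewrite ffunE (negPf au).
      rewrite (eq_bigr (fun u' => green R (Phi u') (Phi (par u')))); last first.
        move=> a /andP[]; rewrite in_setD1 => /andP[au aU] av.
        by rewrite !updn// nochild.
      rewrite [X in _ * X * _](eq_bigr (fun u' => riesz 1 al (Phi u') ^+ c u')); last first.
        by move=> a; rewrite in_setD1 => /andP[au aU]; rewrite updn.
      rewrite -/Q ler_wpM2l// updu updn// cu /f green_sym ler_wpM2l ?green_ge0//.
      by rewrite expr2 rieszM// riesz_exp_le//; lra.
    apply: le_trans (esumZl _ Q0 f0) _.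
    apply: (@le_trans _ _ (Q%:E * (C1 * riesz 1 al (Phi (par u)))%:E)%E).
      by apply: lee_wpmul2l => //; exact: HC1.
    by rewrite -EFinM lee_fin mulrCA [Q * _]mulrC.
  apply: le_trans (esumZl _ (ltW C10) (w0 U' c')) _.
  by rewrite -mulrA EFinM; apply: lee_wpmul2l; [rewrite lee_fin ltW|exact: HC].
(* A pinned leaf: its edge is at most a constant, depending on its position, times [riesz 1 al] at
   the parent; its own factors are at most 1. *)
- have [C1 C10 HC1] := green_upper R d2.
  pose C2 := C1 * (2 * (sqnorm R (pin u) + 1)) `^ al.
  have C20 : 0 < C2.
    by rewrite mulr_gt0// powR_gt0// mulr_gt0//; have := sqnorm_ge0 R (pin u); lra.
  exists (C2 * C); first by rewrite mulr_gt0.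
  move=> w; set pn := (fun a => _).
  rewrite (_ : ((U :&: I) :\ v)%SET = ((U' :&: I) :\ v)%SET); last first.
    apply/setP => a; rewrite !inE; case: (eqVneq a u) => //= ->.
    by rewrite (negPf uI) !andbF.
  apply: (@le_trans _ _ (\esum_(Phi in pinned ((U' :&: I) :\ v)%SET pn) (C2 * weight U' c' Phi)%:E)%E).
    apply: le_esum => Phi PA; rewrite lee_fin wE wE'.
    set Q := _ * \prod_(u' in U') _; rewrite [leRHS]mulrA.
    have Q0 : 0 <= Q by apply: mulr_ge0; apply: prodr_ge0 => a _; [exact: green_ge0|exact/exprn_ge0/rz0].
    rewrite ler_wpM2r//.
    have Pu : Phi u = pin u by rewrite PA ?inE ?eqxx ?andbF// /pn (negPf uv).
    apply: (@le_trans _ _ (green R (Phi u) (Phi (par u)) * 1)).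
      by rewrite ler_wpM2l ?green_ge0// exprn_ile1 ?rz0 ?riesz_le_one.
    rewrite mulr1 green_sym; apply: le_trans (HC1 _ _) _.
    rewrite /C2 -mulrA ler_pM2l// Pu -/al.
    by apply: le_trans (riesz_shift _ _ al0) _; rewrite sqnormN.
  apply: le_trans (esumZl _ (ltW C20) (w0 U' c')) _.
  by rewrite -(mulrA C2) [leRHS]EFinM; apply: lee_wpmul2l; [rewrite lee_fin ltW|exact: HC].
Qed.

End elimination.

Lemma mem_transversal_equivalence (T : finType) (e : rel T) (D : {set T}) (x : T) :
  x \in transversal (equivalence_partition e D) D -> x \in D.
Proof.
case/imsetP => y yD ->; set B := finset.pblock _ _.
have BD z : z \in B -> z \in D.
  rewrite /B /finset.pblock; case: pickP => [B' /andP[/imsetP[y' _ ->] _]|_] /=.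
    by rewrite !inE => /andP[].
  by rewrite inE.
by case: pickP => [z|] //=; exact: BD.
Qed.

Lemma Tr_cubic (k : nat) (E : graph k) : E \in Tr k -> E \in cubic_trees k.
Proof. exact: mem_transversal_equivalence. Qed.

Lemma eq_of_card1 (T : finType) (A : pred T) (a b : T) :
  #|A| = 1%N -> A a -> A b -> a = b.
Proof.
move=> A1 Aa Ab; apply/eqP/negPn/negP => ab.
have := subset_leq_card (_ : [set a; b]%SET \subset A); rewrite cards2 ab A1 => /(_ _).
suff s : [set a; b]%SET \subset A by move=> /(_ s).
by apply/fintype.subsetP => x; rewrite !inE => /orP[]/eqP->.
Qed.

Lemma esumZ (R : realType) (T : choiceType) (A : set T) (c : R) (f : T -> R) :
  0 < c -> (forall t, 0 <= f t) ->
  (\esum_(t in A) (c * f t)%:E = c%:E * \esum_(t in A) (f t)%:E)%E.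
Proof.
move=> c0 f0; apply/eqP; rewrite eq_le esumZl ?(ltW c0)//=.
have ci0 : 0 <= c^-1 by rewrite invr_ge0 ltW.
have cf0 t : 0 <= c * f t by rewrite mulr_ge0// ltW.
have h := @esumZl R T A c^-1 (fun t => c * f t) ci0 cf0.
apply: le_trans (lee_wpmul2l _ (le_trans _ h)) _; first by rewrite lee_fin ltW.
  by apply: le_esum => t _; rewrite mulKf// gt_eqF.
by rewrite muleA -EFinM divff ?gt_eqF// mul1e.
Qed.

Lemma esum_pinned_outer (R : realType) (V : finType) (T : choiceType)
    (Fr : {set V}) (pin : V -> T) (u : V) (F : {ffun V -> T} -> \bar R) :
  u \notin Fr -> (forall Phi, (0 <= F Phi)%E) ->
  (\esum_(Phi in pinned (u |: Fr)%SET pin) F Phi =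
   \esum_(y in setT) \esum_(Phi in pinned Fr (fun a => if a == u then y else pin a)) F Phi)%E.
Proof.
move=> uFr F0; rewrite esum_esum//.
apply: (@reindex_esum R _ _ _ _ (fun k => k.2)); split.
- move=> [y Phi] /= [_ PA] a; rewrite in_setU1 negb_or => /andP[au aFr].
  by rewrite PA// (negPf au).
- move=> [y Phi] [y' Psi] /[!inE] /= -[_ PA] [_ PB] E; subst Psi.
  by congr pair; have := PA u uFr; rewrite PB// eqxx.
- move=> Psi PA; exists (Psi u, Psi) => //; split => // a aFr.
  by case: eqP => [->//|/eqP au]; apply: PA; rewrite in_setU1 negb_or au.
Qed.

Lemma esum_pinned_repin (R : realType) (V : finType) (T : choiceType)
    (Fr : {set V}) (pin : V -> T) (u : V) (t : T) (F : {ffun V -> T} -> \bar R) :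
  u \notin Fr -> (forall Phi, F (upd Phi u t) = F Phi) ->
  (\esum_(Phi in pinned Fr (fun a => if a == u then t else pin a)) F Phi =
   \esum_(Phi in pinned Fr pin) F Phi)%E.
Proof.
move=> uFr Fu; rewrite (@reindex_esum R _ _ (pinned Fr pin) _ (fun Phi => upd Phi u t)); last first.
  split.
  - by move=> Phi PA a aFr /=; rewrite ffunE; case: eqP => // _; exact: PA.
  - move=> Phi Psi /[!inE] PA PB /ffunP E; apply/ffunP => a.
    have := E a; rewrite !ffunE; case: eqP => [->|//].
    by rewrite PA// PB.
  - move=> Psi PA; exists (upd Psi u (pin u)) => [a aFr|].
      by rewrite ffunE; case: eqP => [->//|/eqP/negPf au]; rewrite PA// au.
    apply/ffunP => a; rewrite !ffunE; case: eqP => [->|//].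
    by rewrite PA// eqxx.
by apply: eq_esum => Phi _; rewrite Fu.
Qed.

Lemma tnth_rcons_last (T : Type) (k : nat) (x : k.-tuple T) (z z' : T) (i : 'I_k.+1) :
  tnth [tuple of rcons x z] i =
  if i == ord_max then z else tnth [tuple of rcons x z'] i.
Proof.
rewrite !(tnth_nth z) /= !nth_rcons size_tuple -val_eqE /=.
have := ltn_ord i; rewrite ltnS leq_eqVlt => /orP[/eqP ->|ik].
  by rewrite ltnn eqxx.
by rewrite ik (ltn_eqF ik); apply: set_nth_default; rewrite size_tuple.
Qed.

(** The tree is rooted at the leaf z. [K] is finite by [elimination], and positive because a single
    embedding already contributes a positive amount. *)
Lemma cubic_sum (R : realType) (d k : nat) (E : graph k.+1) (x : k.-tuple 'rV[int]_d) :
  (6 < d)%N -> (2 <= k)%N -> E \in cubic_trees k.+1 ->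
  exists (K : 'rV[int]_d -> R) (C : R), [/\ 0 < C,
    forall w, 0 < K w <= C * riesz 1 (2 * crit R d) w &
    forall z, (\esum_(Phi in [set Phi : {ffun tree_vertex k.+1 -> 'rV[int]_d} |
         forall i : 'I_k.+1, Phi (inl i) = tnth [tuple of rcons x z] i])
       (embedding_weight R E Phi)%:E)%E =
     (\esum_(w in setT) (K w * green R w z)%:E)%E].
Proof.
move=> d6 k2; rewrite inE => /asboolP[[esym eirr econ eacy] degl degi].
have d4 : (4 < d)%N by exact: ltn_trans d6.
have d2 : (2 < d)%N by exact: ltn_trans d4.
have tr := @transientP R d d2.
have gp (a b : 'rV[int]_d) : 0 < green R a b by exact: green_gt0.
pose V := tree_vertex k.+1; pose r : V := inl ord_max.
have [par [rk root]] := tree_rooted r esym eirr econ eacy.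
have [parr parP edgeP] := root.
have [v erv] : exists v, adj E r v.
  have : (0 < degree E r)%N by rewrite degl.
  by rewrite /degree => /card_gt0P[v]; rewrite inE => h; exists v.
have [vr pv] : v != r /\ par v = r.
  by have := edgeP _ _ erv; rewrite eqxx /= => /andP[? /eqP].
have chr u : u != r -> par u = r -> u = v.
  move=> ur pu; have [eu _] := parP u ur.
  by apply: (eq_of_card1 (degl ord_max)) => //=; rewrite esym -/r -[in adj E _ r]pu.
(* If [v] were a leaf, then [r] and [v] would have no neighbours but each other; a third vertex,
   which exists since [2 <= k], taken of least rank, would have nowhere to put its parent. *)
have [j0 vj] : exists j, v = inr j.
  case: v erv vr pv chr => [i|j] erv vr pv chr; last by exists j.
  exfalso.
  have [w0 w0P] : exists w : V, (w != r) && (w != inl i).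
    have : (0 < #|[set: V] :\ r :\ (inl i : V)|)%N.
      rewrite -(ltn_add2l 2); have := cardsD1 r [set: V]; rewrite inE cardsT /=.
      have := cardsD1 (inl i : V) ([set: V] :\ r); rewrite !inE vr /=.
      rewrite card_sum !card_ord => ->; move: #|_|; lia.
    case/card_gt0P => w; rewrite !inE andbT => /andP[w1 w2].
    by exists w; rewrite w1 w2.
  case: (@arg_minnP V w0 (fun w => (w != r) && (w != inl i)) rk w0P) => w /andP[wr wi] wmin.
  have [ew rw] := parP w wr.
  have pwr : par w != r by apply: contra wi => /eqP pw; apply/eqP/chr.
  have [pwi|pwi] := eqVneq (par w) (inl i).
    have : w = r; last by apply/eqP.
    apply: (eq_of_card1 (degl i)) => /=; first by rewrite esym -pwi.
    by rewrite esym.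
  by have := wmin (par w); rewrite pwr pwi => /(_ isT); rewrite leqNgt rw.
pose I : {set V} := [set a : V | if a is inr _ then true else false]%SET.
(* The value 0 stands in for z at the root, so that [K] does not depend on z; [esum_pinned_repin]
   restores z below. *)
pose pin (a : V) := if a is inl i then tnth [tuple of rcons x (0 : 'rV[int]_d)] i else 0.
have vI : v \in I by rewrite vj inE.
have rI : r \notin I by rewrite inE.
pose U : {set V} := [set~ r]%SET.
have vU : v \in U by rewrite !inE.
have parU u : u \in U -> u != v -> par u \in U /\ (rk (par u) < rk u)%N.
  rewrite !inE => ur uv; have [_ ->] := parP u ur; split => //.
  by apply: contra uv => /eqP pu; apply/eqP/chr.
(* Degree 3 means one parent and two children. *)
have cc u : u \in U -> u \in I -> (children v par U u + 0 = 2)%N.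
  rewrite !inE => ur uI; case: u uI ur => // j _ ur; rewrite addn0.
  have := degi j; rewrite /degree /children => deg3.
  have [eu ru] := parP _ ur.
  suff : #|[pred b | adj E (inr j) b]| =
      (#|[set par (inr j)]%SET| + #|[set u' in U | (u' != v) && (par u' == inr j)]%SET|)%N.
    by rewrite deg3 cards1 add1n => -[].
  rewrite -cardsUI (_ : _ :&: _ = finset.set0) ?cards0 ?addn0; last first.
    apply/setP => b; rewrite !inE; apply/negP => /andP[/eqP -> /andP[br /andP[_ /eqP pb]]].
    by have [_] := parP _ br; rewrite pb => /(ltn_trans ru); rewrite ltnn.
  apply: eq_card => b; rewrite !inE; apply/idP/idP => [eb|].
    have /orP[/andP[_ ->]//|/andP[br /eqP jb]] := edgeP _ _ eb.
    rewrite br -jb eqxx andbT orbC /=; apply/orP; left.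
    by apply: contraNneq ur => bv; rewrite jb bv pv.
  case/orP => [/eqP->//|/andP[br /andP[_ /eqP <-]]].
  by rewrite esym; have [] := parP b br.
pose W (Phi : {ffun V -> 'rV[int]_d}) : R :=
  \prod_(u | (u != r) && (u != v)) green R (Phi u) (Phi (par u)).
have W0 Phi : 0 < W Phi by apply: prodr_gt0.
have [C C0 HC] := elimination (R := R) d6 pin vI vU parU cc.
have UI : (U :&: I :\ v = I :\ v)%SET.
  by apply/setP => a; rewrite !inE; case: eqP => //= _; case: a => a; rewrite ?andbT ?andbF.
pose Kb w := (\esum_(Phi in pinned (I :\ v)%SET (fun a => if a == v then w else pin a)) (W Phi)%:E)%E.
have Kb_le w : (Kb w <= (C * riesz 1 (2 * crit R d) w)%:E)%E.
  apply: le_trans (HC w); rewrite UI; apply: le_esum => Phi _.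
  rewrite lee_fin /weight [X in _ * X]big1 => [|u _]; last by rewrite expr0.
  by rewrite mulr1 /W le_eqVlt; apply/orP; left; apply/eqP/eq_bigl => u; rewrite !inE.
have Kb_ge w : ((W [ffun a => if a == v then w else pin a])%:E <= Kb w)%E.
  pose p : {ffun V -> 'rV[int]_d} := [ffun a => if a == v then w else pin a].
  have -> : (W p)%:E = (\esum_(Phi in [set p]) (W Phi)%:E)%E.
    by rewrite esum_set1// lee_fin ltW.
  by apply: le_esum_subset => _ -> a _ /=; rewrite ffunE.
have Kf w : Kb w \is a fin_num.
  rewrite ge0_fin_numE; first by apply: le_lt_trans (Kb_le w) _; rewrite ltry.
  by apply: le_trans (Kb_ge w); rewrite lee_fin ltW.
exists (fun w => fine (Kb w)), C; split => // [w|z].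
  rewrite -lee_fin -lte_fin fineK// Kb_le andbT.
  by apply: lt_le_trans (Kb_ge w); rewrite lte_fin.
pose pz a := if a == r then z else pin a.
rewrite (_ : [set Phi | _] = pinned I pz); last first.
  apply/seteqP; split => Phi H.
    by case=> [i|j]; rewrite inE //= => _; rewrite H (tnth_rcons_last x z 0) /pz /pin.
  by move=> i; rewrite H ?inE// (tnth_rcons_last x z 0).
rewrite (_ : I = (v |: I :\ v)%SET); last by rewrite finset.setD1K.
rewrite esum_pinned_outer; first last.
- by move=> Phi; rewrite lee_fin; apply: prodr_ge0 => uv _; exact: ltW.
- by rewrite !inE eqxx.
apply: eq_esum => w _.
have -> : (fine (Kb w) * green R w z)%:E = ((green R w z)%:E * Kb w)%E.
  by rewrite EFinM fineK// muleC.
rewrite /Kb -esumZ//; last by move=> Phi; exact: ltW.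
have rIv : r \notin (I :\ v)%SET by rewrite !inE andbF.
pose F (Phi : {ffun V -> 'rV[int]_d}) := (green R w z * W Phi)%:E.
have FE (Phi : {ffun V -> 'rV[int]_d}) : F (upd Phi r z) = F Phi.
  congr (_ * _)%:E; apply: eq_bigr => u /andP[ur uv].
  rewrite !ffunE (negPf ur); case: eqP => // pu.
  by rewrite (chr u ur pu) eqxx in uv.
rewrite -(@esum_pinned_repin R V _ _ _ r z F rIv FE).
rewrite (_ : (fun a => if a == v then w else pz a) =
   (fun a => if a == r then z else if a == v then w else pin a)); last first.
  apply/funext => a; rewrite /pz; case: (eqVneq a v) => // ->.
  by rewrite (negPf vr).
apply: eq_esum => Phi PA; congr EFin.
rewrite /embedding_weight.
rewrite (eq_bigl (fun uv : V * V => adj E uv.1 uv.2 && (enum_rank uv.1 < enum_rank uv.2)%N)); last first.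
  by case.
rewrite (prod_edges esym eirr root (fun a b => green_sym R (Phi a) (Phi b))).
have Pv : Phi v = w by rewrite PA ?inE ?eqxx// (negPf vr).
have Pr : Phi r = z by rewrite PA ?rIv// eqxx.
rewrite (bigD1 v vr) pv Pv Pr; reflexivity.
Qed.

Lemma cvg_sum_in (R : realType) (T : Type) (I : finType) (A : {set I})
    (F : set_system T) (f : I -> T -> R) : Filter F ->
  (forall i, i \in A -> cvg (f i t @[t --> F])) ->
  cvg ((\sum_(i in A) f i t) @[t --> F]).
Proof.
move=> FF H; under eq_fun do rewrite big_mkcond /=.
suff h i : exists l, (if i \in A then f i t else 0) @[t --> F] --> (l : R).
  pose l i := xget 0 [set l : R | (if i \in A then f i t else 0) @[t --> F] --> l].
  apply/cvg_ex; exists (\sum_i l i); apply: cvg_bigsum => i.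
  by have := h i => /cid; rewrite /l => -[l' hl']; case: xgetP => // /(_ l').
case iA: (i \in A); first by have /cvg_ex := H i iA.
by exists 0; exact: cvg_cst.
Qed.

Lemma green_ratio_limit (R : realType) (d k : nat) (x : k.-tuple 'rV[int]_d) :
  (6 < d)%N -> (2 <= k)%N ->
  cvg (green_ratio R x z @[z --> @near_infinity R d]) /\
  (Tr k.+1 != finset.set0 -> exists2 c : R, 0 < c &
    \forall z \near @near_infinity R d, c <= green_ratio R x z).
Proof.
move=> d6 k2; have d2 : (2 < d)%N by exact: ltn_trans d6.
have tr := @transientP R d d2.
pose S (E : graph k.+1) z := (\esum_(Phi in [set Phi : {ffun tree_vertex k.+1 -> 'rV[int]_d} |
    forall i : 'I_k.+1, Phi (inl i) = tnth [tuple of rcons x z] i])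
    (embedding_weight R E Phi)%:E)%E.
have H E : E \in Tr k.+1 -> [/\ forall z, S E z \is a fin_num,
   forall z, 0 <= fine (S E z),
   cvg (fine (S E z) / green R (head 0 x) z @[z --> @near_infinity R d]) &
   exists2 c : R, 0 < c & \forall z \near @near_infinity R d,
     c <= fine (S E z) / green R (head 0 x) z].
  move=> /Tr_cubic /(cubic_sum R x d6 k2)[K [C [C0 HK SE]]].
  have HK' w : 0 <= K w <= C * riesz 1 (2 * crit R d) w.
    by have /andP[/ltW -> ->] := HK w.
  have [Sf Sc Sp] := esum_green_ratio (head 0 x) d6 C0 HK'.
  have S0 z : (0 <= S E z)%E.
    apply: esum_ge0 => Phi _; rewrite lee_fin /embedding_weight.
    by apply: prodr_ge0 => *; exact: green_ge0.
  split.
  - by move=> z; rewrite ge0_fin_numE// /S SE.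
  - by move=> z; exact: fine_ge0.
  - rewrite (_ : (fun z => _) = (fun z =>
      fine (\esum_(w in setT) (K w * green R w z)%:E)%E / green R (head 0 x) z)) //.
    by apply/funext => z; rewrite /S SE.
  - have [c c0 Hc] := Sp 0 ltac:(by have /andP[] := HK 0).
    by exists c => //; apply: filterS Hc => z; rewrite /S SE.
have grE z : green_ratio R x z = \sum_(E in Tr k.+1) fine (S E z) / green R (head 0 x) z.
  rewrite /green_ratio /tree_green -mulr_suml; congr (_ / _).
  rewrite (eq_bigr (fun E => (fine (S E z))%:E)); first by rewrite sumEFin.
  by move=> E /H[Sf _ _ _]; rewrite fineK.
split.
  under eq_fun do rewrite grE.
  by apply: cvg_sum_in => E /H[].
case/set0Pn => E ETr; have [_ _ _ [c c0 Hc]] := H E ETr.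
exists c => //; apply: filterS Hc => z hc; apply: le_trans hc _.
rewrite grE (bigD1 E)//= lerDl sumr_ge0// => E' /andP[/H[_ S0 _ _] _].
by rewrite divr_ge0// green_ge0.
Qed.

(** * The van den Berg--Kesten inequality *)

Section BK.
Context {R : realType} {T : eqType} (p : R).
Hypothesis p01 : 0 <= p <= 1.
Implicit Types (w : T -> bool) (A B : set (T -> bool)) (s : seq T).

Definition subconf w w' := forall e, w e -> w' e.

Definition increasing A := forall w w', subconf w w' -> A w -> A w'.

(** For increasing events this is the usual disjoint occurrence, the disjoint sets of open edges
    being written as configurations. *)
Definition disj_occ A B : set (T -> bool) :=
  [set w | exists w1 w2, [/\ subconf w1 w, subconf w2 w,
    (forall e, ~~ (w1 e && w2 e)), A w1 & B w2]].

Definition setw w (e : T) (b : bool) : T -> bool :=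
  fun f => if f == e then b else w f.

Definition slice A (e : T) (b : bool) : set (T -> bool) :=
  [set w | A (setw w e b)].

(** Product measure on the coordinates in [s], all others closed; the recursion conditions on one
    coordinate, which is the inductive step of the inequality. *)
Fixpoint Pr s A : R :=
  if s is e :: s' then (1 - p) * Pr s' (slice A e false) + p * Pr s' (slice A e true)
  else (`[< A (fun=> false) >])%:R.

Lemma Pr_ge0 s A : 0 <= Pr s A.
Proof.
have /andP[p0 p1] := p01.
elim: s A => [|e s IH] A //=; rewrite addr_ge0// mulr_ge0//; lra.
Qed.

Lemma le_Pr s A B : A `<=` B -> Pr s A <= Pr s B.
Proof.
have /andP[p0 p1] := p01.
elim: s A B => [|e s IH] A B AB /=.
  by rewrite ler_nat; case: asboolP => // /AB AB0; case: asboolP.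
by apply: lerD; apply: ler_wpM2l; rewrite ?subr_ge0//; apply: IH => w; exact: AB.
Qed.

Lemma PrUI s A B : Pr s (A `|` B) + Pr s (A `&` B) = Pr s A + Pr s B.
Proof.
elim: s A B => [|e s IH] A B /=.
  rewrite -!natrD; congr _%:R.
  have -> : `[< (A `|` B) (fun=> false) >] = `[< A (fun=> false) >] || `[< B (fun=> false) >].
    exact: asbool_or.
  have -> : `[< (A `&` B) (fun=> false) >] = `[< A (fun=> false) >] && `[< B (fun=> false) >].
    exact: asbool_and.
  by case: `[< A _ >]; case: `[< B _ >].
have h b := IH (slice A e b) (slice B e b).
transitivity ((1 - p) * (Pr s (slice A e false `|` slice B e false) +
    Pr s (slice A e false `&` slice B e false)) +
  p * (Pr s (slice A e true `|` slice B e true) +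
    Pr s (slice A e true `&` slice B e true))).
  by rewrite /slice; ring.
by rewrite !h; ring.
Qed.

Lemma subconf_trans w2 w1 w3 : subconf w1 w2 -> subconf w2 w3 -> subconf w1 w3.
Proof. by move=> h h' e /h/h'. Qed.

Lemma increasing_slice A e b : increasing A -> increasing (slice A e b).
Proof.
move=> iA w w' ww'; apply: iA => f; rewrite /setw; case: ifP => // _; exact: ww'.
Qed.

Lemma slice_le A e : increasing A -> slice A e false `<=` slice A e true.
Proof. by move=> iA w; apply: iA => f; rewrite /setw; case: ifP. Qed.

Lemma setw_id w e b : w e = b -> setw w e b = w.
Proof. by move=> <-; apply/funext => f; rewrite /setw; case: eqP => [->|]. Qed.

Lemma increasing_disj_occ A B : increasing (disj_occ A B).
Proof.
move=> w w' ww' [w1 [w2 [h1 h2 h12 a b]]]; exists w1, w2; split => //.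
  exact: subconf_trans ww'.
exact: subconf_trans ww'.
Qed.

Lemma disj_occS A A' B B' : A `<=` A' -> B `<=` B' -> disj_occ A B `<=` disj_occ A' B'.
Proof.
move=> AA BB w [w1 [w2 [h1 h2 h12 a b]]]; exists w1, w2; split => //.
  exact: AA.
exact: BB.
Qed.

Lemma disj_occC A B : disj_occ A B = disj_occ B A.
Proof.
by apply/seteqP; split => w [w1 [w2 [h1 h2 h12 a b]]]; exists w2, w1; split => // e;
  rewrite andbC.
Qed.

Lemma slice_false_disj_occ A B e :
  slice (disj_occ A B) e false `<=` disj_occ (slice A e false) (slice B e false).
Proof.
move=> w [w1 [w2 [h1 h2 h12 a b]]]; exists w1, w2.
have n1 : w1 e = false by apply/negP => /h1; rewrite /setw eqxx.
have n2 : w2 e = false by apply/negP => /h2; rewrite /setw eqxx.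
split => //.
- by move=> f /[dup] wf /h1; rewrite /setw; case: eqP => // fe; rewrite fe n1 in wf.
- by move=> f /[dup] wf /h2; rewrite /setw; case: eqP => // fe; rewrite fe n2 in wf.
- by rewrite /slice/= setw_id.
- by rewrite /slice/= setw_id.
Qed.

(** At most one of the two witnesses uses [e], so the other event occurs with [e] closed. *)
Lemma slice_true_disj_occ A B e : increasing A -> increasing B ->
  slice (disj_occ A B) e true `<=`
  disj_occ (slice A e true) (slice B e false) `|`
  disj_occ (slice A e false) (slice B e true).
Proof.
have half A' B' w w1 w2 : increasing A' ->
    subconf w1 (setw w e true) -> subconf w2 (setw w e true) ->
    (forall f, ~~ (w1 f && w2 f)) -> A' w1 -> B' w2 -> w2 e = false ->
    disj_occ (slice A' e true) (slice B' e false) w.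
  move=> iA h1 h2 h12 a b n2; exists (setw w1 e false), w2; split.
  - move=> f; rewrite {1}/setw; case: eqP => // /eqP fe /h1.
    by rewrite /setw (negPf fe).
  - by move=> f /[dup] wf /h2; rewrite /setw; case: eqP => // fe; rewrite fe n2 in wf.
  - by move=> f; rewrite /setw; case: ifP => // _; exact: h12.
  - by apply: (iA _ _ _ a) => f; rewrite /setw; case: (f == e).
  - by rewrite /slice/= setw_id.
move=> iA iB w [w1 [w2 [h1 h2 h12 a b]]].
case n2 : (w2 e); last by left; apply: (half A B w w1 w2).
right; rewrite disj_occC; apply: (half B A w w2 w1) => //.
  by move=> f; rewrite andbC.
by have := h12 e; rewrite n2 andbT => /negPf.
Qed.

(** Induction on the edges. The bounds [v <= a0 * b0] and [u <= a1 * b1] alone do not suffice; the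
    decisive one is [u + v <= a1 * b0 + a0 * b1], from inclusion-exclusion, since [D false false]
    lies in both [D true false] and [D false true]. *)
Theorem BK_finite s A B : increasing A -> increasing B ->
  Pr s (disj_occ A B) <= Pr s A * Pr s B.
Proof.
have /andP[p0 p1] := p01.
elim: s A B => [|e s IH] A B iA iB /=.
  case: asboolP => [[w1 [w2 [h1 h2 _ a b]]]|_]; last by rewrite mulr_ge0.
  by rewrite !asboolT ?mulr1//; [exact: (iB _ _ h2 b)|exact: (iA _ _ h1 a)].
set a0 := Pr s (slice A e false); set a1 := Pr s (slice A e true).
set b0 := Pr s (slice B e false); set b1 := Pr s (slice B e true).
have iS A' b : increasing A' -> increasing (slice A' e b) by exact: increasing_slice.
have la : a0 <= a1 by apply: le_Pr; exact: slice_le.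
have lb : b0 <= b1 by apply: le_Pr; exact: slice_le.
have a00 : 0 <= a0 by exact: Pr_ge0.
have b00 : 0 <= b0 by exact: Pr_ge0.
pose D i j := disj_occ (slice A e i) (slice B e j).
have D00 : Pr s (D false false) <= a0 * b0 by apply: IH; exact: iS.
have D11 : Pr s (D true true) <= a1 * b1 by apply: IH; exact: iS.
have D01 : Pr s (D false true) <= a0 * b1 by apply: IH; exact: iS.
have D10 : Pr s (D true false) <= a1 * b0 by apply: IH; exact: iS.
have v0 : Pr s (slice (disj_occ A B) e false) <= Pr s (D false false).
  exact/le_Pr/slice_false_disj_occ.
have u1 : Pr s (slice (disj_occ A B) e true) <= Pr s (D true false `|` D false true).
  exact/le_Pr/slice_true_disj_occ.
have u2 : Pr s (D true false `|` D false true) <= Pr s (D true true).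
  by apply: le_Pr => w [] ; apply: disj_occS; first [exact: subset_refl | exact: slice_le].
have u3 : Pr s (D false false) <= Pr s (D true false `&` D false true).
  by apply: le_Pr => w Dw; split; move: Dw; apply: disj_occS; first [exact: subset_refl | exact: slice_le].
have := PrUI s (D true false) (D false true).
set u := Pr s (_ `|` _) in u1 u2 *; set v := Pr s (D false false) in D00 v0 u3 *.
move=> uv.
have uv' : u + v <= a1 * b0 + a0 * b1 by lra.
have ab : 0 <= (a1 - a0) * (b1 - b0) by rewrite mulr_ge0 ?subr_ge0.
apply: (@le_trans _ _ ((1 - p) * v + p * u)).
  by apply: lerD; apply: ler_wpM2l; lra.
(* (1 - p) v + p u is a nonnegative combination of u + v with v or with u, depending on the sign of
   1 - 2p. The gap to the product of the two probabilities is then p^2 or (1 - p)^2 times the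
   quantity in [ab]. *)
have [pq|pq] := leP p (1 - p).
  apply: (@le_trans _ _ ((1 - p - p) * (a0 * b0) + p * (a1 * b0 + a0 * b1))).
    have : (1 - p - p) * v <= (1 - p - p) * (a0 * b0) by rewrite ler_wpM2l//; lra.
    have : p * (u + v) <= p * (a1 * b0 + a0 * b1) by rewrite ler_wpM2l.
    lra.
  have : 0 <= p ^+ 2 * ((a1 - a0) * (b1 - b0)) by rewrite mulr_ge0 ?sqr_ge0.
  lra.
apply: (@le_trans _ _ ((p - (1 - p)) * (a1 * b1) + (1 - p) * (a1 * b0 + a0 * b1))).
  have : (p - (1 - p)) * u <= (p - (1 - p)) * (a1 * b1) by rewrite ler_wpM2l//; lra.
  have : (1 - p) * (u + v) <= (1 - p) * (a1 * b0 + a0 * b1) by rewrite ler_wpM2l//; lra.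
  lra.
have : 0 <= (1 - p) ^+ 2 * ((a1 - a0) * (b1 - b0)) by rewrite mulr_ge0 ?sqr_ge0.
lra.
Qed.

End BK.

(** * From finitely many edges to the whole lattice *)

Definition restr (T : eqType) (s : seq T) (w : T -> bool) : T -> bool :=
  fun e => w e && (e \in s).

Definition initial_seq (T : countType) (N : nat) : seq T :=
  undup (pmap pickle_inv (iota 0 N)).

Lemma initial_seqP (T : countType) (N : nat) (e : T) :
  (choice.pickle e < N)%N -> e \in initial_seq T N.
Proof.
move=> eN; rewrite mem_undup mem_pmap; apply/mapP; exists (choice.pickle e).
  by rewrite mem_iota.
by rewrite pickleK_inv.
Qed.

Lemma initial_seqS (T : countType) (M N : nat) : (M <= N)%N ->
  {subset initial_seq T M <= initial_seq T N}.
Proof.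
move=> MN e; rewrite !mem_undup !mem_pmap => /mapP[i]; rewrite mem_iota => iM ei.
by apply/mapP; exists i => //; rewrite mem_iota; lia.
Qed.

Lemma subconf_restr (T : eqType) (s s' : seq T) (w w' : T -> bool) :
  {subset s <= s'} -> subconf w w' -> subconf (restr s w) (restr s' w').
Proof. by move=> ss ww e /andP[/ww we /ss es]; rewrite /restr we es. Qed.

(** An increasing event of this kind is an increasing union of cylinder events. Connection events
    qualify because paths are finite. *)
Definition finitary (T : countType) (A : set (T -> bool)) :=
  forall w, A w -> exists N, A (restr (initial_seq T N) w).

Lemma restr_le (T : eqType) (s : seq T) (w : T -> bool) : subconf (restr s w) w.
Proof. by move=> e /andP[]. Qed.

Lemma finitary_disj_occ (T : countType) (A B : set (T -> bool)) :
  increasing A -> increasing B -> finitary A -> finitary B ->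
  finitary (disj_occ A B).
Proof.
move=> iA iB fA fB w [w1 [w2 [h1 h2 h12 /fA[N1 a] /fB[N2 b]]]].
exists (maxn N1 N2), (restr (initial_seq T (maxn N1 N2)) w1), (restr (initial_seq T (maxn N1 N2)) w2).
split.
- exact: subconf_restr.
- exact: subconf_restr.
- by move=> e; apply: contra (h12 e) => /andP[/andP[-> _] /andP[-> _]].
- apply: (iA _ _ _ a); apply: subconf_restr => //.
  by apply: initial_seqS; exact: leq_maxl.
- apply: (iB _ _ _ b); apply: subconf_restr => //.
  by apply: initial_seqS; exact: leq_maxr.
Qed.

Lemma measurable_cylinder (d L : nat) (F : set (edge d L -> bool)) :
  cylinder F -> measurable (F : set (config d L)).
Proof. by move=> cF; apply: sub_sigma_algebra. Qed.

Lemma cylinder_restr (d L : nat) (s : seq (edge d L)) (A : set (edge d L -> bool)) :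
  cylinder [set w | A (restr s w)].
Proof.
exists [fset e in s]%fset => w w' ww' /=; congr (A _).
apply/funext => e; rewrite /restr; case: (boolP (e \in s)) => es; rewrite ?andbF//.
by rewrite (ww' e)// inE.
Qed.

Lemma cylinder_eq (d L : nat) (S : {fset edge d L}) (eta : edge d L -> bool) :
  cylinder [set w : edge d L -> bool | {in S, w =1 eta}].
Proof. by exists S => w w' ww' /= h e eS; rewrite -(ww' e eS) h. Qed.

(** [S] and [eta] are general because the induction on [s] moves edges, one by one, into the set
    where the configuration is prescribed. *)
Lemma bernoulli_Pr (R : realType) (d L : nat) (p : R)
    (mu : probability (config d L) R) (S : {fset edge d L})
    (eta : edge d L -> bool) (s : seq (edge d L)) (A : set (edge d L -> bool)) :
  bernoulli_percolation p mu -> uniq s -> (forall e, e \in s -> e \notin S) ->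
  mu ([set w : config d L | {in S, w =1 eta}] `&` [set w | A (restr s w)]) =
  (\prod_(e <- S) (if eta e then p else 1 - p) * Pr p s A)%:E.
Proof.
move=> hmu; elim: s S eta A => [|e s IH] S eta A /=.
  move=> _ _; have rE (w : edge d L -> bool) : restr [::] w = (fun=> false).
    by apply/funext => e; rewrite /restr in_nil andbF.
  case: asboolP => [A0|A0].
    rewrite mulr1 -hmu; congr (mu _); apply/seteqP; split => [w [] //|w /= h].
    by split => //; rewrite rE.
  rewrite mulr0 (_ : _ `&` _ = set0) ?measure0//.
  by apply/seteqP; split => // w [_] /=; rewrite rE.
move=> /andP[es us] sS.
have eS : e \notin S by apply: sS; rewrite mem_head.
have sS' f : f \in s -> f \notin (e |` S)%fset.
  move=> fs; rewrite in_fset1U negb_or sS ?andbT; last by rewrite in_cons fs orbT.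
  by apply: contraNneq es => <-.
pose X b := [set w : config d L | {in (e |` S)%fset, w =1 setw eta e b}] `&`
   [set w | slice A e b (restr s w)].
have mX b : measurable (X b).
  apply: measurableI; apply: measurable_cylinder; first exact: cylinder_eq.
  exact: cylinder_restr.
have rE (w : edge d L -> bool) : restr (e :: s) w = setw (restr s w) e (w e).
  apply/funext => f; rewrite /restr /setw in_cons; case: eqP => [->|_]; rewrite ?andbT//.
have -> : [set w : config d L | {in S, w =1 eta}] `&` [set w | A (restr (e :: s) w)] =
    X false `|` X true.
  apply/seteqP; split.
    move=> w [h1 h2].
    have : X (w e) w.
      split; last by rewrite /slice/= -rE.
      move=> f; rewrite in_fset1U => /orP[/eqP ->|fS]; first by rewrite /setw eqxx.
      by rewrite /setw; case: eqP => [->//|_]; exact: h1.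
    by case: (w e); [right|left].
  have XS b w : X b w -> ([set w : config d L | {in S, w =1 eta}] `&` [set w | A (restr (e :: s) w)]) w.
    move=> [h1 h2]; split.
      move=> f fS; rewrite h1 ?in_fset1U ?fS ?orbT// /setw.
      by case: eqP => // fe; rewrite fe (negPf eS) in fS.
    by rewrite /= rE (h1 e) ?fset1U1// /setw eqxx; exact: h2.
  by move=> w []; exact: XS.
have mU : mu (X false `|` X true) = (mu (X false) + mu (X true))%E.
  apply: measureU => //.
  apply/seteqP; split => // w [[h1 _] [h2 _]].
  by have := h1 e (fset1U1 _ _); rewrite (h2 e (fset1U1 _ _)) /setw eqxx.
have IHX b := IH (e |` S)%fset (setw eta e b) (slice A e b) us sS'.
rewrite mU (IHX false : mu (X false) = _) (IHX true : mu (X true) = _) -EFinD; congr EFin.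
have prodE b : \prod_(f <- (e |` S)%fset) (if setw eta e b f then p else 1 - p) =
    (if b then p else 1 - p) * \prod_(f <- S) (if eta f then p else 1 - p).
  rewrite big_fsetU1//= /setw eqxx; congr (_ * _).
  apply: eq_big_seq => f fS; case: eqP => // fe.
  by rewrite fe (negPf eS) in fS.
by rewrite !prodE; ring.
Qed.

Lemma mu_Pr (R : realType) (d L : nat) (p : R) (mu : probability (config d L) R)
    (s : seq (edge d L)) (A : set (edge d L -> bool)) :
  bernoulli_percolation p mu -> uniq s ->
  mu [set w : config d L | A (restr s w)] = (Pr p s A)%:E.
Proof.
move=> hmu us; have := @bernoulli_Pr R d L p mu fset0 (fun=> false) s A hmu us.
rewrite big_seq_fset0 mul1r => <-; last by move=> e _; rewrite in_fset0.
by congr (mu _); apply/seteqP; split => [w /= h|w []//]; split.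
Qed.

Lemma finitary_bigcup (d L : nat) (A : set (edge d L -> bool)) :
  increasing A -> finitary A ->
  (A : set (config d L)) = \bigcup_N [set w | A (restr (initial_seq _ N) w)].
Proof.
move=> iA fA; apply/seteqP; split => [w /fA[N h]|w [N _ h]]; first by exists N.
by apply: iA h; exact: restr_le.
Qed.

Lemma mu_finitary_le (R : realType) (d L : nat) (mu : probability (config d L) R)
    (A : set (edge d L -> bool)) (b : \bar R) :
  increasing A -> finitary A ->
  (forall N, mu [set w : config d L | A (restr (initial_seq _ N) w)] <= b)%E ->
  (mu (A : set (config d L)) <= b)%E.
Proof.
move=> iA fA H; rewrite (finitary_bigcup iA fA).
pose F N := [set w : config d L | A (restr (initial_seq _ N) w)].
have mF N : measurable (F N) by apply: measurable_cylinder; exact: cylinder_restr.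
have ndF : {homo F : n m / (n <= m)%N >-> (n <= m)%O}.
  move=> n m nm; apply/subsetPset => w; apply: iA; apply: subconf_restr => //.
  exact: initial_seqS.
have mU : measurable (\bigcup_N F N) by apply: bigcup_measurable => N _.
have cv : (mu \o F) n @[n --> \oo] --> mu (\bigcup_N F N) by exact: nondecreasing_cvg_mu.
rewrite -(cvg_lim _ cv)//; apply: lime_le; first by apply/cvg_ex; eexists; exact: cv.
by apply: nearW => N; exact: H.
Qed.

Lemma measurable_incr (d L : nat) (A : set (edge d L -> bool)) :
  increasing A -> finitary A -> measurable (A : set (config d L)).
Proof.
move=> iA fA; rewrite (finitary_bigcup iA fA); apply: bigcup_measurable => N _.
by apply: measurable_cylinder; exact: cylinder_restr.
Qed.

Theorem BK (R : realType) (d L : nat) (p : R) (mu : probability (config d L) R)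
    (A B : set (edge d L -> bool)) :
  0 <= p <= 1 -> bernoulli_percolation p mu ->
  increasing A -> increasing B -> finitary A -> finitary B ->
  (mu (disj_occ A B : set (config d L)) <=
    mu (A : set (config d L)) * mu (B : set (config d L)))%E.
Proof.
move=> p01 hmu iA iB fA fB.
apply: mu_finitary_le; [exact: increasing_disj_occ|exact: finitary_disj_occ|].
move=> N; have us : uniq (initial_seq (edge d L) N) by exact: undup_uniq.
rewrite (mu_Pr _ hmu us); apply: (@le_trans _ _ (Pr p (initial_seq _ N) A * Pr p (initial_seq _ N) B)%:E).
  by rewrite lee_fin; exact: BK_finite.
have le A' : increasing A' -> finitary A' ->
    ((Pr p (initial_seq (edge d L) N) A')%:E <= mu (A' : set (config d L)))%E.
  move=> iA' fA'; rewrite -(mu_Pr _ hmu us); apply: le_measure; rewrite ?inE.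
  - by apply: measurable_cylinder; exact: cylinder_restr.
  - exact: measurable_incr.
  - by move=> w; apply: iA'; exact: restr_le.
by rewrite EFinM lee_pmul ?lee_fin ?Pr_ge0//; exact: le.
Qed.

(** * Open paths and edge disjoint arms *)

Lemma open_edge_sym (d L : nat) (w : config d L) : symmetric (open_edge w).
Proof. by move=> x y; rewrite /open_edge fsetUC. Qed.

Lemma open_edge_le (d L : nat) (w w' : edge d L -> bool) x y :
  subconf w w' -> open_edge (w : config d L) x y -> open_edge (w' : config d L) x y.
Proof. by move=> ww; rewrite /open_edge; case: insubP => // e _ _ /ww. Qed.

Lemma connected_refl (d L : nat) (w : config d L) x : connected_by w x x.
Proof. by exists [::]. Qed.

Lemma connected_trans (d L : nat) (w : config d L) y x z :
  connected_by w x y -> connected_by w y z -> connected_by w x z.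
Proof.
move=> [p [xp py]] [q [yq qz]]; exists (p ++ q).
by rewrite cat_path xp py yq last_cat py.
Qed.

Lemma connected_edge (d L : nat) (w : config d L) x y :
  open_edge w x y -> connected_by w x y.
Proof. by move=> xy; exists [:: y]; rewrite /= xy. Qed.

Lemma connected_sym (d L : nat) (w : config d L) x y :
  connected_by w x y -> connected_by w y x.
Proof.
move=> [p [xp <-]]; elim: p x xp => [|a p IH] x /=; first by exists [::].
move=> /andP[xa ap]; apply: connected_trans (IH _ ap) _.
by apply: connected_edge; rewrite open_edge_sym.
Qed.

Lemma increasing_conn (d L : nat) (x y : 'rV[int]_d) :
  increasing (conn x y : set (edge d L -> bool)).
Proof.
move=> w w' ww [p [xp py]]; exists p; split => //.
by apply: sub_path xp => a b; exact: open_edge_le.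
Qed.

Lemma open_edge_finitary (d L : nat) (w : edge d L -> bool) x y :
  open_edge (w : config d L) x y ->
  exists N, open_edge (restr (initial_seq _ N) w : config d L) x y.
Proof.
rewrite /open_edge; case: insubP => // e _ _ we; exists (choice.pickle e).+1.
by rewrite /restr we initial_seqP.
Qed.

Lemma finitary_conn (d L : nat) (x y : 'rV[int]_d) :
  finitary (conn x y : set (edge d L -> bool)).
Proof.
move=> w [p [xp <-]]; elim: p x xp => [|a p IH] x /=.
  by exists 0%N; exact: connected_refl.
move=> /andP[/open_edge_finitary[N1 h1] /IH[N2 h2]]; exists (maxn N1 N2).
have sub N : (N <= maxn N1 N2)%N ->
    subconf (restr (initial_seq _ N) w) (restr (initial_seq _ (maxn N1 N2)) w).
  by move=> NM; apply: subconf_restr => //; exact: initial_seqS.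
apply: (@connected_trans _ _ _ a).
  by apply: connected_edge; apply: open_edge_le h1; apply: sub; exact: leq_maxl.
by apply: increasing_conn h2; apply: sub; exact: leq_maxr.
Qed.

Lemma BK4 (R : realType) (d L : nat) (p : R) (mu : probability (config d L) R)
    (A1 A2 A3 A4 : set (edge d L -> bool)) :
  0 <= p <= 1 -> bernoulli_percolation p mu ->
  increasing A1 -> increasing A2 -> increasing A3 -> increasing A4 ->
  finitary A1 -> finitary A2 -> finitary A3 -> finitary A4 ->
  (mu (disj_occ A1 (disj_occ A2 (disj_occ A3 A4)) : set (config d L)) <=
    mu (A1 : set (config d L)) * (mu (A2 : set (config d L)) *
    (mu (A3 : set (config d L)) * mu (A4 : set (config d L)))))%E.
Proof.
move=> p01 hmu i1 i2 i3 i4 f1 f2 f3 f4.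
have i34 := @increasing_disj_occ _ A3 A4; have f34 := finitary_disj_occ i3 i4 f3 f4.
have i234 := @increasing_disj_occ _ A2 (disj_occ A3 A4).
have f234 := finitary_disj_occ i2 i34 f2 f34.
apply: le_trans (BK p01 hmu i1 i234 f1 f234) _; apply: lee_wpmul2l => //.
apply: le_trans (BK p01 hmu i2 i34 f2 f34) _; apply: lee_wpmul2l => //.
exact: BK p01 hmu i3 i4 f3 f4.
Qed.

Definition inside (d L : nat) (U : pred 'rV[int]_d) (w : edge d L -> bool) :
    edge d L -> bool :=
  fun e => w e && all U (val e).

(** An edge has two distinct ends, so vertex sets with at most one common point share no edge. Edge
    disjointness of paths is thus checked on vertices. *)
Lemma inside_disj (d L : nat) (U U' : pred 'rV[int]_d) (w : edge d L -> bool) e :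
  (forall a b, U a -> U' a -> U b -> U' b -> a = b) ->
  ~~ (inside U w e && inside U' w e).
Proof.
move=> UU; apply/negP => /andP[/andP[_ hU] /andP[_ hU']].
have /asboolP[a [b [ab _ E]]] := valP e.
have aE : a \in val e by rewrite E !inE eqxx.
have bE : b \in val e by rewrite E !inE eqxx orbT.
move/eqP: ab; apply; apply: UU; by [apply: (allP hU)|apply: (allP hU')].
Qed.

Lemma inside_le (d L : nat) (U : pred 'rV[int]_d) (w : edge d L -> bool) :
  subconf (inside U w) w.
Proof. by move=> e /andP[]. Qed.

Lemma open_inside (d L : nat) (U : pred 'rV[int]_d) (w : edge d L -> bool) x y :
  open_edge (w : config d L) x y -> U x -> U y ->
  open_edge (inside U w : config d L) x y.
Proof.
rewrite /open_edge; case: insubP => // e _ eE we Ux Uy.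
rewrite /inside we /=; apply/allP => a; rewrite eE !inE => /orP[]/eqP->//.
Qed.

Lemma connected_nth (d L : nat) (w : edge d L -> bool) (U : pred 'rV[int]_d)
    (x0 x : 'rV[int]_d) (p : seq 'rV[int]_d) (i j : nat) :
  path (open_edge (w : config d L)) x p -> (i <= j)%N -> (j < (size p).+1)%N ->
  (forall k, (i <= k <= j)%N -> U (nth x0 (x :: p) k)) ->
  connected_by (inside U w : config d L) (nth x0 (x :: p) i) (nth x0 (x :: p) j).
Proof.
move=> /(pathP x0) xp ij; rewrite -(subnKC ij); move: (j - i)%N => m {j ij}.
elim: m => [|m IH]; first by rewrite addn0 => *; exact: connected_refl.
rewrite addnS ltnS => im HU.
apply: (@connected_trans _ _ _ (nth x0 (x :: p) (i + m))).
  apply: IH => [|k /andP[k1 k2]]; first by rewrite ltnS; exact: ltnW.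
  by apply: HU; rewrite k1 (leq_trans k2)// leqnSn.
apply: connected_edge; apply: open_inside; first exact: xp.
- by apply: HU; rewrite leq_addr leqnSn.
- by apply: HU; rewrite leqnn andbT -addnS leq_addr.
Qed.

Lemma disj_occ4 (T : eqType) (A1 A2 A3 A4 : set (T -> bool)) (w w1 w2 w3 w4 : T -> bool) :
  subconf w1 w -> subconf w2 w -> subconf w3 w -> subconf w4 w ->
  (forall e, [/\ ~~ (w1 e && w2 e), ~~ (w1 e && w3 e) & ~~ (w1 e && w4 e)]) ->
  (forall e, [/\ ~~ (w2 e && w3 e), ~~ (w2 e && w4 e) & ~~ (w3 e && w4 e)]) ->
  A1 w1 -> A2 w2 -> A3 w3 -> A4 w4 ->
  disj_occ A1 (disj_occ A2 (disj_occ A3 A4)) w.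
Proof.
move=> s1 s2 s3 s4 h1 h2 a1 a2 a3 a4.
exists w1, (fun e => [|| w2 e, w3 e | w4 e]); split => //.
- by move=> e /or3P[/s2|/s3|/s4].
- by move=> e; have [] := h1 e; case: (w1 e) => //=; case: (w2 e); case: (w3 e).
exists w2, (fun e => w3 e || w4 e); split => //.
- by move=> e ->.
- by move=> e ->; rewrite orbT.
- by move=> e; have [] := h2 e; case: (w2 e) => //=; case: (w3 e).
exists w3, w4; split => //.
- by move=> e ->.
- by move=> e ->; rewrite orbT.
- by move=> e; have [] := h2 e.
Qed.

Definition box_edges (d L n : nat) : seq (edge d L) :=
  pmap insub (enum_fset (fpowerset [fset v in box_seq d n]%fset)).

Lemma mem_box_edges (d L n : nat) (e : edge d L) :
  all (mem (box_seq d n)) (val e) -> e \in box_edges d L n.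
Proof.
move=> /allP h; rewrite mem_pmap_sub; rewrite /= fpowersetE; apply/fsubsetP => a /h /= ha.
by rewrite in_fset; exact: ha.
Qed.

(* [v] is the branch point of [x], [y] and [z], and [u] lies outside the box on
   the open path from [x] to [y]. *)
Definition four_arms (d L : nat) (x y z u v : 'rV[int]_d) : set (edge d L -> bool) :=
  disj_occ (conn x u) (disj_occ (conn u v) (disj_occ (conn v y) (conn v z))).

(** [t] is a simple path from [x] to [y], [u] a vertex of it off the box, and [v] the first vertex
    of [t] on a path from [z], so that the piece from [z] to [v] meets [t] in [v] only. The other
    three arms are segments of [t]; the order of [u] and [v] along [t] decides whether [x] and [y]
    trade places. *)
Lemma far_connection (d L n : nat) (x y z : 'rV[int]_d) (w : edge d L -> bool) :
  connected_by (w : config d L) x y -> connected_by (w : config d L) x z ->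
  ~ connected_by (restr (box_edges d L n) w : config d L) x y ->
  exists u v, u \notin box_seq d n /\
   (four_arms x y z u v w \/ four_arms y x z u v w).
Proof.
move=> [p0 [xp0 p0y]] /connected_sym[q [zq qx]] nxy.
case/shortenP: xp0 p0y => p xp up _ py.
set t := x :: p in up; set t' := z :: q.
have [u ut uB] : exists2 u, u \in t & u \notin box_seq d n.
  apply/hasP; rewrite has_predC; apply/negP => /allP tB; apply: nxy.
  have h : connected_by (inside (mem (box_seq d n)) w : config d L) x y.
    have := @connected_nth d L w (mem (box_seq d n)) x x p 0 (size p) xp (leq0n _) (ltnSn _).
    rewrite nth0 /= -last_nth py; apply => k kp.
    by apply: tB; apply: mem_nth.
  apply: increasing_conn h => e /andP[we eB].
  by rewrite /restr we mem_box_edges.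
have ht : has (mem t) t'.
  by apply/hasP; exists x; [rewrite /t' -[X in X \in _]qx; exact: mem_last | exact: mem_head].
pose m := find (mem t) t'; pose v := nth x t' m.
have mt : (m < size t')%N by rewrite -has_find.
have vt : v \in t by exact: nth_find.
have mlt k : (k < m)%N -> nth x t' k \notin t.
  by move=> km; have := before_find x km => /negbT.
pose U4 := mem (take m.+1 t').
have U4v a : U4 a -> a \in t -> a = v.
  move=> /= /(nthP x)[k]; rewrite size_take_min => kl <-.
  have km : (k <= m)%N by rewrite -ltnS (leq_trans kl)// geq_minl.
  rewrite nth_take//; move: km; rewrite leq_eqVlt => /orP[/eqP -> //|/mlt kt].
  by rewrite (negPf kt).
have c4 : connected_by (inside U4 w : config d L) v z.
  apply: connected_sym; have := @connected_nth d L w U4 x z q 0 m zq (leq0n _) mt.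
  rewrite nth0 /=; apply => k km; rewrite /U4 /= -(nth_take _ (km : (k < m.+1)%N)).
  by apply: mem_nth; rewrite size_take_min leq_min ltnS km (leq_ltn_trans km mt).
pose ran i j : pred 'rV[int]_d := fun a => (a \in t) && (i <= index a t <= j)%N.
have ranc i j : (i <= j)%N -> (j < size t)%N ->
    connected_by (inside (ran i j) w : config d L) (nth x t i) (nth x t j).
  move=> ij jt; apply: connected_nth => // k /andP[ik kj].
  have kt : (k < size t)%N by exact: leq_ltn_trans jt.
  by rewrite /ran mem_nth// index_uniq// ik kj.
have ran_eq i j i' j' a b : (j <= i')%N -> ran i j a -> ran i' j' a -> ran i j b -> ran i' j' b -> a = b.
  move=> ji /andP[a_t /andP[_ a1]] /andP[_ /andP[a2 _]] /andP[b_t /andP[_ b1]] /andP[_ /andP[b2 _]].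
  have E : index a t = index b t by lia.
  by rewrite -(nth_index x a_t) E nth_index.
have ran4 i j a b : ran i j a -> U4 a -> ran i j b -> U4 b -> a = b.
  by move=> /andP[a_t _] /U4v -> // /andP[b_t _] /U4v ->.
exists u, v; split => //.
have iu : (index u t < size t)%N by rewrite index_mem.
have iv : (index v t < size t)%N by rewrite index_mem.
have xE : nth x t 0 = x by [].
have yE : nth x t (size p) = y by rewrite /t nth_last.
have uE : nth x t (index u t) = u by exact: nth_index.
have vE : nth x t (index v t) = v by exact: nth_index.
have [iuv|ivu] := leqP (index u t) (index v t); [left|right].
- have c1 := ranc _ _ (leq0n _) iu; have c2 := ranc _ _ iuv iv.
  have c3 := ranc (index v t) (size p) iv (ltnSn _).
  rewrite xE uE vE yE in c1 c2 c3.
  apply: (disj_occ4 _ _ _ _ _ _ c1 c2 c3 c4); try exact: inside_le.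
    move=> e; split; apply: inside_disj; last exact: ran4.
      by move=> a b; exact: ran_eq.
    by move=> a b; exact: ran_eq.
  move=> e; split; apply: inside_disj; try exact: ran4.
  by move=> a b; exact: ran_eq.
- have ivu' := ltnW ivu.
  have c1 := ranc (index u t) (size p) iu (ltnSn _); have c2 := ranc _ _ ivu' iu.
  have c3 := ranc _ _ (leq0n _) iv.
  rewrite xE uE vE yE in c1 c2 c3.
  move/connected_sym: c1 => c1; move/connected_sym: c2 => c2; move/connected_sym: c3 => c3.
  have ran_eq' i j i' j' a b : (j <= i')%N ->
      ran i' j' a -> ran i j a -> ran i' j' b -> ran i j b -> a = b.
    by move=> ji h1 h2 h3 h4; exact: (ran_eq _ _ _ _ _ _ ji h2 h1 h4 h3).
  apply: (disj_occ4 _ _ _ _ _ _ c1 c2 c3 c4); try exact: inside_le.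
    move=> e; split; apply: inside_disj; last exact: ran4.
      by move=> a b; exact: ran_eq'.
    by move=> a b; exact: ran_eq'.
  move=> e; split; apply: inside_disj; try exact: ran4.
  by move=> a b; exact: ran_eq'.
Qed.

(** * The IIC limit *)

Lemma measure_le_esum (R : realType) (d L : nat) (mu : probability (config d L) R)
    (T : countType) (D : set T) (F : T -> set (config d L)) (B : set (config d L)) :
  (forall t, measurable (F t)) -> measurable B ->
  B `<=` \bigcup_(t in D) F t -> (mu B <= \esum_(t in D) mu (F t))%E.
Proof.
move=> mF mB BF.
pose G n := if pickle_inv n is Some t then (if t \in D then F t else set0) else set0 : set (config d L).
have mG n : measurable (G n) by rewrite /G; case: pickle_inv => // t; case: ifP.
have BG : B `<=` \bigcup_n G n.
  move=> w /BF[t Dt Ft]; exists (choice.pickle t) => //.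
  by rewrite /G pickleK_inv mem_set.
apply: le_trans (measure_sigma_subadditive _ mG mB BG) _.
rewrite nneseries_esumT; last by move=> n; exact: measure_ge0.
pose H n := mu (G n).
have -> : (\esum_(t in D) mu (F t))%E = (\esum_(n in [set choice.pickle t | t in D]) H n)%E.
  rewrite esum_image; last by move=> a b _ _ /(pcan_inj pickleK_inv).
  by apply: eq_esum => t Dt; rewrite /H /G pickleK_inv mem_set.
rewrite [leRHS]esum_mkcond; apply: le_esum => n _; rewrite /H.
case: ifPn => // nD; rewrite /G; case nE : (pickle_inv n) => [t|]; last by rewrite measure0.
case: ifPn => [tD|]; last by rewrite measure0.
move: nD; rewrite notin_setE => /(_ _)[]; exists t; first exact: set_mem.
by have := @pickle_invK T n; rewrite nE.
Qed.

Lemma conn_measurable (d L : nat) (x y : 'rV[int]_d) :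
  measurable (conn x y : set (config d L)).
Proof. by apply: measurable_incr; [exact: increasing_conn|exact: finitary_conn]. Qed.

(** * The two-point function and connections that leave the box *)

Section two_point.
Context {R : realType} {d L : nat} (mu : probability (config d L) R) (A p : R).
Hypotheses (d6 : (6 < d)%N) (A0 : 0 < A) (hT : two_point_asymptotics mu A).
Hypotheses (p01 : 0 <= p <= 1) (hmu : bernoulli_percolation p mu).

Definition tau (x y : 'rV[int]_d) : R := fine (mu (conn x y)).

Let d4 : (4 < d)%N. Proof. exact: ltn_trans d6. Qed.
Let d2 : (2 < d)%N. Proof. exact: ltn_trans d4. Qed.
Let d0 : (0 < d)%N. Proof. exact: ltn_trans d2. Qed.
Let tr : transient R d. Proof. exact: transientP. Qed.

Lemma tauE x y : (tau x y)%:E = mu (conn x y).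
Proof. by rewrite /tau fineK// fin_num_measure//; exact: conn_measurable. Qed.

Lemma tau_ge0 x y : 0 <= tau x y.
Proof. by rewrite fine_ge0. Qed.

Lemma tau_le1 x y : tau x y <= 1.
Proof. by rewrite -lee_fin tauE probability_le1//; exact: conn_measurable. Qed.

Lemma two_point_cvg :
  tau xy.1 xy.2 / (A * green R xy.1 xy.2) @[xy --> @far_apart R d] --> (1 : R).
Proof.
have [_] := hT; apply => /(_ (0, 0)) /eqP; rewrite /= mulf_eq0 !gt_eqF//.
exact: green_gt0.
Qed.

(** At large distance by the asymptotics and [green_upper]; at bounded distance because [tau] is at
    most 1 and [riesz] is bounded below. *)
Lemma tau_upper : exists2 C : R, 0 < C &
  forall x y, tau x y <= C * riesz 1 (crit R d) (x - y).
Proof.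
have /cvgrPdist_le/(_ _ ltr01)[M _ HM] := two_point_cvg.
have [C C0 HC] := green_upper R d2.
set al := crit R d in HC *; have al0 : 0 <= al by rewrite ltW// crit_gt0.
pose C2 := (M ^+ 2 + 1) `^ al.
have C20 : 0 < C2 by rewrite powR_gt0// ltr_wpDl// sqr_ge0.
exists (2 * A * C + C2) => [|x y].
  by have := mulr_gt0 A0 C0; lra.
have r0 : 0 < riesz 1 al (x - y) by exact: riesz_gt0.
have [xyM|xyM] := leP M (enorm R (x - y)).
  have := HM (x, y) xyM; rewrite /= ler_distl => /andP[h _].
  have g0 : 0 < A * green R x y by rewrite mulr_gt0// green_gt0.
  have : tau x y <= 2 * (A * green R x y).
    by rewrite -ler_pdivrMr//; lra.
  have := HC x y; have : 0 <= C2 * riesz 1 al (x - y) by rewrite mulr_ge0// ltW.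
  move=> h1 h2; have : A * green R x y <= A * (C * riesz 1 al (x - y)) by rewrite ler_pM2l.
  lra.
apply: (@le_trans _ _ (C2 * riesz 1 al (x - y))).
  apply: le_trans (tau_le1 x y) _.
  have M0 : 0 <= M by apply: le_trans (ltW xyM); rewrite enormE sqrtr_ge0.
  have sM : sqnorm R (x - y) <= M ^+ 2.
    rewrite -(sqr_sqrtr (sqnorm_ge0 R (x - y))) lerXn2r ?nnegrE ?sqrtr_ge0// ltW//.
  have n0 := sqnorm_ge0 R (x - y).
  have -> : C2 = ((M ^+ 2 + 1) `^ (- al))^-1 by rewrite powRN invrK.
  rewrite mulrC ler_pdivlMr ?mul1r; last by rewrite powR_gt0// ltr_wpDl// sqr_ge0.
  by apply: powRN_le => //; lra.
rewrite ler_wpM2r ?(ltW r0)// lerDr; apply: mulr_ge0; last exact: ltW.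
by rewrite mulr_ge0// ltW.
Qed.

Lemma near_far_apart (x : 'rV[int]_d) (P : set ('rV[int]_d * 'rV[int]_d)) :
  (\forall xy \near @far_apart R d, P xy) ->
  \forall z \near @near_infinity R d, P (x, z).
Proof.
move=> [M _ HM]; apply: (@near_infinity_sqnorm R d _ (2 * (M ^+ 2 + sqnorm R x))).
move=> z hz; apply: HM => /=; rewrite enormE; apply: le_trans (ler_norm M) _.
rewrite -sqrtr_sqr ler_wsqrtr//.
rewrite -sqnormN opprB.
by have := sqnorm_near R z (- x); rewrite sqnormN; lra.
Qed.

Lemma tau_ratio (x : 'rV[int]_d) :
  tau x z / (A * green R x z) @[z --> @near_infinity R d] --> (1 : R).
Proof.
apply/cvgrPdist_le => eps e0.
have /cvgrPdist_le/(_ _ e0) := two_point_cvg.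
exact: near_far_apart.
Qed.

Lemma tau_lower (x : 'rV[int]_d) :
  \forall z \near @near_infinity R d, A / 2 * green R x z <= tau x z.
Proof.
have h2 : (0 : R) < 2^-1 by rewrite invr_gt0.
have /cvgrPdist_le/(_ _ h2) := tau_ratio x.
apply: filterS => z; rewrite ler_distl => /andP[_ h].
have g0 : 0 < A * green R x z by rewrite mulr_gt0// green_gt0.
have : 2^-1 <= tau x z / (A * green R x z) by lra.
by rewrite ler_pdivlMr//; lra.
Qed.

Definition far_event (n : nat) (x y z : 'rV[int]_d) : set (config d L) :=
  (conn x y `&` conn x z) `\` [set w | conn x y (restr (box_edges d L n) w)].

Lemma measurable_far_event n x y z : measurable (far_event n x y z).
Proof.
apply: measurableD; first by apply: measurableI; exact: conn_measurable.
by apply: measurable_cylinder; exact: cylinder_restr.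
Qed.

Lemma four_arms_incr (x y z u v : 'rV[int]_d) :
  increasing (four_arms x y z u v : set (edge d L -> bool)).
Proof. exact: increasing_disj_occ. Qed.

Lemma four_arms_fin (x y z u v : 'rV[int]_d) :
  finitary (four_arms x y z u v : set (edge d L -> bool)).
Proof.
by repeat apply: finitary_disj_occ; try exact: increasing_disj_occ;
  try exact: increasing_conn; exact: finitary_conn.
Qed.

Lemma four_arms_le (x y z u v : 'rV[int]_d) :
  (mu (four_arms x y z u v) <= (tau x u * (tau u v * (tau v y * tau v z)))%:E)%E.
Proof.
rewrite !EFinM !tauE; apply: (BK4 p01 hmu); try exact: increasing_conn;
  exact: finitary_conn.
Qed.

(* The sum over the branch point converges because [d > 6]. *)
Lemma four_arms_sum (x y : 'rV[int]_d) : exists2 C : R, 0 < C & forall n z,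
  (\esum_(vu in [set vu | vu.2 \notin box_seq d n]) mu (four_arms x y z vu.2 vu.1) <=
   (C * (n%:R + 1) `^ (- (1 / 4)) * riesz 1 (crit R d) z)%:E)%E.
Proof.
have dR : 7 <= d%:R :> R by rewrite ler_nat.
have [C C0 HC] := tau_upper; have [c c0 Hc] := green_lower R d4.
set al := crit R d in HC Hc *; have al1 : 5 / 2 <= al by rewrite /al /crit; lra.
have al0 : 0 <= al by lra.
have rz0 (a : 'rV[int]_d) (b : R) : 0 <= riesz 1 b a by rewrite ltW// riesz_gt0.
(* The arm x--u gives up an exponent 1/4 as smallness off the box. The sum over u then returns
   exponent [al - 5 / 4] at v, and the arm v--y adds [al]. The sum over v needs
   [2 * al - 5 / 4 >= al + 1 / 4 + 1], that is [al >= 5 / 2], which is [d >= 7]. *)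
have b1 : 0 < al - 5 / 4 by lra.
have b2 : al - 5 / 4 < crit R d by rewrite -/al; lra.
have b3 : crit R d < al + 1 / 4 by rewrite -/al; lra.
have [C1 C10 HC1] := esum_potential_subcrit d2 b1 b2.
have [C2 C20 HC2] := esum_potential_supercrit d2 b3.
have tauR a : exists2 k : R, 0 < k & forall b, tau a b <= k * riesz 1 al b /\ tau b a <= k * riesz 1 al b.
  exists (C * (2 * (sqnorm R (- a) + 1)) `^ al).
    by rewrite mulr_gt0// powR_gt0// mulr_gt0//; have := sqnorm_ge0 R (- a); lra.
  move=> b; have h := riesz_shift b (- a) al0.
  have rsym : riesz 1 al (a - b) = riesz 1 al (b - a).
    by rewrite /riesz -sqnormN opprB.
  split; apply: le_trans (HC _ _) _; rewrite -mulrA ler_pM2l// ?rsym//.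
have tauG a b : tau a b <= C / c * green R b a.
  rewrite mulrAC -mulrA; apply: le_trans (HC a b) _; rewrite ler_pM2l//.
  by rewrite ler_pdivlMr// mulrC green_sym; exact: Hc.
have [kx kx0 Hx] := tauR x; have [ky ky0 Hy] := tauR y.
have Cc0 : 0 < C / c by rewrite divr_gt0.
move: Cc0 tauG; move: (C / c) => e e0 tauG.
pose K := kx * ky * e * e.
have K0 : 0 < K by rewrite /K !mulr_gt0.
have KE : K = kx * ky * e * e by [].
clearbody K.
exists (K * C1 * C2) => [|n z]; first by rewrite !mulr_gt0.
set q := _ `^ (- (1 / 4)); have q0 : 0 <= q by exact: powR_ge0.
pose f (v u : 'rV[int]_d) : R := green R v u * riesz 1 (al - 5 / 4 + 1) u.
have f0 v u : 0 <= f v u by rewrite mulr_ge0 ?green_ge0.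
pose g (v : 'rV[int]_d) : R := green R z v * riesz 1 (al + 1 / 4 + 1) v.
have g0 v : 0 <= g v by rewrite mulr_ge0 ?green_ge0.
rewrite (_ : [set vu | _] = setT `*`` (fun=> [set u | u \notin box_seq d n])); last first.
  by apply/seteqP; split => [[v u] h|[v u] []//]; split.
rewrite -(@esum_esum R _ _ setT (fun=> [set u | u \notin box_seq d n])
  (fun v u => mu (four_arms x y z u v)))//.
apply: (@le_trans _ _ (\esum_(v in setT) (K * q * C1 * g v)%:E)%E); last first.
  have kq : 0 <= K * q * C1 by rewrite !mulr_ge0// ltW.
  apply: le_trans (esumZl _ kq g0) _.
  apply: le_trans (lee_wpmul2l _ (HC2 z)) _; first by rewrite lee_fin.
  by rewrite -EFinM lee_fin le_eqVlt; apply/orP; left; apply/eqP; ring.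
apply: le_esum => v _.
pose kv : R := K * q * riesz 1 al v * green R z v.
have kv0 : 0 <= kv by rewrite /kv !mulr_ge0 ?(ltW K0) ?green_ge0.
apply: (@le_trans _ _ (\esum_(u in [set u | u \notin box_seq d n]) (kv * f v u)%:E)%E).
  apply: le_esum => u ub; apply: le_trans (four_arms_le _ _ _ _ _) _; rewrite lee_fin.
  have ru : riesz 1 al u <= q * riesz 1 (al - 5 / 4 + 1) u.
    have -> : riesz 1 al u = riesz 1 (1 / 4) u * riesz 1 (al - 5 / 4 + 1) u.
      by rewrite rieszM//; congr (riesz _ _ _); lra.
    by rewrite ler_wpM2r// /q; apply: riesz_far => //; lra.
  apply: (@le_trans _ _ ((kx * riesz 1 al u) * ((e * green R v u) * ((ky * riesz 1 al v) * (e * green R z v))))).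
    apply: ler_pM; rewrite ?tau_ge0 ?mulr_ge0 ?tau_ge0//; first by have [] := Hx u.
    apply: ler_pM; rewrite ?tau_ge0 ?mulr_ge0 ?tau_ge0//.
    apply: ler_pM; rewrite ?tau_ge0//; by have [] := Hy v.
  rewrite [leLHS](_ : _ = K * (riesz 1 al v * green R z v * green R v u) * riesz 1 al u); last by rewrite KE; ring.
  rewrite [leRHS](_ : _ = K * (riesz 1 al v * green R z v * green R v u) *
    (q * riesz 1 (al - 5 / 4 + 1) u)); last by rewrite /kv /f; ring.
  by rewrite ler_wpM2l// !mulr_ge0 ?(ltW K0) ?green_ge0.
apply: le_trans (esumZl _ kv0 (f0 v)) _.
apply: (@le_trans _ _ (kv%:E * \esum_(u in setT) (f v u)%:E)%E).
  by apply: lee_wpmul2l => //; exact: le_esum_subset.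
apply: le_trans (lee_wpmul2l _ (HC1 v)) _; first by rewrite lee_fin.
rewrite -EFinM lee_fin /kv /g.
rewrite [leLHS](_ : _ = K * q * C1 * green R z v * (riesz 1 al v * riesz 1 (al - 5 / 4) v)); last by ring.
rewrite [leRHS](_ : _ = K * q * C1 * green R z v * riesz 1 (al + 1 / 4 + 1) v); last by ring.
rewrite ler_wpM2l ?mulr_ge0 ?(ltW K0) ?(ltW C10) ?green_ge0//.
by rewrite rieszM// riesz_exp_le//; lra.
Qed.

(** The range of z is the one where [tau x z] dominates a multiple of [green R x z], hence is the
    same for all n. *)
Lemma far_event_le (x y : 'rV[int]_d) : exists2 C : R, 0 < C &
  \forall z \near @near_infinity R d, forall n,
    fine (mu (far_event n x y z)) <= C * (n%:R + 1) `^ (- (1 / 4)) * tau x z.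
Proof.
have [C1 C10 H1] := four_arms_sum x y; have [C2 C20 H2] := four_arms_sum y x.
have [c c0 Hc] := green_lower R d4; have [k k0 Hk] := harnack 0 x tr.
pose C := (C1 + C2) * (k / c) * (2 / A).
exists C; first by rewrite /C mulr_gt0 ?divr_gt0// mulr_gt0 ?divr_gt0// addr_gt0.
apply: filterS (tau_lower x) => z hz n; set q := _ `^ _.
have q0 : 0 <= q by exact: powR_ge0.
pose D := [set vu : 'rV[int]_d * 'rV[int]_d | vu.2 \notin box_seq d n].
have fam a b vu : measurable (four_arms a b z vu.2 vu.1 : set (config d L)).
  by apply: measurable_incr; [exact: four_arms_incr|exact: four_arms_fin].
have sub : far_event n x y z `<=`
    \bigcup_(vu in D) (four_arms x y z vu.2 vu.1 `|` four_arms y x z vu.2 vu.1).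
  move=> w [[xy xz] nxy]; have [u [v [ub h]]] := far_connection xy xz nxy.
  by exists (v, u).
have : (mu (far_event n x y z) <= ((C1 + C2) * q * riesz 1 (crit R d) z)%:E)%E.
  apply: le_trans (measure_le_esum _ _ _ sub) _.
  - by move=> vu; exact: measurableU.
  - exact: measurable_far_event.
  apply: (@le_trans _ _ (\esum_(vu in D) (mu (four_arms x y z vu.2 vu.1) + mu (four_arms y x z vu.2 vu.1)))%E).
    by apply: le_esum => vu _; exact: measureU2.
  rewrite esumD; [|by move=> *; exact: measure_ge0|by move=> *; exact: measure_ge0].
  apply: le_trans (leeD (H1 n z) (H2 n z)) _.
  by rewrite -EFinD lee_fin !mulrDl.
move=> h; rewrite -lee_fin fineK; last first.
  by apply: fin_num_measure; exact: measurable_far_event.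
apply: le_trans h _; rewrite lee_fin.
have h1 : riesz 1 (crit R d) z <= k / c * green R x z.
  rewrite mulrAC ler_pdivlMr// mulrC; apply: le_trans (Hk z).
  by rewrite green_sym -[X in riesz _ _ X]subr0; exact: Hc.
have h2 : green R x z <= 2 / A * tau x z.
  rewrite mulrAC ler_pdivlMr//; move: hz; rewrite -(ler_pM2l (ltr0Sn R 1)).
  by rewrite mulrA mulrCA divff// mulr1 mulrC.
apply: (@le_trans _ _ ((C1 + C2) * q * (k / c * (2 / A * tau x z)))); last first.
  by rewrite le_eqVlt; apply/orP; left; apply/eqP; rewrite /C; ring.
rewrite ler_wpM2l//; first by rewrite mulr_ge0// addr_ge0// ltW.
by apply: le_trans h1 _; rewrite ler_wpM2l// divr_ge0// ltW.
Qed.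

End two_point.

Lemma shift_edgeK (d L : nat) (x : 'rV[int]_d) (e : edge d L) :
  shift_edge x (shift_edge (- x) e) = e.
Proof.
apply/val_inj/fsetP => y /=; apply/imfsetP/idP => [[u /= /imfsetP[v /= ve ->] ->]|ye].
  by rewrite subrK.
by exists (y - x); rewrite ?subrK//; apply/imfsetP; exists y.
Qed.

Lemma cylinder_shift (d L : nat) (x : 'rV[int]_d) (F : set (edge d L -> bool)) :
  cylinder F -> cylinder (shift_event x F).
Proof.
move=> [S HS]; exists [fset shift_edge x e | e in S]%fset => w w' ww'.
by apply: HS => e eS; apply: ww'; apply/imfsetP; exists e.
Qed.

Lemma cylinderT (d L : nat) : cylinder [set: edge d L -> bool].
Proof. by exists fset0. Qed.

Lemma cvg_near_eq (R : realType) (T : Type) (F : set_system T) (f g : T -> R) (l : R) :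
  Filter F -> (\forall t \near F, f t = g t) -> (g t @[t --> F] --> l) ->
  f t @[t --> F] --> l.
Proof.
move=> FF fg /cvgrPdist_le gl; apply/cvgrPdist_le => eps e0.
by apply: filterS2 fg (gl _ e0) => t ->.
Qed.

(** * Existence of the limit of the k-point ratio *)

Section kpoint.
Context {R : realType} {d L : nat} (mu : probability (config d L) R) (A p : R).
Hypotheses (d6 : (6 < d)%N) (A0 : 0 < A) (hT : two_point_asymptotics mu A).
Hypotheses (p01 : 0 <= p <= 1) (hmu : bernoulli_percolation p mu).
Hypothesis hB : two_blob_estimate mu.

Let d0 : (0 < d)%N. Proof. exact: ltn_trans d6. Qed.
Let tr : transient R d. Proof. by apply: transientP; exact: ltn_trans d6. Qed.

Lemma tau_gt0_near (x : 'rV[int]_d) : \forall z \near @near_infinity R d, 0 < tau mu x z.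
Proof.
apply: filterS (tau_lower d6 A0 hT x) => z; apply: lt_le_trans.
by rewrite mulr_gt0 ?divr_gt0// green_gt0.
Qed.

(** The two-blob estimate with the sure event at z, and with [F] translated by [- x] because the
    estimate shifts its first event to [x]. *)
Lemma cylinder_cond_cvg (x : 'rV[int]_d) (F : set (edge d L -> bool)) : cylinder F ->
  exists l : R, fine (mu (F `&` conn x z)) / tau mu x z
    @[z --> @near_infinity R d] --> l.
Proof.
move=> cF; have [iic [_ blob]] := hB.
have := blob (shift_event (- x) F) setT (cylinder_shift (- x) cF) (@cylinderT d L).
set f := (fun xy => fine (mu _)); set g := (fun xy => _ * fine (mu _)) => -[as0 as1].
have fE z : f (x, z) = fine (mu (F `&` conn x z)).
  rewrite /f /= (_ : shift_event z setT = setT)// setIT setIC; congr (fine (mu (_ `&` _))).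
  rewrite /shift_event; apply/seteqP; split => w /=;
    rewrite (_ : (fun e => w (shift_edge x (shift_edge (- x) e))) = w)//;
    by apply/funext => e; rewrite shift_edgeK.
(* If the comparison function is identically zero, [asymptotic] says that the numerators vanish
   eventually, and the limit is 0. *)
have [g0|gn0] := pselect (forall t, g t = 0).
  exists 0; apply: (@cvg_near_eq _ _ _ _ (fun=> 0)); last exact: cvg_cst.
  by have := near_far_apart x (as0 g0); apply: filterS => z; rewrite fE => ->; rewrite mul0r.
pose b := fine (iic (shift_event (- x) F)) * fine (iic setT).
have gE z : g (x, z) = b * tau mu x z by [].
have b0 : b != 0.
  by apply: contra_notN gn0 => /eqP b0 t; rewrite /g; move: b0; rewrite /b => ->; rewrite mul0r.
exists b; apply: (@cvg_near_eq _ _ _ _ (fun z => f (x, z) / g (x, z) * b)).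
  apply: filterS (tau_gt0_near x) => z tz; rewrite fE gE.
  by field; rewrite b0 gt_eqF.
have h : f (x, z) / g (x, z) @[z --> @near_infinity R d] --> (1 : R).
  apply/cvgrPdist_le => eps e0.
  have /cvgrPdist_le/(_ _ e0) := as1 gn0; exact: near_far_apart.
have h2 := cvgM h (cvg_cst b); rewrite mul1r in h2; exact: h2.
Qed.

Lemma measurable_one_cluster (k : nat) (x : k.-tuple 'rV[int]_d) :
  measurable (in_one_cluster x : set (config d L)).
Proof.
rewrite (_ : in_one_cluster x =
  \bigcap_(ij in [set: 'I_k * 'I_k]) (conn (tnth x ij.1) (tnth x ij.2) : set (config d L))).
  by apply: fin_bigcap_measurable => //= ij _; exact: conn_measurable.
apply/seteqP; split => w h; first by move=> [i j] _; exact: h.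
by move=> i j; exact: (h (i, j)).
Qed.

Lemma kpoint2E (a z : 'rV[int]_d) : kpoint mu [tuple a; z] = tau mu a z.
Proof.
rewrite /kpoint /tau; congr (fine (mu _)); apply/seteqP; split => w.
  by move=> /(_ ord0 ord_max); rewrite (tnth_nth 0) (tnth_nth 0).
have t0 : tnth [tuple a; z] ord0 = a by rewrite (tnth_nth 0).
have t1 : tnth [tuple a; z] ord_max = z by rewrite (tnth_nth 0).
have o (i : 'I_2) : i = ord0 \/ i = ord_max.
  by case: i => [[|[|//]] ?]; [left|right]; apply/val_inj.
move=> az i j; have [->|->] := o i; have [->|->] := o j; rewrite ?t0 ?t1//.
- exact: connected_refl.
- exact: connected_sym.
- exact: connected_refl.
Qed.

Lemma one_cluster_rcons (k : nat) (x : k.-tuple 'rV[int]_d) (z : 'rV[int]_d) :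
  (0 < k)%N -> in_one_cluster [tuple of rcons x z] =
  [set w : config d L | (forall i, connected_by w (head 0 x) (tnth x i)) /\
     connected_by w (head 0 x) z].
Proof.
move=> k0; have lt i : (i < k)%N -> (i < k.+1)%N by move=> /ltnW; rewrite ltnS.
have t1 (i : 'I_k) : tnth [tuple of rcons x z] (Ordinal (lt i (ltn_ord i))) = tnth x i.
  by rewrite !(tnth_nth 0) /= nth_rcons size_tuple ltn_ord.
have t2 : tnth [tuple of rcons x z] ord_max = z.
  by rewrite (tnth_nth 0) /= nth_rcons size_tuple ltnn eqxx.
have t0 : head 0 x = tnth x (Ordinal k0) by rewrite (tnth_nth 0) /= nth0.
have oP (i : 'I_k.+1) : i = ord_max \/ exists j : 'I_k, i = Ordinal (lt j (ltn_ord j)).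
  have := ltn_ord i; rewrite ltnS leq_eqVlt => /orP[/eqP E|ik].
    by left; apply/val_inj.
  by right; exists (Ordinal ik); apply/val_inj.
apply/seteqP; split => w.
  move=> h; rewrite t0; split => [i|].
    by have := h (Ordinal (lt _ (ltn_ord (Ordinal k0)))) (Ordinal (lt i (ltn_ord i))); rewrite !t1.
  by have := h (Ordinal (lt _ (ltn_ord (Ordinal k0)))) ord_max; rewrite t1 t2.
move=> [h1 h2] i j; apply: (@connected_trans _ _ _ (head 0 x)).
  by apply: connected_sym; have [->|[i' ->]] := oP i; rewrite ?t1 ?t2.
by have [->|[i' ->]] := oP j; rewrite ?t1 ?t2.
Qed.

(** The approximating event [F] asks for all connections inside the box; what it misses is covered
    by one far event for each point of [x]. *)
Lemma kpoint_ratio_cvg (k : nat) (x : k.-tuple 'rV[int]_d) : (0 < k)%N ->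
  cvg (kpoint_ratio mu x z @[z --> @near_infinity R d]).
Proof.
move=> k0; set x1 := head 0 x.
have [Cf HCf] := choice (fun i : 'I_k => let: ex_intro2 C C0 H :=
  far_event_le d6 A0 hT p01 hmu x1 (tnth x i) in ex_intro _ C (conj C0 H)).
have PF := near_infinity_proper R d0.
apply: cvg_of_approx => eps e0.
pose C := 1 + \sum_i Cf i.
have Cf0 i : 0 <= Cf i by have [/ltW] := HCf i.
have C0 : 0 < C by rewrite ltr_pwDl// sumr_ge0.
have q4 : (0 : R) < 1 / 4 by lra.
have [n Hn] := powRN_small q4 (divr_gt0 e0 C0).
set q := _ `^ _ in Hn.
pose F := [set w : edge d L -> bool | forall i : 'I_k,
   connected_by (restr (box_edges d L n) w : config d L) x1 (tnth x i)].
have cF : cylinder F.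
  exact: (@cylinder_restr d L (box_edges d L n) [set w | forall i : 'I_k,
   connected_by (w : config d L) x1 (tnth x i)]).
have [l Hl] := cylinder_cond_cvg x1 cF.
exists (fun z => fine (mu (F `&` conn x1 z)) / tau mu x1 z), l; split => //.
have hfar : \forall z \near @near_infinity R d, forall i : 'I_k,
    fine (mu (far_event n x1 (tnth x i) z)) <= Cf i * q * tau mu x1 z.
  apply: filter_forall => i; have [_] := HCf i.
  by apply: filterS => z /(_ n).
apply: filterS2 (tau_gt0_near x1) hfar => z tz far.
rewrite /kpoint_ratio kpoint2E -/x1 -mulrBl.
have mF : measurable (F `&` conn x1 z : set (config d L)).
  by apply: measurableI; [exact: measurable_cylinder|exact: conn_measurable].
have mI := measurable_one_cluster [tuple of rcons x z].
set I := in_one_cluster _ in mI *.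
have FI : F `&` conn x1 z `<=` I.
  rewrite /I one_cluster_rcons// => w [Fw xz]; split => // i.
  by have := Fw i; apply: increasing_conn; exact: restr_le.
have mIF : measurable (I `\` (F `&` conn x1 z) : set (config d L)) by exact: measurableD.
have sub : I `\` (F `&` conn x1 z) `<=`
    \bigcup_(i in [set: 'I_k]) far_event n x1 (tnth x i) z.
  rewrite /I one_cluster_rcons// => w [[h xz] nF].
  have /existsNP[i hi] : ~ F w by move=> Fw; apply: nF.
  by exists i => //; split=> //; split => //; exact: h.
have hle : (mu (I `\` (F `&` conn x1 z)) <= (\sum_i Cf i * q * tau mu x1 z)%:E)%E.
  apply: le_trans (measure_le_esum mu _ mIF sub) _.
    by move=> i; exact: measurable_far_event.
  rewrite (_ : [set: 'I_k] = [set` enum 'I_k]); last first.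
    by apply/seteqP; split => // i _ /=; rewrite mem_enum.
  rewrite esum_seq ?enum_uniq// big_enum /= -sumEFin; apply: lee_sum => i _.
  rewrite -[leLHS]fineK ?lee_fin//.
  by apply: fin_num_measure; exact: measurable_far_event.
have diff : fine (mu I) - fine (mu (F `&` conn x1 z)) = fine (mu (I `\` (F `&` conn x1 z))).
  have E : mu I = (mu (F `&` conn x1 z) + mu (I `\` (F `&` conn x1 z)))%E.
    rewrite -measureU//; first by congr (mu _); rewrite setDUK.
    by rewrite setDE setICA setICr setI0.
  by rewrite E fineD ?fin_num_measure// addrC addKr.
rewrite /kpoint diff ger0_norm; last by rewrite divr_ge0 ?fine_ge0// ltW.
rewrite ler_pdivrMr//; move: hle; rewrite -[leLHS]fineK ?fin_num_measure// lee_fin => /le_trans; apply.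
rewrite -mulr_suml ler_wpM2r ?(ltW tz)// -mulr_suml.
apply: (@le_trans _ _ (C * q)).
  by rewrite ler_wpM2r ?powR_ge0// /C lerDr.
by move: Hn; rewrite ler_pdivlMr// mulrC.
Qed.

End kpoint.

(** * The vertex factor *)

Lemma critical_probability_itv (R : realType) (d L : nat)
    (P : R -> probability (config d L) R) : 0 <= critical_probability P <= 1.
Proof.
rewrite /critical_probability; set S := [set p | _].
have lb : lbound S 0 by move=> p [/andP[]].
(* The infimum of the empty set is 0 by convention, which still lies in the interval. *)
have [->|/set0P[p Sp]] := eqVneq S set0; first by rewrite inf0 lexx ler01.
apply/andP; split; first by apply: lb_le_inf => //; exists p.
have [/andP[_ p1] _] := Sp; apply: le_trans p1.
by apply: ge_inf Sp; exists 0.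
Qed.

Lemma open_edge_step (d L : nat) (x : 'rV[int]_d) e : (1 <= L)%N ->
  open_edge ((fun=> true) : config d L) x (x + walk_step e).
Proof.
move=> L1; rewrite /open_edge insubT//; apply/asboolP; exists x, (x + walk_step e).
case: e => i s; split => //.
  rewrite -subr_eq0 opprD addrA subrr add0r oppr_eq0.
  by apply/eqP => /rowP/(_ i); rewrite walk_stepE eqxx mxE; case: s.
apply: leq_trans L1; rewrite /l1dist (bigD1 i)//= big1 => [|j ji].
  by rewrite mxE walk_stepE eqxx opprD addrA subrr add0r; case: s.
by rewrite mxE walk_stepE (negPf ji) addr0 subrr.
Qed.

Lemma connected_full (d L : nat) (x y : 'rV[int]_d) : (1 <= L)%N ->
  connected_by ((fun=> true) : config d L) x y.
Proof.
move=> L1; rewrite -(subrK x y) addrC; move: (y - x); apply: step_ind.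
  by rewrite addr0; exact: connected_refl.
move=> v e h; apply: connected_trans h _; rewrite addrA.
by apply: connected_edge; exact: open_edge_step.
Qed.

Lemma bernoulli_open (R : realType) (d L : nat) (p : R)
    (mu : probability (config d L) R) (S : {fset edge d L}) :
  bernoulli_percolation p mu ->
  mu [set w : config d L | {in S, w =1 (fun=> true)}] = (\prod_(e <- S) p)%:E.
Proof. by move=> ->. Qed.

(** With all edges open the graph is connected, and finitely many of its edges already join the
    given points; these are all open with positive probability. *)
Lemma kpoint_gt0 (R : realType) (d L k : nat) (p : R)
    (mu : probability (config d L) R) (x : k.-tuple 'rV[int]_d) :
  (1 <= L)%N -> 0 < p -> bernoulli_percolation p mu -> 0 < kpoint mu x.
Proof.
move=> L1 p0 hmu.
have ex (ij : 'I_k * 'I_k) : exists N,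
    connected_by (restr (initial_seq (edge d L) N) (fun=> true) : config d L)
      (tnth x ij.1) (tnth x ij.2).
  by apply: (@finitary_conn d L (tnth x ij.1) (tnth x ij.2)); exact: connected_full.
have [Nf HN] := choice ex; pose N := \max_ij Nf ij.
pose S := [fset e in initial_seq (edge d L) N]%fset.
have sub : [set w : config d L | {in S, w =1 (fun=> true)}] `<=` in_one_cluster x.
  move=> w hw i j; apply: increasing_conn (HN (i, j)) => e /andP[_ eN].
  apply: hw; rewrite in_fset /=; apply: initial_seqS eN.
  exact: (leq_bigmax (i, j)).
have mS : measurable ([set w : config d L | {in S, w =1 (fun=> true)}] : set (config d L)).
  by apply: measurable_cylinder; exact: cylinder_eq.
rewrite /kpoint -lte_fin fineK; last by apply: fin_num_measure; exact: measurable_one_cluster.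
apply: (@lt_le_trans _ _ (mu [set w : config d L | {in S, w =1 (fun=> true)}])).
  by rewrite (bernoulli_open S hmu) lte_fin; apply: prodr_gt0.
by apply: le_measure; rewrite ?inE//; exact: measurable_one_cluster.
Qed.

Lemma tau_p0 (R : realType) (d L : nat) (mu : probability (config d L) R)
    (x y : 'rV[int]_d) :
  bernoulli_percolation 0 mu -> x != y -> tau mu x y = 0.
Proof.
move=> hmu xy; apply/eqP; rewrite eq_le tau_ge0 andbT -lee_fin tauE.
pose O e := [set w : config d L | {in [fset e]%fset, w =1 (fun=> true)}].
have sub : conn x y `<=` \bigcup_(e in setT) O e.
  move=> w [[|a s] [/= + E]]; first by move: xy; rewrite E eqxx.
  rewrite /open_edge; case: insubP => // e _ _ /andP[we _]; exists e => //.
  by move=> f; rewrite in_fset1 => /eqP ->.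
have mO e : measurable (O e) by apply: measurable_cylinder; exact: cylinder_eq.
apply: le_trans (measure_le_esum mu mO (conn_measurable _ _) sub) _.
rewrite esum1// => e _; rewrite /O (bernoulli_open _ hmu).
by rewrite big_seq_fset1.
Qed.

(** At p = 0 distinct points are almost surely not connected, whereas the asymptotics make [tau]
    positive far away. *)
Lemma p_gt0 (R : realType) (d L : nat) (mu : probability (config d L) R) (A p : R) :
  (6 < d)%N -> 0 < A -> two_point_asymptotics mu A -> 0 <= p ->
  bernoulli_percolation p mu -> 0 < p.
Proof.
move=> d6 A0 hT p0 hmu; rewrite lt_def p0 andbT; apply/negP => /eqP pE.
rewrite pE in hmu.
have PF := near_infinity_proper R (ltn_trans (isT : 0 < 6)%N d6).
have [z [tz]] := filter_ex (filterI (tau_gt0_near d6 A0 hT (0 : 'rV[int]_d))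
  (@near_infinity_ge R d 1)).
have [->|z0] := eqVneq z 0.
  rewrite /sqnorm big1 => [|i _]; last by rewrite mxE expr0n.
  by rewrite ler10.
by move=> _; move: tz; rewrite (tau_p0 hmu) ?ltxx// eq_sym.
Qed.

Lemma min_separation_ge (R : realType) (d k : nat) (x : k.-tuple 'rV[int]_d) (M : R) :
  (2 <= k)%N ->
  (forall i j : 'I_k, i != j -> M <= enorm R (tnth x i - tnth x j)) ->
  M <= min_separation R x.
Proof.
move=> k2 H; apply: lb_le_inf; last by move=> _ [[i j] /= ij <-]; exact: H.
have k1 : (0 < k)%N by exact: ltnW.
by eexists; exists (Ordinal k1, Ordinal k2).
Qed.

Lemma min_separation_le (R : realType) (d k : nat) (x : k.-tuple 'rV[int]_d)
    (i j : 'I_k) :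
  i != j -> min_separation R x <= enorm R (tnth x i - tnth x j).
Proof.
move=> ij; apply: ge_inf; last by exists (i, j).
by exists 0 => _ [[i' j'] _ <-]; exact: sqrtr_ge0.
Qed.

Lemma well_separated_ex (R : realType) (d k : nat) (M : R) : (0 < d)%N -> (2 <= k)%N ->
  exists x : k.-tuple 'rV[int]_d, M <= min_separation R x.
Proof.
move=> d0 k2; pose n := (Num.truncn M).+1; pose c := Ordinal d0.
pose pt (i : nat) : 'rV[int]_d := (n * i)%:Z *: delta_mx 0 c.
exists [tuple pt i | i < k]; apply: min_separation_ge => // i j ij.
rewrite !tnth_mktuple enormE; apply: le_trans (ltW (truncnS_gt M)) _.
rewrite -/n -[n%:R](@ger0_norm R)// -sqrtr_sqr ler_wsqrtr//.
rewrite /sqnorm (bigD1 c)//= !mxE !eqxx !mulr1.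
apply: ler_wpDr; first by apply: sumr_ge0 => l _; exact: sqr_ge0.
have h : n%:Z ^+ 2 <= ((n * i)%:Z - (n * j)%:Z) ^+ 2.
  rewrite !PoszM -mulrBr exprMn ler_peMr ?sqr_ge0//.
  have : (i : nat) != j by []; move: (i : nat) (j : nat) => a b ab; nia.
by move: h; rewrite -(ler_int R) !rmorphXn.
Qed.

(** Gives access to the quotient form of [asymptotic]: in the other case [kpoint] would vanish at
    well separated points, against [kpoint_gt0]. *)
Lemma tree_green_neq0 (R : realType) (d L k : nat) (A V p : R)
    (mu : probability (config d L) R) :
  (0 < d)%N -> (1 <= L)%N -> (2 <= k)%N -> 0 < p -> bernoulli_percolation p mu ->
  vertex_factor mu A V ->
  ~ (forall x : k.-tuple 'rV[int]_d,
      V ^+ (k - 2) * A ^+ (2 * k - 3) * tree_green R x = 0).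
Proof.
move=> d0 L1 k2 p0 hmu hV g0; have [/(_ g0)[M _ HM] _] := hV k k2.
have [x hx] := well_separated_ex M d0 k2.
by have := kpoint_gt0 x L1 p0 hmu; rewrite (HM x hx) ltxx.
Qed.

Lemma Tr_neq0 (R : realType) (d L k : nat) (A V p : R)
    (mu : probability (config d L) R) :
  (0 < d)%N -> (1 <= L)%N -> (2 <= k)%N -> 0 < p -> bernoulli_percolation p mu ->
  vertex_factor mu A V -> Tr k != finset.set0.
Proof.
move=> d0 L1 k2 p0 hmu hV; apply/negP => /eqP Tr0.
apply: (tree_green_neq0 d0 L1 k2 p0 hmu hV) => x.
by rewrite /tree_green Tr0 big_set0 mulr0.
Qed.

Lemma dist_cvg_le (R : realType) (T : Type) (F : set_system T) (f : T -> R)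
    (a l eps : R) : ProperFilter F -> f t @[t --> F] --> l ->
  (\forall t \near F, `|a - f t| <= eps) -> `|a - l| <= eps.
Proof.
move=> PF /cvgrPdist_le fl fa; apply/ler_addgt0Pr => e e0.
have [t [h1 h2]] := filter_ex (filterI fa (fl _ e0)).
rewrite (_ : a - l = (a - f t) - (l - f t)); last by ring.
by apply: le_trans (ler_normB _ _) (lerD h1 h2).
Qed.

(** Allows z to tend to infinity with [x] fixed: a threshold met by [x] is met by [rcons x z] for
    all far z. *)
Lemma near_min_separation (R : realType) (d k : nat) (x : k.-tuple 'rV[int]_d) (M : R) :
  (2 <= k)%N -> M <= min_separation R x ->
  \forall z \near @near_infinity R d, M <= min_separation R [tuple of rcons x z].
Proof.
move=> k2 hx; have far : \forall z \near @near_infinity R d,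
    forall i : 'I_k, M <= enorm R (tnth x i - z) /\ M <= enorm R (z - tnth x i).
  apply: filter_forall => i.
  have farM : \forall xy \near @far_apart R d, M <= enorm R (xy.1 - xy.2) by exists M.
  have := near_far_apart (tnth x i) farM; apply: filterS => z /= h; split => //.
  by rewrite -opprB enormE sqnormN.
apply: filterS far => z hz; apply: min_separation_ge => [|i j ij]; first exact: ltnW.
have tE (l : 'I_k) (l' : 'I_k.+1) : l' = l :> nat -> tnth [tuple of rcons x z] l' = tnth x l.
  by move=> E; rewrite !(tnth_nth 0) /= nth_rcons size_tuple E ltn_ord.
have t2 (l' : 'I_k.+1) : l' = k :> nat -> tnth [tuple of rcons x z] l' = z.
  by move=> E; rewrite (tnth_nth 0) /= nth_rcons size_tuple E ltnn eqxx.
have := ltn_ord i; rewrite ltnS leq_eqVlt => /orP[/eqP iE|ik];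
  have := ltn_ord j; rewrite ltnS leq_eqVlt => /orP[/eqP jE|jk].
- by move: ij; rewrite -val_eqE /= iE jE eqxx.
- by rewrite (t2 _ iE) (tE (Ordinal jk) j)//; have [] := hz (Ordinal jk).
- by rewrite (t2 _ jE) (tE (Ordinal ik) i)//; have [] := hz (Ordinal ik).
- rewrite (tE (Ordinal jk) j)// (tE (Ordinal ik) i)//; apply: le_trans hx _.
  exact: min_separation_le.
Qed.

Theorem corollary1p13 (R : realType) (d L : nat) (A V : R)
    (P : R -> probability (config d L) R)
    (hd : (6 < d)%N) (hL : (1 <= L)%N) (hA : 0 < A) (hV : 0 < V)
    (hP : forall p : R, 0 <= p <= 1 -> bernoulli_percolation p (P p))
    (hTwoPoint : two_point_asymptotics (P (critical_probability P)) A)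
    (hTwoBlob : two_blob_estimate (P (critical_probability P)))
    (hVertex : vertex_factor (P (critical_probability P)) A V)
    (k : nat) (hk : (2 <= k)%N) :
  (* the limits that define T_IIC and G_IIC exist *)
  (forall x : k.-tuple 'rV[int]_d,
     cvg (kpoint_ratio (P (critical_probability P)) x z
            @[z --> @near_infinity R d]) /\
     cvg (green_ratio R x z @[z --> @near_infinity R d])) /\
  asymptotic (@well_separated R d k)
    (fun x => T_IIC (P (critical_probability P)) x)
    (fun x => V ^+ (k - 1) * A ^+ (2 * k - 2) * G_IIC R x).
Proof.
have p01 := critical_probability_itv P.
set p := critical_probability P in p01 hTwoPoint hTwoBlob hVertex *.
have hmu := hP p p01; set mu := P p in hTwoPoint hTwoBlob hVertex hmu *.
have d0 : (0 < d)%N by exact: ltn_trans hd.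
have tr : transient R d by apply: transientP; exact: ltn_trans hd.
have p0 : 0 < p by apply: (p_gt0 hd hA hTwoPoint _ hmu); have /andP[] := p01.
have k0 : (0 < k)%N by exact: ltnW.
have PF := near_infinity_proper R d0.
have cT (x : k.-tuple 'rV[int]_d) : cvg (kpoint_ratio mu x z @[z --> @near_infinity R d]).
  exact: (kpoint_ratio_cvg hd hA hTwoPoint p01 hmu hTwoBlob).
have Tr0 : Tr k.+1 != finset.set0.
  by apply: (Tr_neq0 d0 hL _ p0 hmu hVertex); exact: ltnW.
have cG (x : k.-tuple 'rV[int]_d) : cvg (green_ratio R x z @[z --> @near_infinity R d]).
  by have [] := green_ratio_limit R x hd hk.
have G0 (x : k.-tuple 'rV[int]_d) : exists2 c : R, 0 < c &
    \forall z \near @near_infinity R d, c <= green_ratio R x z.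
  by have [_ /(_ Tr0)] := green_ratio_limit R x hd hk.
have G_gt0 (x : k.-tuple 'rV[int]_d) : 0 < G_IIC R x.
  have [c c0 Hc] := G0 x; apply: lt_le_trans c0 _.
  by apply: limr_ge => //; exact: cG.
pose c := V ^+ (k - 1) * A ^+ (2 * k - 2).
have c0 : 0 < c by rewrite mulr_gt0// exprn_gt0.
(* The surplus factor [A] is the amplitude of the two-point function at (x_1, z). *)
have cE : V ^+ (k.+1 - 2) * A ^+ (2 * k.+1 - 3) = c * A.
  rewrite /c -mulrA -exprSr; congr (_ ^+ _ * _ ^+ _); lia.
split => //; split.
  have [x _] := well_separated_ex (0 : R) d0 hk.
  by move=> /(_ x)/eqP; rewrite -/c mulf_eq0 !gt_eqF.
move=> _; apply/cvgrPdist_le => eps e0.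
have hk1 : (2 <= k.+1)%N by exact: ltnW.
have [_ /(_ (tree_green_neq0 d0 hL hk1 p0 hmu hVertex))] := hVertex k.+1 hk1.
move=> /cvgrPdist_le/(_ _ e0)[M _ HM].
exists M => // x hx; rewrite -/c.
set x1 := head 0 x.
(* The quotient controlled by the vertex factor at (x, z), regrouped so that each factor has a limit
   in z. The bound [eps] holds for all far z as soon as [x] is [M]-separated, hence passes to the
   limit. *)
pose h z := kpoint_ratio mu x z / green_ratio R x z *
  (tau mu x1 z / (A * green R x1 z)) * c^-1.
have hcvg : h z @[z --> @near_infinity R d] --> T_IIC mu x / G_IIC R x * 1 * c^-1.
  apply: cvgM; last exact: cvg_cst.
  apply: cvgM; last exact: (tau_ratio hd hA hTwoPoint).
  apply: cvgM; first exact: cT.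
  by apply: cvgV; [rewrite gt_eqF|exact: cG].
have -> : T_IIC mu x / (c * G_IIC R x) = T_IIC mu x / G_IIC R x * 1 * c^-1.
  by field; rewrite !gt_eqF.
apply: (dist_cvg_le PF hcvg).
have [cg cg0 Hcg] := G0 x.
apply: filterS3 (near_min_separation hk hx) (tau_gt0_near hd hA hTwoPoint x1) Hcg.
move=> z hxz tz gz; have := HM _ hxz; rewrite cE; congr (`|_ - _| <= _).
have g0 : 0 < green R x1 z by exact: green_gt0.
have gr0 : green_ratio R x z != 0 by rewrite gt_eqF// (lt_le_trans cg0).
have -> : tree_green R [tuple of rcons x z] = green_ratio R x z * green R x1 z.
  by rewrite /green_ratio divfK// gt_eqF.
have -> : kpoint mu [tuple of rcons x z] = kpoint_ratio mu x z * tau mu x1 z.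
  by rewrite /kpoint_ratio kpoint2E divfK// gt_eqF.
by rewrite /h; field; rewrite gr0 !gt_eqF.
Qed.
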